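(* Let $p \equiv 5 \pmod 8$ be prime. Then $\mathrm{OP}(F)$ has a solution for every 2-regular graph $F$ of order $2p$; that is, for every 2-regular graph $F$ of order $2p$ there is a 1-factor $I$ of $K_{2p}$ such that $K_{2p}-I$ has a factorisation into $F$.
   Context: A factor of a graph is a spanning subgraph; a factorisation is a decomposition of the edge set into edge-disjoint factors; a factorisation into $F$ is one in which every factor is isomorphic to $F$. For a 2-regular graph $F$ of order $n$, the Oberwolfach Problem $\mathrm{OP}(F)$ asks, for $n$ odd, for a factorisation of $K_n$ into $F$, and for $n$ even, for a factorisation of $K_n - I$ into $F$, where $K_n-I$ is $K_n$ with the edges of a 1-factor (perfect matching) $I$ removed. *)

(* Defs.v *)
From mathcomp Require Import all_boot.

Set Implicit Arguments.
Unset Strict Implicit.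
Unset Printing Implicit Defensive.

Record sgraph (V : finType) := SGraph {
  adj : rel V;
  adj_sym : symmetric adj;
  adj_irrefl : irreflexive adj
}.

Definition edges (V : finType) (G : sgraph V) : {set {set V}} :=
  [set [set u.1; u.2] | u in [set u : V * V | adj G u.1 u.2]].

Definition regular (V : finType) (k : nat) (G : sgraph V) : Prop :=
  forall x : V, #|[set y | adj G x y]| = k.

Definition isomorphic (V W : finType) (G : sgraph V) (H : sgraph W) : Prop :=
  exists2 f : V -> W, bijective f &
    forall x y : V, adj H (f x) (f y) = adj G x y.

Lemma complete_sym n : symmetric (fun x y : 'I_n => x != y).
Proof. by move=> x y; rewrite eq_sym. Qed.

Lemma complete_irrefl n : irreflexive (fun x y : 'I_n => x != y).
Proof. by move=> x; rewrite eqxx. Qed.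

Definition complete_graph (n : nat) : sgraph 'I_n :=
  SGraph (@complete_sym n) (@complete_irrefl n).

Section DelEdges.
Variables (V : finType) (G H : sgraph V).

Lemma del_edges_sym : symmetric (fun x y => adj G x y && ~~ adj H x y).
Proof. by move=> x y; rewrite (adj_sym G) (adj_sym H). Qed.

Lemma del_edges_irrefl : irreflexive (fun x y => adj G x y && ~~ adj H x y).
Proof. by move=> x; rewrite adj_irrefl. Qed.

Definition del_edges : sgraph V := SGraph del_edges_sym del_edges_irrefl.
End DelEdges.

(* A factor has the same vertex type as the ambient graph, hence is spanning. *)
Definition factor (V : finType) (G H : sgraph V) : Prop :=
  edges H \subset edges G.

Definition one_factor (V : finType) (G I : sgraph V) : Prop :=
  factor G I /\ regular 1 I.

Definition factorisation (V : finType) (G : sgraph V) (k : nat)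
    (H : 'I_k -> sgraph V) : Prop :=
  [/\ forall i, factor G (H i),
      forall i j, i != j -> [disjoint edges (H i) & edges (H j)]
    & \bigcup_(i < k) edges (H i) = edges G].

Definition has_factorisation_into (V W : finType) (G : sgraph V)
    (F : sgraph W) : Prop :=
  exists (k : nat) (H : 'I_k -> sgraph V),
    factorisation G H /\ forall i, isomorphic F (H i).

(* OP(F) has a solution; meaningful when F is 2-regular. *)
Definition OP_solvable (V : finType) (F : sgraph V) : Prop :=
  let K := complete_graph #|V| in
  if odd #|V| then has_factorisation_into K F
  else exists I : sgraph 'I_#|V|,
    one_factor K I /\ has_factorisation_into (del_edges K I) F.

(* Main.v *)
Require Import Defs.
From mathcomp Require Import all_boot all_order all_algebra.
From mathcomp Require Import zify ring.

Set Implicit Arguments.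
Unset Strict Implicit.
Unset Printing Implicit Defensive.
Import GRing.Theory.

(** A family of (n - 2) / 2 copies of F covering all edges of K_n - I is
    automatically a factorisation, so only coverage has to be proved.

    Let chi(x) = x^((p-1)/4) on F_p.  As p = 5 mod 8, chi(2) is a primitive fourth
    root of unity and chi(-1) = -1.  If an arithmetic progression x0, x0 + d, x0 + 2d,
    x0 + 3d meets the four classes of chi, then the multiples by g in ker chi of the
    bicirculant graph on F_p x {0, 1} with differences d, 2d inside both copies of F_p
    and x0 + jd across partition K_2p - I; each of them is isomorphic to
    Circ(2p, {1, 2, 3, 4}).  For p > 13 a progression is found among eighteen
    progressions of 13-smooth integers, whatever the classes of 3, 5, 7, 11, 13.
    For p = 13 there is none, and order 26 is settled by a table.

    Circ(n, {1, 2, 3, 4}) is factored into four copies of F by laying the cycles of F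
    one after the other along the strip, in blocks that start and end at the same cut.
    Two cuts are used, one for F with many triangles and one for F with many 4-cycles;
    long cycles come from a periodic pattern.

    This fails only for triangles and a single 4-cycle.  Then p = 5 mod 24 and there is
    a Steiner system S(2, 4, p - 1), from truncated transversal designs; replacing each
    of its blocks by a Kirkman frame of type 2^4 gives the factorisation. *)

(** * From coverings to factorisations *)

(** The condition p = 5 mod 8 makes 1, -1, 2, -2 represent the four classes of chi. Inside a side,
    where differences count up to sign, d and 2d therefore suffice; across, where a difference has a
    direction, one representative per class is needed, hence four terms of a progression. The count
    is exact: (p - 1) / 4 multipliers with four factors each. Smooth integers make the search
    uniform in p: chi is multiplicative and its values are powers of chi(2), so 4^5 assignments of
    exponents to 3, 5, 7, 11, 13 settle all p > 13. On the strip the obstacle is to find a cut at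
    which every cycle is closed. If an edge belonged to the side of its smaller end, some vertices
    at a cut would have odd degree; grouping the edges into 4-cycles keeps all degrees even. Blocks
    between equal cuts can then be concatenated in any order, so finitely many tiles and a few
    periodic families suffice. That 2p is divisible by neither 3 nor 4 excludes leftover types of
    the division into tiles, for instance an odd number of 4-cycles and nothing else. *)

Lemma mem_edges (V : finType) (G : sgraph V) x y :
  ([set x; y] \in edges G) = adj G x y.
Proof.
apply/imsetP/idP => [[[u v]]|xy]; last by exists (x, y); rewrite ?inE.
rewrite inE /= => uv /setP e.
have uv' : u != v by apply: contraTneq uv => ->; rewrite adj_irrefl.
have : (x \in [set u; v]) && (y \in [set u; v]) by rewrite -!e !inE !eqxx orbT.
have : (u \in [set x; y]) && (v \in [set x; y]) by rewrite !e !inE !eqxx orbT.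
rewrite !inE => /andP[eu ev] /andP[/orP[]/eqP ex /orP[]/eqP ey];
  move: eu ev; subst; rewrite ?eqxx ?orbT ?orbb ?(negbTE uv') ?(eq_sym v) ?(negbTE uv') //.
by rewrite adj_sym.
Qed.

Lemma edgesP (V : finType) (G : sgraph V) (e : {set V}) :
  reflect (exists x y, e = [set x; y] /\ adj G x y) (e \in edges G).
Proof.
apply: (iffP imsetP) => [[[u v]]|[x [y [-> xy]]]]; last by exists (x, y); rewrite ?inE.
by rewrite inE /= => uv ->; exists u, v.
Qed.

Section Pullback.
Variables (V W : finType) (F : sgraph V) (g : W -> V).

Lemma pullback_sym : symmetric (fun x y => adj F (g x) (g y)).
Proof. by move=> x y; rewrite adj_sym. Qed.

Lemma pullback_irrefl : irreflexive (fun x y => adj F (g x) (g y)).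
Proof. by move=> x; rewrite adj_irrefl. Qed.

Definition pullback : sgraph W := SGraph pullback_sym pullback_irrefl.
End Pullback.

Section Mate.
Variables (X : finType) (mate : X -> X).
Hypotheses (mateK : involutive mate) (mate_neq : forall x, mate x != x).

Lemma mate_sym : symmetric (fun x y => y == mate x).
Proof. by move=> x y; apply/eqP/eqP => ->; rewrite mateK. Qed.

Lemma mate_irrefl : irreflexive (fun x y => y == mate x).
Proof. by move=> x; rewrite eq_sym (negbTE (mate_neq x)). Qed.

Definition mate_graph : sgraph X := SGraph mate_sym mate_irrefl.
End Mate.

(* There are just enough edges, so a family of copies of F that covers every
   edge of K_n - I covers each of them exactly once, and covers no edge of I. *)
Lemma OP_of_embeddings (V X J : finType) (F : sgraph V) (mate : X -> X)
    (f : J -> V -> X) :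
    #|X| = #|V| -> ~~ odd #|V| -> regular 2 F -> 2 * #|J| + 2 <= #|V| ->
    involutive mate -> (forall x, mate x != x) ->
    (forall j, injective (f j)) ->
    (forall x y, x != y -> y != mate x ->
       exists j u v, [/\ adj F u v, f j u = x & f j v = y]) ->
  OP_solvable F.
Proof.
move=> cardX evenV regF cardJ mateK mate_neq f_inj cover.
rewrite /OP_solvable (negbTE evenV).
have [e [e' eK e'K]] : exists e : X -> 'I_#|V|, exists2 e', cancel e e' & cancel e' e.
  exists (fun x => cast_ord cardX (enum_rank x)), (fun i => enum_val (cast_ord (esym cardX) i)).
    by move=> x; rewrite cast_ordK enum_rankK.
  by move=> i; rewrite enum_valK cast_ordKV.
pose mt i := e (mate (e' i)).
have mtK : involutive mt by move=> i; rewrite /mt eK mateK e'K.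
have mt_neq i : mt i != i by rewrite -(can_eq e'K) /mt eK mate_neq.
pose h j u := e (f j u).
have h_inj j : injective (h j) by move=> u v /(can_inj eK)/f_inj.
have h_bij j : bijective (h j) by apply: inj_card_bij => //; rewrite card_ord.
have coverh (x y : 'I_#|V|) : x != y -> y != mt x ->
    exists j u v, [/\ adj F u v, h j u = x & h j v = y].
  move=> xy ym; have [||j [u [v [uv fu fv]]]] := cover (e' x) (e' y).
  - by rewrite (can_eq e'K).
  - by rewrite -(can_eq eK) e'K.
  - by exists j, u, v; rewrite /h fu fv !e'K.
(* [A] consists of the arcs of K_n - I, [B] of the pairs of an index and an arc of F. Since [cardJ]
   gives [#|B| <= #|A|], a map from [B] whose image contains [A] is a bijection onto [A]: this
   yields disjointness and keeps the copies off I. *)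
pose A := [set d : 'I_#|V| * 'I_#|V| | (d.1 != d.2) && (d.2 != mt d.1)].
pose B := [set t : J * (V * V) | adj F t.2.1 t.2.2].
pose m (t : J * (V * V)) := (h t.1 t.2.1, h t.1 t.2.2).
have subA : A \subset m @: B.
  apply/subsetP => -[x y]; rewrite inE /= => /andP[xy ym].
  have [j [u [v [uv hu hv]]]] := coverh x y xy ym.
  by apply/imsetP; exists (j, (u, v)); rewrite ?inE //= /m /= hu hv.
have cardB : #|B| = #|J| * (2 * #|V|).
  rewrite -sum1_card; under eq_bigl do rewrite inE.
  rewrite -(pair_big_dep xpredT (fun _ (d : V * V) => adj F d.1 d.2) (fun _ _ => 1)) /=.
  rewrite -sum_nat_const; apply: eq_bigr => j _.
  rewrite -(pair_big_dep xpredT (fun u v => adj F u v) (fun _ _ => 1)) /=.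
  rewrite mulnC -sum_nat_const; apply: eq_bigr => u _.
  by rewrite sum1_card -(regF u) cardsE.
have cardA : #|A| = #|V| * (#|V| - 2).
  rewrite -sum1_card; under eq_bigl do rewrite inE.
  rewrite -(pair_big_dep xpredT (fun x y => (x != y) && (y != mt x)) (fun _ _ => 1)) /=.
  rewrite -[X in X * _](card_ord #|V|) -sum_nat_const; apply: eq_bigr => x _.
  rewrite sum1_card.
  have -> : #|[pred y | (x != y) && (y != mt x)]| = #|~: [set x; mt x]|.
    by apply: eq_card => y; rewrite !inE negb_or eq_sym.
  by have := cardsC [set x; mt x]; rewrite cards2 eq_sym mt_neq card_ord; lia.
have BA : #|B| <= #|A| by rewrite cardB cardA; nia.
have imA : m @: B = A.
  by apply/esym/eqP; rewrite eqEcard subA (leq_trans (leq_imset_card _ _)).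
have m_inj : {in B &, injective m}.
  apply/imset_injP; rewrite imA eqn_leq BA andbT -imA; exact: leq_imset_card.
have inA j u v : adj F u v -> (h j u != h j v) && (h j v != mt (h j u)).
  move=> uv; have : m (j, (u, v)) \in A by rewrite -imA imset_f // inE.
  by rewrite inE.
exists (mate_graph mtK mt_neq); split.
  split.
    apply/subsetP => E /edgesP[x [y [-> /eqP ->]]].
    by rewrite mem_edges /= eq_sym.
  by move=> x; rewrite -(cards1 (mt x)); apply: eq_card => y; rewrite !inE.
have g_ex j := h_bij j.
have [g gP] : exists g : {ffun J -> {ffun 'I_#|V| -> V}},
    forall j, cancel (g j) (h j) /\ cancel (h j) (g j).
  have gx j : exists gj : {ffun 'I_#|V| -> V}, cancel gj (h j) /\ cancel (h j) gj.
    by have [g0 K1 K2] := h_bij j; exists [ffun x => g0 x]; split=> x; rewrite ffunE.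
  by have [g0 g0P] := fin_all_exists gx; exists [ffun j => g0 j] => j; rewrite ffunE.
exists #|J|, (fun i => pullback F (g (enum_val i))); split; last first.
  move=> i; exists (h (enum_val i)); first exact: h_bij.
  by move=> u v; rewrite /= (gP _).2 (gP _).2.
split.
- move=> i; apply/subsetP => E /edgesP[x [y [-> /= xy]]]; rewrite mem_edges /=.
  by have := inA (enum_val i) _ _ xy; rewrite !(gP _).1.
- move=> i j ij; apply/pred0P => E /=; apply/negP => /andP[].
  case/edgesP => x [y [-> /= xyi]]; rewrite mem_edges /= => xyj.
  case/eqP: ij; apply: enum_val_inj.
  have := @m_inj (enum_val i, (g (enum_val i) x, g (enum_val i) y))
                 (enum_val j, (g (enum_val j) x, g (enum_val j) y)).
  by rewrite !inE /m /= !(gP _).1 => /(_ xyi xyj erefl) [].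
- apply/setP => E; apply/bigcupP/idP => [[i _]|].
    case/edgesP => x [y [-> /= xy]]; rewrite mem_edges /=.
    by have := inA (enum_val i) _ _ xy; rewrite !(gP _).1.
  case/edgesP => x [y [-> /= /andP[xy ym]]].
  have [j [u [v [uv hu hv]]]] := coverh x y xy ym.
  exists (enum_rank j) => //; rewrite mem_edges /= enum_rankK -hu -hv.
  by rewrite !(gP _).2.
Qed.

(** * Cycle decomposition of a 2-regular graph *)

Definition consec (T : eqType) (s : seq T) (x y : T) : bool :=
  infix [:: x; y] s || infix [:: y; x] s.

Definition closed_walk (T : Type) (c : seq T) : seq T :=
  if c is a :: _ then rcons c a else [::].

Definition covers (T : eqType) (w : seq (seq T)) (x y : T) : bool :=
  has (fun c => consec (closed_walk c) x y) w.

Lemma consec_sym (T : eqType) (s : seq T) x y : consec s x y = consec s y x.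
Proof. exact: orbC. Qed.

Lemma covers_sym (T : eqType) (w : seq (seq T)) x y : covers w x y = covers w y x.
Proof. by apply: eq_has => c; apply: consec_sym. Qed.

Lemma consec_map (T U : eqType) (g : T -> U) s x y :
  consec s x y -> consec (map g s) (g x) (g y).
Proof.
by case/orP=> /infixP[s1 [s2 ->]]; rewrite /consec map_cat /=;
  apply/orP; [left | right]; apply/infixP; exists (map g s1), (map g s2).
Qed.

Lemma closed_walk_map (T U : Type) (g : T -> U) c :
  closed_walk (map g c) = map g (closed_walk c).
Proof. by case: c => //= a c; rewrite map_rcons. Qed.

Lemma covers_map (T U : eqType) (g : T -> U) w x y :
  covers w x y -> covers (map (map g) w) (g x) (g y).
Proof.
case/hasP=> c cw xy; apply/hasP; exists (map g c); first exact: map_f.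
by rewrite closed_walk_map; apply: consec_map.
Qed.

Lemma covers_cat (T : eqType) (w1 w2 : seq (seq T)) x y :
  covers (w1 ++ w2) x y = covers w1 x y || covers w2 x y.
Proof. exact: has_cat. Qed.

Lemma consec_sorted (T : eqType) (e : rel T) s x y :
  symmetric e -> sorted e s -> consec s x y -> e x y.
Proof.
move=> e_sym se.
have step a b : infix [:: a; b] s -> e a b.
  by case/infixP=> s1 [s2 def_s]; move: se; rewrite def_s => /cat_sorted2[_] /andP[].
by case/orP=> /step //; rewrite e_sym.
Qed.

Lemma consec_map_inv (T U : eqType) (g : T -> U) s x y :
  consec (map g s) x y -> exists u v, [/\ consec s u v, g u = x & g v = y].
Proof.
have inv a b : infix [:: a; b] (map g s) ->
    exists u v, [/\ infix [:: u; v] s, g u = a & g v = b].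
  case/infixP=> s1 [s2]; elim: s s1 => [|z s IHs] [|a' s1] //=.
    case: s {IHs} => [|z' s] //= [<- <- _]; exists z, z'; split=> //.
    exact: (infix_infix [::] [:: z; z'] s).
  case=> _ /IHs[u [v [/infixP[t1 [t2 ->]] gu gv]]]; exists u, v; split=> //.
  exact: (infix_infix (z :: t1) [:: u; v] t2).
case/orP=> /inv[u [v [uv gu gv]]]; [exists u, v | exists v, u]; split=> //;
  by rewrite /consec uv ?orbT.
Qed.

Lemma flatten_shape_inj (T : Type) (w1 w2 : seq (seq T)) :
  shape w1 = shape w2 -> flatten w1 = flatten w2 -> w1 = w2.
Proof. by move=> e1 e2; rewrite -(flattenK w1) -(flattenK w2) e1 e2. Qed.

(** Lists of the same shape correspond position by position; as [flatten cs] has no repetition, a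
    vertex determines its position, so the correspondence is a function. *)
Lemma relabel_cycles (V X : eqType) (cs : seq (seq V)) (w : seq (seq X)) (x0 : X) :
    uniq (flatten cs) -> shape w = shape cs ->
  exists f : V -> X, map (map f) cs = w.
Proof.
move=> ucs sh; exists (fun u => nth x0 (flatten w) (index u (flatten cs))).
apply: flatten_shape_inj.
  by rewrite sh /shape -map_comp; apply: eq_map => c /=; rewrite size_map.
have sz : size (flatten w) = size (flatten cs) by rewrite !size_flatten sh.
rewrite -map_flatten; apply: (@eq_from_nth _ x0); rewrite size_map // => i ilt.
have [u0 _] : exists u0 : V, True by case: (flatten cs) ilt => // u0; exists u0.
by rewrite (nth_map u0) // index_uniq.
Qed.

Lemma perm_shape (T : eqType) (cs : seq (seq T)) L :
  perm_eq (shape cs) L -> exists2 cs', shape cs' = L & perm_eq cs' cs.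
Proof.
rewrite perm_sym => /(perm_iotaP 0)[Is pI ->].
exists (map (nth [::] cs) Is).
  rewrite /shape -map_comp; apply/eq_in_map => i.
  by rewrite (perm_mem pI) mem_iota size_map /= => ilt; rewrite (nth_map [::]).
apply: (perm_trans (perm_map _ pI)).
by rewrite size_map map_nth_iota0 // take_size.
Qed.

Section Cycles.
Variables (V : finType) (F : sgraph V).
Hypothesis regF : regular 2 F.

Lemma third_neighbour x y z t :
  adj F x y -> adj F x z -> adj F x t -> y != z -> (t == y) || (t == z).
Proof.
move=> xy xz xt yz; apply: contraT; rewrite negb_or => /andP[ty tz].
have := regF x; have : #|[set t; y; z]| <= #|[set w | adj F x w]|.
  by apply/subset_leq_card/subsetP => w; rewrite !inE => /orP[/orP[]|] /eqP->.
by rewrite -setUA cardsU1 cards2 !inE yz negb_or ty tz => + e; rewrite e.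
Qed.

Lemma other_neighbour x y : adj F x y -> exists2 z, adj F x z & z != y.
Proof.
move=> xy; have := regF x; rewrite (cardsD1 y) inE xy => -[] /eqP/cards1P[z zP].
by have := set11 z; rewrite -zP !inE => /andP[zy xz]; exists z.
Qed.

Lemma exists_neighbour x : exists y, adj F x y.
Proof.
have /card_gt0P[y] : 0 < #|[set w | adj F x w]| by rewrite regF.
by rewrite inE; exists y.
Qed.

(* A longest path inside a union of components closes up to a cycle. *)
Lemma component_cycle (W : {set V}) x0 :
    x0 \in W -> (forall x y, x \in W -> adj F x y -> y \in W) ->
  exists c, [/\ cycle (adj F) c, uniq c, 2 < size c, {subset c <= W}
              & forall x y, x \in c -> adj F x y -> y \in c].
Proof.
move=> x0W clW.
pose good k := [exists t : k.-tuple V,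
  [&& uniq t, all (mem W) t & if tval t is a :: s then path (adj F) a s else false]].
have good1 : good 1.
  by apply/existsP; exists [tuple x0]; rewrite /= x0W.
have good_bound k : good k -> k <= #|V|.
  case/existsP=> t /and3P[ut _ _]; rewrite -(size_tuple t) -(card_uniqP ut).
  exact: max_card.
case: (ex_maxnP (ex_intro _ 1 good1) good_bound) => k /existsP[[t /= /eqP st]] + kmax.
case: t st => [|a s] /= st; rewrite ?andbF // => /and3P[/andP[as_ us] /andP[aW sW] pas].
have not_longer b : adj F b a -> b \in a :: s.
  move=> ba; apply: contraT => bs.
  have : good k.+1.
    apply/existsP; exists (@Tuple _ _ (b :: a :: s) (introT eqP (congr1 S st))).
    rewrite /= bs as_ us aW sW ba pas !andbT.
    by apply: (clW a) => //; rewrite adj_sym.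
  by move/kmax; rewrite ltnn.
(* A vertex on a cycle of length at least 3 has two distinct neighbours there, and [third_neighbour]
   leaves room for no other. *)
have closed_of_big c : cycle (adj F) c -> uniq c -> 2 < size c ->
    forall x y, x \in c -> adj F x y -> y \in c.
  move=> cc uc sc x y xc xy; have [i c' def_c] := rot_to xc.
  move: cc uc sc; rewrite -(rot_cycle i) -(rot_uniq i) -(size_rot i) -(mem_rot i) def_c.
  case: c' {def_c} => [|z c'] //= /andP[xz]; rewrite rcons_path => /andP[pz zx].
  case: (lastP c') pz zx => [|c'' t] //=; rewrite last_rcons => _ tx.
  rewrite !inE !mem_rcons !inE => /and3P[_ /norP[zt _] _] _.
  by case/orP: (third_neighbour xz (etrans (adj_sym F x t) tx) xy zt) => /eqP->;
    rewrite eqxx ?orbT.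
have [c ac] : exists c, adj F a c by apply: exists_neighbour.
case: s st as_ us sW pas not_longer => [|b s] /= st as_ us sW pas not_longer.
  have := not_longer c; rewrite adj_sym ac inE => /(_ isT)/eqP ca.
  by move: ac; rewrite ca adj_irrefl.
case/andP: pas => ab pbs; have [y ay yb] := other_neighbour ab.
have ya : y != a by apply: contraTneq ay => ->; rewrite adj_irrefl.
have : y \in s.
  by have := not_longer y; rewrite adj_sym ay !inE (negbTE yb) (negbTE ya) => /(_ isT).
move=> ys; case/splitPr def_s: {1}s / ys => [s1 s2].
move: pbs us as_ sW st; rewrite def_s cat_path /= => /and3P[pb1 ly p2].
(* If [y] had a successor [z] on the path, it would have three neighbours: its predecessor
   [last b s1], [z] and [a]. So [y] is the last vertex, and the edge from [y] to [a] closes the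
   path. *)
case: s2 def_s p2 => [|z s2] def_s /= p2 us as_ sW st; last first.
  case/andP: p2 => yz _.
  have lz : last b s1 != z.
    have : uniq ((b :: s1) ++ [:: y, z & s2]) by [].
    rewrite cat_uniq => /and3P[_ /hasPn/(_ z) + _]; rewrite !inE eqxx orbT => /(_ isT).
    by apply: contraNneq => <-; rewrite -in_cons mem_last.
  have := third_neighbour (etrans (adj_sym F y _) ly) yz (etrans (adj_sym F y a) ay) lz.
  move: as_; rewrite inE mem_cat !inE !negb_or => /and5P[ab' as1 _ az _].
  rewrite (negbTE az) orbF => /eqP al; have := mem_last b s1.
  by rewrite -al inE (negbTE ab') (negbTE as1).
exists [:: a, b & rcons s1 y].
have uc : uniq [:: a, b & rcons s1 y] by rewrite -cats1; apply/andP.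
have cc : cycle (adj F) [:: a, b & rcons s1 y].
  by rewrite /= ab rcons_path last_rcons rcons_path pb1 ly adj_sym.
have sc : 2 < size [:: a, b & rcons s1 y] by rewrite /= size_rcons.
split=> //; last exact: (closed_of_big _ cc uc sc).
by move=> x; rewrite -cats1 => xc; have /allP : all (mem W) (a :: b :: s1 ++ [:: y]);
  [rewrite /= aW sW | exact].
Qed.

Lemma cycle_decomposition :
  exists cs : seq (seq V), [/\ perm_eq (flatten cs) (enum V), all (fun c => 2 < size c) cs
    & all (cycle (adj F)) cs].
Proof.
(* Induction on the size of a union [W] of components: after the removal of one component the rest
   is still closed under adjacency. *)
suff dec k (W : {set V}) : #|W| <= k -> (forall x y, x \in W -> adj F x y -> y \in W) ->
    exists cs : seq (seq V), [/\ uniq (flatten cs), flatten cs =i W,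
      all (fun c => 2 < size c) cs & all (cycle (adj F)) cs].
  have [||cs [ucs mcs scs ccs]] := dec #|V| setT; rewrite ?max_card //.
  exists cs; split=> //; apply: uniq_perm => //; first exact: enum_uniq.
  by move=> x; rewrite mcs mem_enum !inE.
elim: k W => [|k IHk] W Wk clW.
  exists [::]; split=> // x; move: Wk; rewrite leqn0 => /eqP/cards0_eq->.
  by rewrite inE.
have [->|[x0 x0W]] := set_0Vmem W.
  by exists [::]; split=> // x; rewrite inE.
have [c [cc uc sc cW clc]] := component_cycle x0W clW.
have [||cs [ucs mcs scs ccs]] := IHk (W :\: [set x in c]).
- rewrite -ltnS; apply: leq_trans Wk; apply: proper_card.
  rewrite properE subsetDl /=; apply/subsetPn.
  case: c sc cW {cc uc clc} => // a c _ cW; exists a; first by rewrite cW ?mem_head.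
  by rewrite !inE eqxx.
- move=> x y; rewrite !inE => /andP[xc xW] xy; rewrite (clW x) // andbT.
  by apply: contra xc => yc; apply: (clc y) => //; rewrite adj_sym.
exists (c :: cs); split=> /=; [ | | by rewrite sc | by rewrite cc].
- rewrite cat_uniq uc ucs andbT /=; apply/hasPn => x; rewrite mcs !inE.
  by case/andP.
- move=> x; rewrite mem_cat mcs !inE; case xc: (x \in c) => //=.
  by rewrite cW.
Qed.
End Cycles.

(** Reduces the problem to lists of cycles with prescribed lengths: a list [w j] of shape [L]
    without repeated vertices is the image of F under an injection, and two neighbours in [w j] come
    from adjacent vertices of F. *)
Lemma OP_of_cycle_cover (V X J : finType) (F : sgraph V) (mate : X -> X)
    (w : J -> seq (seq X)) (cs : seq (seq V)) (L : seq nat) :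
    regular 2 F -> #|X| = #|V| -> ~~ odd #|V| -> 2 * #|J| + 2 <= #|V| ->
    involutive mate -> (forall x, mate x != x) ->
    perm_eq (flatten cs) (enum V) -> all (cycle (adj F)) cs -> perm_eq (shape cs) L ->
    (forall j, shape (w j) = L) -> (forall j, uniq (flatten (w j))) ->
    (forall x y, x != y -> y != mate x -> exists j, covers (w j) x y) ->
  OP_solvable F.
Proof.
move=> regF cardX evenV cardJ mateK mate_neq pcs ccs /perm_shape[cs' sh pcs'] shw uw cover.
have pV : perm_eq (flatten cs') (enum V).
  by apply: perm_trans pcs; apply: perm_flatten.
have ucs : uniq (flatten cs') by rewrite (perm_uniq pV) enum_uniq.
have ccs' : all (cycle (adj F)) cs' by rewrite (perm_all _ pcs').
have [x0 _|X0] := pickP (@predT X); last first.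
  have J0 : #|J| = 0 by have : #|X| = 0 by [apply: eq_card0]; lia.
  by have := cardJ; rewrite J0 -cardX (eq_card0 X0).
have [f fP] : exists f : J -> {ffun V -> X}, forall j, map (map (f j)) cs' = w j.
  apply: (@fin_all_exists J _ (fun j fj => map (map (fun_of_fin fj)) cs' = w j)) => j.
  have [g gP] := relabel_cycles x0 ucs (etrans (shw j) (esym sh)).
  exists [ffun v => g v]; rewrite -gP; apply: eq_map => c; apply: eq_map => v.
  by rewrite ffunE.
apply: (@OP_of_embeddings V X J F mate (fun j => f j)) => // [j u v fuv|x y xy ym].
  have mV z : z \in flatten cs' by rewrite (perm_mem pV) mem_enum.
  have := uw j; rewrite -fP -map_flatten => /(uniqP x0) inj.
  rewrite -(nth_index u (mV u)) -(nth_index u (mV v)); congr nth.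
  apply: inj; rewrite ?inE ?size_map ?index_mem //.
  by rewrite !(nth_map u) ?index_mem // !nth_index.
have [j /hasP[c cw]] := cover x y xy ym; move: cw; rewrite -fP => /mapP[c' c'cs ->].
rewrite closed_walk_map => /consec_map_inv[u [v [uv <- <-]]].
exists j, u, v; split=> //; apply: consec_sorted (adj_sym F) _ uv.
by have := allP ccs' _ c'cs; case: (c').
Qed.

(** * Tilings of the strip *)

Lemma consec_rev (T : eqType) (s : seq T) x y : consec (rev s) x y = consec s x y.
Proof.
by rewrite /consec orbC -[in LHS](infix_rev [:: x; y]) -[in LHS](infix_rev [:: y; x]) !revK.
Qed.

Lemma consec_infix (T : eqType) (s1 s2 : seq T) x y :
  infix s1 s2 -> consec s1 x y -> consec s2 x y.
Proof.
by move=> s12 /orP[] i; rewrite /consec (infix_trans i s12) ?orbT.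
Qed.

Lemma consec_closed_walk (T : eqType) (c : seq T) x y :
  consec c x y -> consec (closed_walk c) x y.
Proof.
case: c => [|a c] //; apply: consec_infix.
by rewrite /closed_walk -cats1; apply: prefix_infix.
Qed.

Lemma consec_close (T : eqType) (a : T) s :
  consec (closed_walk (a :: s)) (last a s) a.
Proof.
case: (lastP s) => [|s' b]; first by rewrite /consec /= eqxx.
rewrite /closed_walk last_rcons /consec -rcons_cons -!cats1 -catA.
by rewrite (suffix_infix (a :: s') [:: b; a]).
Qed.

(* A 4-cycle with steps 1, 2, 4, 3: its translates partition the edges
   of the infinite strip, and each of them has even degrees. *)
Definition strip_edges (t : nat) : seq (nat * nat) :=
  [:: (t.+1, t.+2); (t, t.+2); (t, t + 4); (t.+1, t + 4)].

Lemma mem_iota0 n i : i < n -> i \in iota 0 n.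
Proof. by rewrite mem_iota. Qed.

Definition shift (t : nat) (w : seq (seq nat)) := map (map (addn t)) w.

Lemma shape_shift t w : shape (shift t w) = shape w.
Proof. by rewrite /shape -map_comp; apply: eq_map => c /=; rewrite size_map. Qed.

Lemma flatten_shift t w : flatten (shift t w) = map (addn t) (flatten w).
Proof. by rewrite map_flatten. Qed.

Lemma strip_edges_add a t x y :
  (x, y) \in strip_edges (a + t) ->
  exists x' y', [/\ (x', y') \in strip_edges t, x = a + x' & y = a + y'].
Proof.
rewrite !inE !xpair_eqE => /or4P[] /andP[/eqP-> /eqP->];
  [exists t.+1, t.+2 | exists t, t.+2 | exists t, (t + 4) | exists t.+1, (t + 4)];
  by rewrite !inE !eqxx ?orbT ?addnS ?addnA.
Qed.

(* S and S' list, for each of the four factors, the vertices among 0..3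
   (relative to the cut) which the cycles on the left of the cut already use. *)
Definition tiling (S S' : seq (seq nat)) (N : nat) (L : seq nat)
    (B : nat -> seq (seq nat)) : Prop :=
  [/\ forall f, f < 4 -> shape (B f) = L,
      forall f, f < 4 -> perm_eq (nth [::] S f ++ flatten (B f))
                           (iota 0 N ++ map (addn N) (nth [::] S' f))
    & forall t x y, t < N -> (x, y) \in strip_edges t ->
        exists2 f, f < 4 & covers (B f) x y].

(** Equal cuts at both ends are what allows blocks to be put side by side in any order. The length
    can only be [sumn L], by the number of vertices. *)
Definition loop (S : seq (seq nat)) (L : seq nat) : Prop :=
  exists B, tiling S S (sumn L) L B.

Lemma iota_addn N M : iota 0 (N + M) = iota 0 N ++ map (addn N) (iota 0 M).
Proof. by rewrite iotaD add0n -{2}[N]addn0 iotaDl. Qed.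

Lemma map_addnD N M s : map (addn N) (map (addn M) s) = map (addn (N + M)) s.
Proof. by rewrite -map_comp; apply: eq_map => z /=; rewrite addnA. Qed.

(** The vertices that the left block uses beyond its right cut are exactly those that the right
    block omits. A group [strip_edges t] goes to the left or to the right block according to whether
    [t < N]. *)
Lemma tiling_cat S S' S'' N N' L L' B B' :
  tiling S S' N L B -> tiling S' S'' N' L' B' ->
  tiling S S'' (N + N') (L ++ L') (fun f => B f ++ shift N (B' f)).
Proof.
case=> sh pm cov [sh' pm' cov']; split=> [f lf|f lf|t x y].
- by rewrite /shape map_cat -/(shape _) -/(shape (shift _ _)) shape_shift sh ?sh'.
- apply/permP => P; rewrite flatten_cat flatten_shift iota_addn -map_addnD.
  have := permP (pm f lf) P; have := permP (perm_map (addn N) (pm' f lf)) P.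
  by rewrite !map_cat !count_cat => e1 e2; rewrite addnA e2 -!addnA e1.
- have [tN _ /(cov _ _ _ tN)[f lf c]|Nt] := ltnP t N.
    by exists f; rewrite // covers_cat c.
  rewrite -{1}(subnKC Nt) ltn_add2l => tN'.
  rewrite -(subnKC Nt) => /strip_edges_add[x' [y' [+ -> ->]]].
  case/(cov' _ _ _ tN') => f lf c; exists f; rewrite // covers_cat.
  by rewrite (covers_map (addn N) c) orbT.
Qed.

Lemma loop_cat S L L' : loop S L -> loop S L' -> loop S (L ++ L').
Proof.
case=> B tB [B' tB']; rewrite /loop sumn_cat.
by exists (fun f => B f ++ shift (sumn L) (B' f)); apply: tiling_cat tB'.
Qed.

Lemma loop_nil S : loop S [::].
Proof. by exists (fun=> [::]); split=> // f lf; rewrite cats0 map_id. Qed.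

Lemma loop_nseq S L k : loop S L -> loop S (flatten (nseq k L)).
Proof.
move=> lL; elim: k => [|k IHk] /=; [exact: loop_nil | exact: loop_cat].
Qed.

Definition tile_ok (S : seq (seq nat)) (L : seq nat) (B : seq (seq (seq nat))) : bool :=
  let N := sumn L in
  all (fun f => (shape (nth [::] B f) == L)
    && perm_eq (nth [::] S f ++ flatten (nth [::] B f))
               (iota 0 N ++ map (addn N) (nth [::] S f))) (iota 0 4)
  && all (fun t => all (fun e => has (fun f => covers (nth [::] B f) e.1 e.2) (iota 0 4))
                     (strip_edges t)) (iota 0 N).

Lemma tile_okP S L B : tile_ok S L B -> loop S L.
Proof.
case/andP=> /allP a1 /allP a2; exists (nth [::] B); split=> [f lf|f lf|t x y lt xy].
- by have := a1 f; rewrite mem_iota => /(_ lf) /andP[/eqP].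
- by have := a1 f; rewrite mem_iota => /(_ lf) /andP[].
- have /allP/(_ _ xy)/hasP[f] := a2 t (mem_iota0 lt).
  by rewrite mem_iota; exists f.
Qed.

(** * Periodic families of blocks with one long cycle *)

Section Families.
Variable S : seq (seq nat).

(* Besides the closed cycles C, every factor has one open path p, whose end
   points lie at the positions (nth (0, 0) E f) relative to the cut t. *)
Definition partial (U : seq (seq nat)) (E : seq (nat * nat)) (t : nat) (L : seq nat)
    (C : nat -> seq (seq nat)) (p : nat -> seq nat) : Prop :=
  [/\ forall f, f < 4 -> shape (C f) = L,
      forall f, f < 4 -> perm_eq (nth [::] S f ++ flatten (C f) ++ p f)
                           (iota 0 t ++ map (addn t) (nth [::] U f)),
      forall f, f < 4 -> [/\ p f != [::], head 0 (p f) = t + (nth (0, 0) E f).1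
                           & last 0 (p f) = t + (nth (0, 0) E f).2]
    & forall i x y, i < t -> (x, y) \in strip_edges i ->
        exists2 f, f < 4 & covers (C f) x y || consec (p f) x y].

(* closed cycles, whether the path is reversed, and what is put before and
   after the path *)
Definition piece := (seq (seq nat) * bool * seq nat * seq nat)%type.
Definition no_piece : piece := ([::], false, [::], [::]).

(** Positions are relative to the cut before the extension. The default of [head] matters: with
    nothing put before the path, its old end remains the end. *)
Definition new_head (E : seq (nat * nat)) (q : seq piece) f : nat :=
  let: (_, sw, A, _) := nth no_piece q f in
  let: (a, b) := nth (0, 0) E f in head (if sw then b else a) A.

Definition new_last (E : seq (nat * nat)) (q : seq piece) f : nat :=
  let: (_, sw, _, B) := nth no_piece q f in
  let: (a, b) := nth (0, 0) E f in last (if sw then a else b) B.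

(** The check knows only the end points of the existing path, so new edges come from the new cycles,
    from [A] and [B] with the joints to the old ends, and, when [closing] holds, from the edge
    between the two final ends. *)
Definition piece_ok (U : seq (seq nat)) (E : seq (nat * nat)) (U' : seq (seq nat))
    (N : nat) (L : seq nat) (q : seq piece) (closing : bool) : bool :=
  all (fun f => let: (C, sw, A, B) := nth no_piece q f in
    (shape C == L) && perm_eq (nth [::] U f ++ flatten C ++ A ++ B)
                        (iota 0 N ++ map (addn N) (nth [::] U' f))) (iota 0 4)
  && all (fun t => all (fun e => has (fun f =>
       let: (C, sw, A, B) := nth no_piece q f in let: (a, b) := nth (0, 0) E f in
       [|| covers C e.1 e.2, consec (rcons A (if sw then b else a)) e.1 e.2,
           consec ((if sw then a else b) :: B) e.1 e.2
         | closing && ((e == (new_last E q f, new_head E q f)) || (e == (new_head E q f, new_last E q f)))])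
     (iota 0 4)) (strip_edges t)) (iota 0 N).

Definition extend t (p : nat -> seq nat) (q : seq piece) f : seq nat :=
  let: (_, sw, A, B) := nth no_piece q f in
  map (addn t) A ++ (if sw then rev (p f) else p f) ++ map (addn t) B.

Definition enlarge t (C : nat -> seq (seq nat)) (q : seq piece) f : seq (seq nat) :=
  C f ++ shift t (nth no_piece q f).1.1.1.

Lemma extend_ends U E t L C p q : partial U E t L C p ->
  forall f, f < 4 -> [/\ extend t p q f != [::],
    head 0 (extend t p q f) = t + new_head E q f & last 0 (extend t p q f) = t + new_last E q f].
Proof.
case=> _ _ ends _ f lf; have [pN hp lp] := ends f lf; rewrite /extend /new_head /new_last.
case: (nth no_piece q f) => [[[D sw] A] B]; case: (nth _ E f) hp lp => a b /= hp lp.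
set r := if sw then rev (p f) else p f.
have [rN hr lr] : [/\ r != [::], head 0 r = t + (if sw then b else a)
                    & last 0 r = t + (if sw then a else b)].
  rewrite /r; case: (sw) => //; case: (p f) pN hp lp => [|z s] //= _ hp lp.
  rewrite -size_eq0 size_rev /= rev_cons last_rcons; split=> //.
  case: (lastP s) lp => [|s' z'] /=; first by [].
  by rewrite last_rcons rev_rcons.
split.
- by move: rN; rewrite -!size_eq0 !size_cat; lia.
- by case: A => [|a' A] //=; rewrite -hr; case: (r) rN.
- rewrite catA last_cat; case: B => [|b' B] /=; last by rewrite last_map.
  by rewrite last_cat -lr; case: (r) rN.
Qed.

(** Common to prolonging and closing a path. Groups before the old cut stay covered by the old
    cycles and path; the later ones are covered by the finite check, translated by [t]. *)
Lemma extend_edges U E U' N L L' t C p q closing :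
    partial U E t L C p -> piece_ok U E U' N L' q closing ->
  [/\ forall f, f < 4 -> shape (enlarge t C q f) = L ++ L',
      forall f, f < 4 -> perm_eq (nth [::] S f ++ flatten (enlarge t C q f) ++ extend t p q f)
                           (iota 0 (t + N) ++ map (addn (t + N)) (nth [::] U' f))
    & forall i x y, i < t + N -> (x, y) \in strip_edges i ->
        exists2 f, f < 4 & [|| covers (enlarge t C q f) x y, consec (extend t p q f) x y
          | closing && (((x, y) == (t + new_last E q f, t + new_head E q f))
                        || ((x, y) == (t + new_head E q f, t + new_last E q f)))]].
Proof.
move=> part /andP[/allP ok1 /allP ok2]; have ends := extend_ends q part.
case: (part) => sh pm pends cov; split=> [f lf|f lf|i x y].
- have := ok1 f; rewrite mem_iota /enlarge => /(_ lf).
  case: (nth no_piece q f) => [[[D sw] A] B] /andP[/eqP shD _] /=.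
  by rewrite /shape map_cat -/(shape _) -/(shape (shift _ _)) shape_shift sh ?shD.
- have := ok1 f; rewrite mem_iota /enlarge /extend => /(_ lf).
  case: (nth no_piece q f) => [[[D sw] A] B] /andP[_ pD] /=.
  apply/permP => P; rewrite flatten_cat flatten_shift iota_addn -map_addnD.
  have := permP (pm f lf) P; have := permP (perm_map (addn t) pD) P.
  have arith (s c d a r b u i j : nat) : u + (d + (a + b)) = j -> s + (c + r) = i + u ->
    s + (c + d + (a + (r + b))) = i + j by lia.
  rewrite !map_cat !count_cat -(addnA (count P (iota 0 t))); case: (sw);
    rewrite ?count_rev; exact: arith.
- have [it _ /(cov _ _ _ it)[f lf c]|ti] := ltnP i t.
    exists f => //; rewrite /enlarge /extend covers_cat.
    case/orP: c => [->//|c]; apply/orP; right; apply/orP; left.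
    case: (nth no_piece q f) => [[[D sw] A] B]; rewrite catA.
    apply: consec_infix (_ : consec (if sw then rev (p f) else p f) x y).
      by rewrite -catA infix_infix.
    by case: (sw); rewrite ?consec_rev.
  rewrite -{1}(subnKC ti) ltn_add2l => iN.
  rewrite -(subnKC ti) => /strip_edges_add[x' [y' [+ -> ->]]].
  have /allP ok2' := ok2 (i - t) (mem_iota0 iN) => /ok2' /hasP[f].
  rewrite mem_iota => lf c; exists f => //; move: c; have [pN hp lp] := pends f lf.
  rewrite /enlarge /extend covers_cat /new_last /new_head.
  case: (nth no_piece q f) => [[[D sw] A] B]; case: (nth _ E f) hp lp => a b /= hp lp.
  set r := if sw then rev (p f) else p f.
  have [[r1 def1] [r2 def2]] : (exists r', r = (t + (if sw then b else a)) :: r')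
      /\ (exists r', r = rcons r' (t + (if sw then a else b))).
    have [p1 p2] : (exists r', p f = (t + a) :: r') /\ (exists r', p f = rcons r' (t + b)).
      rewrite -hp -lp; split; first by case: (p f) pN => // z s; exists s.
      by case: (lastP (p f)) pN => // s z _; exists s; rewrite last_rcons.
    rewrite /r; case: (sw) => //; case: p1 p2 => [r1 e1] [r2 e2]; split.
      by exists (rev r2); rewrite e2 rev_rcons.
    by exists (rev r1); rewrite e1 rev_cons.
  case/or4P=> c.
  - by rewrite (covers_map (addn t) c) orbT.
  - apply/or3P/Or32; apply: consec_infix (consec_map (addn t) c).
    rewrite map_rcons def1 /= -cat_rcons; exact: prefix_infix.
  - apply/or3P/Or32; apply: consec_infix (consec_map (addn t) c).
    rewrite def2 /= cat_rcons catA; exact: suffix_infix.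
  - apply/or3P/Or33; case/andP: c => -> /=; rewrite !xpair_eqE !eqn_add2l.
    by rewrite /new_last /new_head.
Qed.

Lemma partial_step U E U' E' N L L' t C p q :
    partial U E t L C p -> piece_ok U E U' N L' q false ->
    all (fun f => (new_head E q f == N + (nth (0, 0) E' f).1)
               && (new_last E q f == N + (nth (0, 0) E' f).2)) (iota 0 4) ->
  partial U' E' (t + N) (L ++ L') (enlarge t C q) (extend t p q).
Proof.
move=> part ok /allP ok'; have [e1 e2 e3] := extend_edges part ok.
split=> // [f lf|i x y iN xy].
  have [pN -> ->] := extend_ends q part lf; have := ok' f.
  by rewrite mem_iota => /(_ lf)/andP[/eqP-> /eqP->]; rewrite !addnA.
by have [f lf c] := e3 i x y iN xy; exists f => //; move: c; rewrite orbF.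
Qed.

(** The length of the cycle obtained by closing the path is forced by the number of vertices, so it
    need not be tracked through the steps. *)
Lemma partial_close U E N L L' t C p q :
    partial U E t L C p -> piece_ok U E S N L' q true ->
  loop S (L ++ L' ++ [:: t + N - sumn L - sumn L']).
Proof.
move=> part ok; have [e1 e2 e3] := extend_edges part ok.
have sz f : f < 4 -> size (extend t p q f) = t + N - sumn L - sumn L'.
  move=> lf; have := perm_size (e2 f lf); rewrite !size_cat size_iota size_map.
  have arith (s l l' e n : nat) : s + (l + l' + e) = n + s -> e = n - l - l' by lia.
  by rewrite size_flatten (e1 f lf) sumn_cat; apply: arith.
have sumN : sumn (L ++ L' ++ [:: t + N - sumn L - sumn L']) = t + N.
  have := perm_size (e2 0 isT); rewrite !size_cat size_iota size_map size_flatten.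
  have arith (s l l' e n : nat) : s + (l + l' + e) = n + s -> l + (l' + (n - l - l' + 0)) = n.
    by lia.
  by rewrite (e1 0 isT) !sumn_cat /=; apply: arith.
exists (fun f => rcons (enlarge t C q f) (extend t p q f)); rewrite sumN.
split=> [f lf|f lf|i x y iN xy].
- by rewrite /shape map_rcons -/(shape _) e1 // sz // -cats1 catA.
- by rewrite flatten_rcons e2.
- have [f lf c] := e3 i x y iN xy; exists f => //.
  have [pN hp lp] := extend_ends q part lf.
  rewrite -cats1 covers_cat {2}/covers /= orbF; case/or3P: c => [->//|c|].
    by rewrite (consec_closed_walk c) orbT.
  rewrite -hp -lp; case: (extend t p q f) pN => // z s _ /= c; apply/orP; right.
  have := consec_close z s; case/orP: c => /eqP[-> ->] //.
  by rewrite consec_sym.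
Qed.

Definition open_ok (U : seq (seq nat)) (E : seq (nat * nat)) (t : nat) (L : seq nat)
    (C : seq (seq (seq nat))) (p : seq (seq nat)) : bool :=
  all (fun f => [&& shape (nth [::] C f) == L,
      perm_eq (nth [::] S f ++ flatten (nth [::] C f) ++ nth [::] p f)
        (iota 0 t ++ map (addn t) (nth [::] U f)),
      nth [::] p f != [::], head 0 (nth [::] p f) == t + (nth (0, 0) E f).1
    & last 0 (nth [::] p f) == t + (nth (0, 0) E f).2]) (iota 0 4)
  && all (fun i => all (fun e => has (fun f =>
       covers (nth [::] C f) e.1 e.2 || consec (nth [::] p f) e.1 e.2) (iota 0 4))
     (strip_edges i)) (iota 0 t).

Lemma open_okP U E t L C p : open_ok U E t L C p -> partial U E t L (nth [::] C) (nth [::] p).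
Proof.
case/andP=> /allP ok1 /allP ok2; split=> [f lf|f lf|f lf|i x y it xy].
- by have := ok1 f; rewrite mem_iota => /(_ lf) /and5P[/eqP].
- by have := ok1 f; rewrite mem_iota => /(_ lf) /and5P[].
- by have := ok1 f; rewrite mem_iota => /(_ lf) /and5P[_ _ ? /eqP ? /eqP].
- have /allP/(_ _ xy)/hasP[f] := ok2 i (mem_iota0 it).
  by rewrite mem_iota; exists f.
Qed.

(** An opening, [k] identical steps and a closing. A step adds no closed cycle, hence lengthens the
    path by [Nq]: one finite check yields all lengths in an arithmetic progression. *)
Lemma loop_family U E N0 L0 C0 q0 Nq q N1 L1 q1 k :
    open_ok U E N0 L0 C0 q0 -> piece_ok U E U Nq [::] q false ->
    all (fun f => (new_head E q f == Nq + (nth (0, 0) E f).1)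
               && (new_last E q f == Nq + (nth (0, 0) E f).2)) (iota 0 4) ->
    piece_ok U E S N1 L1 q1 true ->
  loop S (L0 ++ L1 ++ [:: N0 + k * Nq + N1 - sumn L0 - sumn L1]).
Proof.
move=> /open_okP o ok ok' cl.
have [C [p part]] : exists C p, partial U E (N0 + k * Nq) L0 C p.
  elim: k => [|k [C [p part]]]; first by rewrite addn0; do 2!eexists; exact: o.
  have := partial_step part ok ok'; rewrite cats0 mulSnr addnA => part'.
  by do 2!eexists; exact: part'.
exact: partial_close part cl.
Qed.
End Families.

(** * The tiles *)

(** The groups [strip_edges t] to the left of a cut give the vertices 0, 1, 2, 3 the degrees 6, 4,
    2, 2. When all cycles are closed, these vertices must therefore occur in 3, 2, 1 and 1 of the
    four lists; [cutA] and [cutB] are two such distributions. *)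
Definition cutA : seq (seq nat) := [:: [:: 0; 1]; [:: 0; 2]; [:: 0; 3]; [:: 1]].

(** The same degrees 6, 4, 2, 2, but with one open path in each factor: a vertex listed in [endsA]
    contributes 1 instead of 2. *)
Definition midA : seq (seq nat) := [:: [:: 1; 2]; [:: 0; 1; 2]; [:: 0; 1; 3]; [:: 0; 1; 3]].

Definition endsA : seq (nat * nat) := [:: (1, 2); (1, 2); (1, 3); (1, 3)].

(** Triangles come by themselves only in threes. The one or two left over must join longer cycles,
    which is why patterns recur with several numbers of triangles. *)
Definition tilesA : seq (seq nat * seq (seq (seq nat))) :=
  [:: ([:: 3; 3; 3], [:: [:: [:: 2; 3; 6]; [:: 4; 5; 8]; [:: 7; 10; 9]]; [:: [:: 1; 4; 3]; [:: 5;
  6; 9]; [:: 7; 8; 11]]; [:: [:: 1; 2; 5]; [:: 4; 7; 6]; [:: 8; 9; 12]]; [:: [:: 0; 2; 4]; [:: 3;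
  5; 7]; [:: 6; 8; 10]]]); ([:: 3; 4; 4], [:: [:: [:: 8; 11; 12]; [:: 2; 3; 4; 5]; [:: 6; 7; 9;
  10]]; [:: [:: 4; 7; 8]; [:: 1; 3; 6; 5]; [:: 9; 11; 10; 13]]; [:: [:: 1; 2; 4]; [:: 5; 8; 6; 9];
  [:: 7; 10; 14; 11]]; [:: [:: 3; 5; 7]; [:: 0; 2; 6; 4]; [:: 8; 9; 12; 10]]]); ([:: 3; 3; 4; 4],
  [:: [:: [:: 2; 3; 6]; [:: 11; 14; 15]; [:: 4; 5; 7; 8]; [:: 9; 10; 12; 13]]; [:: [:: 1; 4; 3];
  [:: 7; 10; 11]; [:: 5; 6; 9; 8]; [:: 12; 14; 13; 16]]; [:: [:: 1; 2; 5]; [:: 4; 7; 6]; [:: 8;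
  11; 9; 12]; [:: 10; 13; 17; 14]]; [:: [:: 0; 2; 4]; [:: 6; 8; 10]; [:: 3; 5; 9; 7]; [:: 11; 12;
  15; 13]]]); ([:: 3; 3; 3; 4; 4], [:: [:: [:: 2; 3; 6]; [:: 4; 5; 8]; [:: 15; 18; 17]; [:: 7; 10;
  12; 9]; [:: 11; 14; 16; 13]]; [:: [:: 1; 4; 3]; [:: 5; 6; 9]; [:: 15; 16; 19]; [:: 7; 8; 12;
  11]; [:: 10; 13; 17; 14]]; [:: [:: 1; 2; 5]; [:: 4; 7; 6]; [:: 16; 17; 20]; [:: 8; 9; 10; 11];
  [:: 12; 13; 14; 15]]; [:: [:: 0; 2; 4]; [:: 3; 5; 7]; [:: 6; 8; 10]; [:: 9; 11; 15; 13]; [:: 12;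
  14; 18; 16]]]); ([:: 3; 3; 4; 4; 4], [:: [:: [:: 6; 7; 9]; [:: 16; 19; 18]; [:: 2; 3; 4; 5]; [::
  8; 11; 13; 10]; [:: 12; 15; 17; 14]]; [:: [:: 7; 10; 11]; [:: 14; 15; 18]; [:: 1; 4; 6; 3]; [::
  5; 8; 12; 9]; [:: 13; 16; 20; 17]]; [:: [:: 4; 7; 8]; [:: 17; 18; 21]; [:: 1; 2; 6; 5]; [:: 9;
  11; 15; 13]; [:: 10; 12; 16; 14]]; [:: [:: 0; 2; 4]; [:: 3; 5; 7]; [:: 6; 8; 9; 10]; [:: 11; 12;
  13; 14]; [:: 15; 16; 17; 19]]]); ([:: 3; 3; 3; 4; 4; 4], [:: [:: [:: 2; 3; 6]; [:: 4; 5; 8]; [::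
  18; 21; 22]; [:: 7; 9; 12; 11]; [:: 10; 13; 15; 14]; [:: 16; 17; 19; 20]]; [:: [:: 1; 4; 3]; [::
  5; 6; 9]; [:: 14; 17; 18]; [:: 7; 8; 11; 10]; [:: 12; 13; 16; 15]; [:: 19; 21; 20; 23]]; [:: [::
  1; 2; 5]; [:: 4; 7; 6]; [:: 8; 10; 12]; [:: 9; 11; 14; 13]; [:: 15; 18; 16; 19]; [:: 17; 20; 24;
  21]]; [:: [:: 0; 2; 4]; [:: 3; 5; 7]; [:: 12; 14; 16]; [:: 6; 8; 9; 10]; [:: 11; 13; 17; 15];
  [:: 18; 19; 22; 20]]]); ([:: 3; 3; 3; 3; 4; 4; 4], [:: [:: [:: 2; 3; 6]; [:: 4; 5; 8]; [:: 20;
  21; 23]; [:: 22; 25; 24]; [:: 7; 10; 11; 9]; [:: 12; 13; 16; 14]; [:: 15; 17; 18; 19]]; [:: [::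
  1; 4; 3]; [:: 5; 6; 9]; [:: 7; 8; 11]; [:: 12; 15; 16]; [:: 10; 13; 17; 14]; [:: 18; 21; 24;
  20]; [:: 19; 22; 26; 23]]; [:: [:: 1; 2; 5]; [:: 4; 7; 6]; [:: 17; 19; 21]; [:: 23; 24; 27]; [::
  8; 9; 10; 12]; [:: 11; 14; 13; 15]; [:: 16; 18; 22; 20]]; [:: [:: 0; 2; 4]; [:: 3; 5; 7]; [:: 6;
  8; 10]; [:: 14; 15; 18]; [:: 9; 12; 11; 13]; [:: 16; 17; 20; 19]; [:: 21; 22; 23; 25]]]); ([::
  5], [:: [:: [:: 2; 3; 5; 6; 4]]; [:: [:: 1; 3; 7; 4; 5]]; [:: [:: 1; 2; 5; 8; 4]]; [:: [:: 0; 2;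
  6; 3; 4]]]); ([:: 6], [:: [:: [:: 2; 3; 4; 5; 7; 6]]; [:: [:: 1; 4; 8; 5; 6; 3]]; [:: [:: 1; 2;
  4; 6; 9; 5]]; [:: [:: 0; 2; 5; 3; 7; 4]]]); ([:: 3; 5], [:: [:: [:: 2; 3; 6]; [:: 4; 5; 7; 9;
  8]]; [:: [:: 1; 4; 3]; [:: 5; 6; 10; 7; 8]]; [:: [:: 1; 2; 5]; [:: 4; 7; 11; 8; 6]]; [:: [:: 0;
  2; 4]; [:: 3; 5; 9; 6; 7]]]); ([:: 3; 6], [:: [:: [:: 2; 3; 6]; [:: 4; 5; 7; 9; 10; 8]]; [:: [::
  1; 4; 3]; [:: 5; 6; 7; 11; 8; 9]]; [:: [:: 1; 2; 5]; [:: 4; 7; 8; 12; 9; 6]]; [:: [:: 0; 2; 4];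
  [:: 3; 5; 8; 6; 10; 7]]]); ([:: 3; 7], [:: [:: [:: 2; 3; 6]; [:: 4; 5; 7; 9; 11; 10; 8]]; [::
  [:: 1; 4; 3]; [:: 5; 6; 7; 10; 9; 12; 8]]; [:: [:: 1; 2; 5]; [:: 4; 7; 8; 9; 13; 10; 6]]; [::
  [:: 0; 2; 4]; [:: 3; 5; 9; 6; 8; 11; 7]]]); ([:: 3; 3; 5], [:: [:: [:: 2; 3; 5]; [:: 9; 12; 11];
  [:: 4; 7; 10; 6; 8]]; [:: [:: 1; 4; 3]; [:: 9; 10; 13]; [:: 5; 6; 7; 11; 8]]; [:: [:: 7; 8; 9];
  [:: 10; 11; 14]; [:: 1; 2; 6; 4; 5]]; [:: [:: 0; 2; 4]; [:: 8; 10; 12]; [:: 3; 6; 9; 5; 7]]]);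
  ([:: 3; 3; 6], [:: [:: [:: 2; 3; 6]; [:: 4; 5; 8]; [:: 7; 10; 13; 12; 11; 9]]; [:: [:: 1; 4; 3];
  [:: 5; 6; 9]; [:: 7; 8; 12; 10; 14; 11]]; [:: [:: 1; 2; 5]; [:: 4; 7; 6]; [:: 8; 9; 12; 15; 11;
  10]]; [:: [:: 0; 2; 4]; [:: 3; 5; 7]; [:: 6; 8; 11; 13; 9; 10]]]); ([:: 3; 3; 7], [:: [:: [:: 2;
  3; 6]; [:: 4; 5; 8]; [:: 7; 10; 11; 12; 14; 13; 9]]; [:: [:: 1; 4; 3]; [:: 5; 6; 9]; [:: 7; 8;
  10; 13; 12; 15; 11]]; [:: [:: 1; 2; 5]; [:: 4; 7; 6]; [:: 8; 9; 10; 12; 16; 13; 11]]; [:: [:: 0;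
  2; 4]; [:: 3; 5; 7]; [:: 6; 8; 12; 9; 11; 14; 10]]]); ([:: 4; 6], [:: [:: [:: 6; 9; 11; 10]; [::
  2; 3; 4; 7; 8; 5]]; [:: [:: 8; 10; 9; 12]; [:: 1; 4; 5; 7; 6; 3]]; [:: [:: 7; 10; 13; 9]; [:: 1;
  2; 4; 8; 6; 5]]; [:: [:: 0; 2; 6; 4]; [:: 3; 5; 9; 8; 11; 7]]]); ([:: 4; 7], [:: [:: [:: 2; 3;
  4; 5]; [:: 6; 7; 9; 12; 11; 8; 10]]; [:: [:: 9; 11; 10; 13]; [:: 1; 4; 7; 5; 8; 6; 3]]; [:: [::
  7; 10; 14; 11]; [:: 1; 2; 4; 8; 9; 6; 5]]; [:: [:: 0; 2; 6; 4]; [:: 3; 5; 9; 10; 12; 8; 7]]]);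
  ([:: 4; 8], [:: [:: [:: 2; 3; 4; 5]; [:: 6; 9; 12; 13; 11; 7; 10; 8]]; [:: [:: 10; 12; 11; 14];
  [:: 1; 4; 7; 8; 9; 5; 6; 3]]; [:: [:: 8; 11; 15; 12]; [:: 1; 2; 4; 6; 10; 9; 7; 5]]; [:: [:: 9;
  11; 10; 13]; [:: 0; 2; 6; 7; 3; 5; 8; 4]]]); ([:: 3; 4; 5], [:: [:: [:: 7; 8; 11]; [:: 2; 3; 4;
  5]; [:: 6; 9; 13; 12; 10]]; [:: [:: 10; 11; 14]; [:: 5; 8; 12; 9]; [:: 1; 4; 7; 6; 3]]; [:: [::
  11; 12; 15]; [:: 7; 10; 8; 9]; [:: 1; 2; 4; 6; 5]]; [:: [:: 3; 5; 7]; [:: 9; 10; 13; 11]; [:: 0;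
  2; 6; 8; 4]]]); ([:: 3; 4; 6], [:: [:: [:: 2; 3; 6]; [:: 9; 12; 14; 13]; [:: 4; 5; 7; 11; 10;
  8]]; [:: [:: 1; 4; 3]; [:: 11; 13; 12; 15]; [:: 5; 6; 7; 10; 9; 8]]; [:: [:: 1; 2; 5]; [:: 10;
  13; 16; 12]; [:: 4; 7; 8; 11; 9; 6]]; [:: [:: 0; 2; 4]; [:: 3; 5; 9; 7]; [:: 6; 8; 12; 11; 14;
  10]]]); ([:: 3; 4; 7], [:: [:: [:: 2; 3; 6]; [:: 10; 12; 15; 14]; [:: 4; 5; 7; 11; 13; 9; 8]];
  [:: [:: 1; 4; 3]; [:: 5; 6; 7; 8]; [:: 9; 10; 11; 14; 13; 16; 12]]; [:: [:: 1; 2; 5]; [:: 12;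
  13; 17; 14]; [:: 4; 7; 10; 8; 11; 9; 6]]; [:: [:: 0; 2; 4]; [:: 3; 5; 9; 7]; [:: 6; 8; 12; 11;
  15; 13; 10]]]); ([:: 3; 4; 8], [:: [:: [:: 2; 3; 6]; [:: 12; 15; 16; 14]; [:: 4; 5; 7; 11; 9;
  13; 10; 8]]; [:: [:: 1; 4; 3]; [:: 5; 6; 7; 8]; [:: 9; 10; 11; 15; 14; 17; 13; 12]]; [:: [:: 1;
  2; 5]; [:: 13; 14; 18; 15]; [:: 4; 7; 10; 12; 11; 8; 9; 6]]; [:: [:: 0; 2; 4]; [:: 3; 5; 9; 7];
  [:: 6; 8; 12; 16; 13; 11; 14; 10]]]); ([:: 3; 4; 9], [:: [:: [:: 2; 3; 6]; [:: 13; 15; 16; 17];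
  [:: 4; 5; 7; 9; 12; 14; 11; 10; 8]]; [:: [:: 1; 4; 3]; [:: 5; 6; 7; 8]; [:: 9; 10; 14; 18; 15;
  12; 16; 13; 11]]; [:: [:: 1; 2; 5]; [:: 14; 15; 19; 16]; [:: 4; 7; 10; 13; 12; 11; 8; 9; 6]];
  [:: [:: 0; 2; 4]; [:: 6; 8; 12; 10]; [:: 3; 5; 9; 13; 14; 17; 15; 11; 7]]]); ([:: 3; 3; 4; 5],
  [:: [:: [:: 2; 3; 6]; [:: 14; 15; 16]; [:: 4; 5; 9; 8]; [:: 7; 10; 13; 12; 11]]; [:: [:: 1; 4;
  3]; [:: 9; 10; 11]; [:: 5; 6; 7; 8]; [:: 12; 15; 13; 17; 14]]; [:: [:: 1; 2; 5]; [:: 8; 10; 12];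
  [:: 4; 7; 9; 6]; [:: 11; 13; 14; 18; 15]]; [:: [:: 0; 2; 4]; [:: 3; 5; 7]; [:: 9; 12; 16; 13];
  [:: 6; 8; 11; 14; 10]]]); ([:: 3; 3; 4; 6], [:: [:: [:: 2; 3; 6]; [:: 4; 5; 8]; [:: 13; 16; 17;
  15]; [:: 7; 10; 11; 14; 12; 9]]; [:: [:: 1; 4; 3]; [:: 5; 6; 9]; [:: 14; 16; 15; 18]; [:: 7; 8;
  10; 13; 12; 11]]; [:: [:: 1; 2; 5]; [:: 4; 7; 6]; [:: 12; 15; 19; 16]; [:: 8; 9; 10; 14; 13;
  11]]; [:: [:: 0; 2; 4]; [:: 3; 5; 7]; [:: 6; 8; 12; 10]; [:: 9; 11; 15; 14; 17; 13]]]); ([:: 3;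
  3; 4; 7], [:: [:: [:: 2; 3; 6]; [:: 4; 5; 8]; [:: 15; 16; 17; 18]; [:: 7; 10; 13; 14; 11; 12;
  9]]; [:: [:: 1; 4; 3]; [:: 5; 6; 9]; [:: 12; 15; 19; 16]; [:: 7; 8; 10; 14; 17; 13; 11]]; [::
  [:: 1; 2; 5]; [:: 4; 7; 6]; [:: 8; 9; 10; 11]; [:: 12; 13; 15; 17; 20; 16; 14]]; [:: [:: 0; 2;
  4]; [:: 3; 5; 7]; [:: 6; 8; 12; 10]; [:: 9; 11; 15; 14; 18; 16; 13]]]); ([:: 3; 3; 4; 8], [::
  [:: [:: 2; 3; 6]; [:: 4; 5; 8]; [:: 14; 16; 19; 18]; [:: 7; 10; 13; 17; 15; 11; 12; 9]]; [:: [::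
  1; 4; 3]; [:: 5; 6; 9]; [:: 16; 18; 17; 20]; [:: 7; 8; 10; 12; 14; 15; 13; 11]]; [:: [:: 1; 2;
  5]; [:: 4; 7; 6]; [:: 8; 9; 10; 11]; [:: 12; 15; 18; 21; 17; 14; 13; 16]]; [:: [:: 0; 2; 4]; [::
  3; 5; 7]; [:: 15; 16; 17; 19]; [:: 6; 8; 12; 13; 9; 11; 14; 10]]]); ([:: 3; 3; 4; 9], [:: [::
  [:: 2; 3; 6]; [:: 4; 5; 8]; [:: 15; 17; 20; 19]; [:: 7; 10; 13; 16; 18; 14; 11; 12; 9]]; [:: [::
  1; 4; 3]; [:: 5; 6; 9]; [:: 17; 19; 18; 21]; [:: 7; 8; 10; 12; 15; 16; 14; 13; 11]]; [:: [:: 1;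
  2; 5]; [:: 4; 7; 6]; [:: 8; 9; 10; 11]; [:: 12; 13; 17; 16; 19; 22; 18; 15; 14]]; [:: [:: 0; 2;
  4]; [:: 3; 5; 7]; [:: 9; 11; 15; 13]; [:: 6; 8; 12; 16; 20; 18; 17; 14; 10]]]); ([:: 3; 3; 3; 4;
  5], [:: [:: [:: 2; 3; 6]; [:: 4; 5; 8]; [:: 16; 19; 18]; [:: 11; 14; 17; 15]; [:: 7; 10; 13; 12;
  9]]; [:: [:: 1; 4; 3]; [:: 5; 6; 9]; [:: 14; 15; 18]; [:: 13; 16; 20; 17]; [:: 7; 8; 10; 12;
  11]]; [:: [:: 1; 2; 5]; [:: 4; 7; 6]; [:: 17; 18; 21]; [:: 8; 9; 10; 11]; [:: 12; 15; 13; 14;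
  16]]; [:: [:: 0; 2; 4]; [:: 3; 5; 7]; [:: 9; 11; 13]; [:: 15; 16; 17; 19]; [:: 6; 8; 12; 14;
  10]]])].

Definition opensA : seq (nat * seq nat * seq (seq (seq nat)) * seq (seq nat)) :=
  [:: (3, [::], [:: [::]; [::]; [::]; [::]], [:: [:: 4; 2; 5]; [:: 4; 3; 1; 5]; [:: 4; 1; 2; 6];
  [:: 4; 0; 2; 3; 6]]); (7, [:: 3], [:: [:: [:: 2; 3; 6]]; [:: [:: 1; 4; 3]]; [:: [:: 1; 2; 5]];
  [:: [:: 0; 2; 4]]], [:: [:: 8; 4; 5; 9]; [:: 8; 7; 5; 6; 9]; [:: 8; 6; 4; 7; 10]; [:: 8; 5; 3;
  7; 6; 10]]); (10, [:: 3; 3], [:: [:: [:: 2; 3; 6]; [:: 4; 5; 8]]; [:: [:: 1; 4; 3]; [:: 5; 6;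
  9]]; [:: [:: 1; 2; 5]; [:: 4; 7; 6]]; [:: [:: 0; 2; 4]; [:: 3; 5; 7]]], [:: [:: 11; 7; 9; 12];
  [:: 11; 10; 7; 8; 12]; [:: 11; 9; 8; 10; 13]; [:: 11; 8; 6; 10; 9; 13]])].

Definition stepA : seq piece :=
  [:: ([::], true, [:: 4; 0], [:: 5]); ([::], false, [:: 4; 3], [:: 5]); ([::], false, [:: 4; 2],
  [:: 6]); ([::], false, [:: 4], [:: 2; 6])].

(** A step adds three vertices to the path, so closings come in triples, one for each residue modulo
    3: three without a 4-cycle and three with one. *)
Definition closesA : seq (nat * seq nat * seq piece) :=
  [:: (4, [::], [:: ([::], false, [:: 0; 4; 5; 3], [::]); ([::], false, [:: 6; 3; 4], [::]);
  ([::], false, [:: 7; 4; 2], [::]); ([::], false, [:: 2; 5], [::])]); (5, [::], [:: ([::], false,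
  [:: 0; 4; 6; 5; 3], [::]); ([::], false, [:: 3; 7; 4; 5], [::]); ([::], false, [:: 4; 8; 5; 2],
  [::]); ([::], false, [:: 6; 2; 4], [::])]); (6, [::], [:: ([::], false, [:: 0; 4; 6; 7; 5; 3],
  [::]); ([::], false, [:: 3; 6; 5; 8; 4], [::]); ([::], false, [:: 4; 5; 9; 6; 2], [::]); ([::],
  false, [:: 7; 4; 2; 5], [::])]); (10, [:: 4], [:: ([:: [:: 6; 9; 11; 10]], false, [:: 0; 4; 7;
  8; 5; 3], [::]); ([:: [:: 8; 10; 9; 12]], false, [:: 3; 6; 7; 5; 4], [::]); ([:: [:: 2; 4; 8;
  6]], false, [:: 7; 10; 13; 9; 5], [::]); ([:: [:: 7; 9; 8; 11]], false, [:: 4; 6; 5; 2],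
  [::])]); (11, [:: 4], [:: ([:: [:: 7; 9; 12; 11]], false, [:: 0; 4; 5; 8; 10; 6; 3], [::]); ([::
  [:: 9; 11; 10; 13]], false, [:: 3; 4; 7; 8; 6; 5], [::]); ([:: [:: 2; 5; 9; 6]], false, [:: 7;
  10; 14; 11; 8; 4], [::]); ([:: [:: 8; 9; 10; 12]], false, [:: 5; 7; 6; 4; 2], [::])]); (12, [::
  4], [:: ([:: [:: 9; 12; 13; 11]], false, [:: 0; 4; 5; 8; 10; 7; 6; 3], [::]); ([:: [:: 10; 12;
  11; 14]], false, [:: 3; 5; 6; 9; 8; 7; 4], [::]); ([:: [:: 8; 11; 15; 12]], false, [:: 4; 6; 10;
  9; 7; 5; 2], [::]); ([:: [:: 2; 4; 8; 6]], false, [:: 7; 11; 10; 13; 9; 5], [::])])].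

Definition cutB : seq (seq nat) := [:: [:: 0; 1; 3]; [:: 0; 1]; [:: 0; 2]; [::]].

Definition midB : seq (seq nat) := [:: [:: 0; 1; 3]; [:: 0; 1]; [:: 0; 1; 2]; [:: 0; 2; 3]].

Definition endsB : seq (nat * nat) := [:: (0, 3); (0, 1); (1, 2); (2, 3)].

Definition tilesB : seq (seq nat * seq (seq (seq nat))) :=
  [:: ([:: 4; 4], [:: [:: [:: 2; 5; 9; 6]; [:: 4; 7; 11; 8]]; [:: [:: 2; 3; 6; 4]; [:: 5; 8; 9;
  7]]; [:: [:: 1; 3; 4; 5]; [:: 6; 8; 7; 10]]; [:: [:: 0; 2; 1; 4]; [:: 3; 5; 6; 7]]]); ([:: 3; 4;
  4], [:: [:: [:: 2; 4; 6]; [:: 5; 8; 12; 9]; [:: 7; 10; 14; 11]]; [:: [:: 6; 7; 9]; [:: 2; 3; 4;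
  5]; [:: 8; 11; 12; 10]]; [:: [:: 4; 7; 8]; [:: 1; 3; 6; 5]; [:: 9; 11; 10; 13]]; [:: [:: 3; 5;
  7]; [:: 0; 2; 1; 4]; [:: 6; 8; 9; 10]]]); ([:: 3; 4; 4; 4], [:: [:: [:: 12; 13; 16]; [:: 2; 5;
  9; 6]; [:: 4; 7; 10; 8]; [:: 11; 14; 18; 15]]; [:: [:: 5; 8; 7]; [:: 2; 3; 6; 4]; [:: 9; 10; 11;
  13]; [:: 12; 15; 16; 14]]; [:: [:: 7; 9; 11]; [:: 1; 3; 4; 5]; [:: 6; 8; 12; 10]; [:: 13; 15;
  14; 17]]; [:: [:: 10; 13; 14]; [:: 0; 2; 1; 4]; [:: 3; 5; 6; 7]; [:: 8; 9; 12; 11]]]); ([:: 5],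
  [:: [:: [:: 2; 5; 8; 4; 6]]; [:: [:: 2; 3; 6; 5; 4]]; [:: [:: 1; 4; 7; 3; 5]]; [:: [:: 0; 2; 1;
  3; 4]]]); ([:: 4; 5; 5], [:: [:: [:: 8; 9; 11; 10]; [:: 2; 5; 6; 7; 4]; [:: 12; 15; 13; 17;
  14]]; [:: [:: 2; 3; 4; 6]; [:: 5; 7; 8; 12; 9]; [:: 10; 13; 11; 15; 14]]; [:: [:: 6; 9; 7; 10];
  [:: 1; 4; 8; 5; 3]; [:: 11; 12; 16; 13; 14]]; [:: [:: 9; 10; 12; 13]; [:: 0; 2; 1; 5; 4]; [:: 3;
  6; 8; 11; 7]]])].

Definition opensB : seq (nat * seq nat * seq (seq (seq nat)) * seq (seq nat)) :=
  [:: (2, [::], [:: [::]; [::]; [::]; [::]], [:: [:: 2; 5]; [:: 2; 3]; [:: 3; 1; 4]; [:: 4; 0; 2;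
  1; 5]])].

Definition stepB : seq piece :=
  [:: ([::], true, [::], [:: 4; 2; 6]); ([::], false, [:: 3; 2], [:: 4]); ([::], false, [:: 4; 3],
  [:: 5]); ([::], false, [:: 5; 1], [:: 6])].

Definition closesB : seq (nat * seq nat * seq piece) :=
  [:: (4, [::], [:: ([::], false, [:: 7; 4; 5; 2], [::]); ([::], false, [:: 5; 3; 2; 4], [::]);
  ([::], false, [:: 6; 3; 4], [::]); ([::], false, [:: 1], [::])]); (5, [::], [:: ([::], false,
  [:: 6; 4; 8; 5; 2], [::]); ([::], false, [:: 2; 6; 5; 3; 4], [::]); ([::], false, [:: 3; 7; 4;
  5], [::]); ([::], false, [:: 1; 4], [::])]); (6, [::], [:: ([::], false, [:: 4; 7; 6; 9; 5; 2],
  [::]); ([::], false, [:: 2; 3; 7; 5; 6; 4], [::]); ([::], false, [:: 6; 3; 5; 8; 4], [::]);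
  ([::], false, [:: 1; 5; 4], [::])]); (8, [:: 4], [:: ([:: [:: 2; 5; 9; 6]], false, [:: 7; 11; 8;
  4], [::]); ([:: [:: 5; 8; 9; 7]], false, [:: 4; 6; 3; 2], [::]); ([:: [:: 6; 8; 7; 10]], false,
  [:: 4; 3; 5], [::]); ([:: [:: 4; 5; 6; 7]], false, [:: 1], [::])]); (9, [:: 4], [:: ([:: [:: 5;
  8; 12; 9]], false, [:: 6; 10; 7; 4; 2], [::]); ([:: [:: 6; 9; 10; 8]], false, [:: 2; 3; 7; 5;
  4], [::]); ([:: [:: 7; 9; 8; 11]], false, [:: 6; 5; 3; 4], [::]); ([:: [:: 4; 6; 7; 8]], false,
  [:: 1; 5], [::])]); (10, [:: 4], [:: ([:: [:: 4; 7; 11; 8]], false, [:: 6; 10; 13; 9; 5; 2],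
  [::]); ([:: [:: 7; 10; 11; 9]], false, [:: 2; 3; 5; 8; 6; 4], [::]); ([:: [:: 8; 10; 9; 12]],
  false, [:: 6; 5; 7; 3; 4], [::]); ([:: [:: 6; 7; 8; 9]], false, [:: 1; 5; 4], [::])])].

Definition family_ok S U E (opens : seq (nat * seq nat * seq (seq (seq nat)) * seq (seq nat)))
    (step : seq piece) (closes : seq (nat * seq nat * seq piece)) : bool :=
  [&& all (fun o => let: (N, L, C, p) := o in open_ok S U E N L C p) opens,
      piece_ok U E U 3 [::] step false,
      all (fun f => (new_head E step f == 3 + (nth (0, 0) E f).1)
                 && (new_last E step f == 3 + (nth (0, 0) E f).2)) (iota 0 4)
    & all (fun c => let: (N, L, q) := c in piece_ok U E S N L q true) closes].

Lemma family_okP S U E opens step closes : family_ok S U E opens step closes ->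
  forall N0 L0 N1 L1 k, (N0, L0) \in map (fun o => (o.1.1.1, o.1.1.2)) opens ->
    (N1, L1) \in map (fun c => (c.1.1, c.1.2)) closes ->
  loop S (L0 ++ L1 ++ [:: N0 + k * 3 + N1 - sumn L0 - sumn L1]).
Proof.
case/and4P=> /allP oo st se /allP cc N0 L0 N1 L1 k.
case/mapP=> -[[[N L] C] p] /oo /= o [-> ->] /mapP[[[N' L'] q] /cc /= c [-> ->]].
exact: loop_family o st se c.
Qed.

Lemma tilesA_ok : all (fun t => tile_ok cutA t.1 t.2) tilesA.
Proof. by vm_cast_no_check (erefl true). Qed.

Lemma tilesB_ok : all (fun t => tile_ok cutB t.1 t.2) tilesB.
Proof. by vm_cast_no_check (erefl true). Qed.

Lemma familyA_ok : family_ok cutA midA endsA opensA stepA closesA.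
Proof. by vm_cast_no_check (erefl true). Qed.

Lemma familyB_ok : family_ok cutB midB endsB opensB stepB closesB.
Proof. by vm_cast_no_check (erefl true). Qed.

Lemma tileA L : L \in unzip1 tilesA -> loop cutA L.
Proof. by case/mapP=> -[L' B] /(allP tilesA_ok) /tile_okP l ->. Qed.

Lemma tileB L : L \in unzip1 tilesB -> loop cutB L.
Proof. by case/mapP=> -[L' B] /(allP tilesB_ok) /tile_okP l ->. Qed.

Lemma famA N0 L0 N1 L1 k m :
    (N0, L0) \in map (fun o => (o.1.1.1, o.1.1.2)) opensA ->
    (N1, L1) \in map (fun c => (c.1.1, c.1.2)) closesA ->
    N0 + k * 3 + N1 - sumn L0 - sumn L1 = m ->
  loop cutA (L0 ++ L1 ++ [:: m]).
Proof. by move=> o c <-; apply: family_okP familyA_ok _ _ _ _ _ o c. Qed.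

Lemma famB N0 L0 N1 L1 k m :
    (N0, L0) \in map (fun o => (o.1.1.1, o.1.1.2)) opensB ->
    (N1, L1) \in map (fun c => (c.1.1, c.1.2)) closesB ->
    N0 + k * 3 + N1 - sumn L0 - sumn L1 = m ->
  loop cutB (L0 ++ L1 ++ [:: m]).
Proof. by move=> o c <-; apply: family_okP familyB_ok _ _ _ _ _ o c. Qed.

Lemma mod3E n : exists2 k, n = k * 3 + n %% 3 & n %% 3 < 3.
Proof. by exists (n %/ 3); rewrite -?divn_eq ?ltn_mod. Qed.

Lemma loopA_m j m : j < 3 -> 4 < m -> loop cutA (nseq j 3 ++ [:: m]).
Proof.
move=> lj lm; case: (ltnP m 8) => [m8|m8].
  have : [|| m == 5, m == 6 | m == 7] by lia.
  case/or3P=> /eqP->.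
  - by case: j lj => [|[|[|//]]] _; apply: tileA.
  - by case: j lj => [|[|[|//]]] _; apply: tileA.
  - case: j lj => [|[|[|//]]] _; [|exact: tileA|exact: tileA].
    exact: (@famA 3 [::] 4 [::] 0).
have [k ek] := mod3E (m - 8); move: ek; case: (_ %% 3) => [|[|[|//]]] ek _;
  case: j lj => [|[|[|//]]] _ /=.
- by apply: (@famA 3 [::] 5 [::] k) => //=; lia.
- by apply: (@famA 7 [:: 3] 4 [::] k) => //=; lia.
- by apply: (@famA 10 [:: 3; 3] 4 [::] k) => //=; lia.
- by apply: (@famA 3 [::] 6 [::] k) => //=; lia.
- by apply: (@famA 7 [:: 3] 5 [::] k) => //=; lia.
- by apply: (@famA 10 [:: 3; 3] 5 [::] k) => //=; lia.
- by apply: (@famA 3 [::] 4 [::] k.+1) => //=; lia.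
- by apply: (@famA 7 [:: 3] 6 [::] k) => //=; lia.
- by apply: (@famA 10 [:: 3; 3] 6 [::] k) => //=; lia.
Qed.

(** A 4-cycle with a 5-cycle and no triangle is not among the tiles, so [m] has to be at least 6
    when [j = 0]. *)
Lemma loopA_4m j m : j < 3 -> 3 + (j == 0) < m.-1 -> loop cutA (nseq j 3 ++ [:: 4; m]).
Proof.
move=> lj lm; case: (ltnP m 10) => [m10|m10].
  have [/andP[/eqP-> /eqP->]|nb] := boolP ((j == 0) && (m == 9)).
    exact: (@famA 3 [::] 10 [:: 4] 0).
  have : [|| m == 5, m == 6, m == 7 | (m == 8) || (m == 9)] by lia.
  by case/or4P=> [/eqP em|/eqP em|/eqP em|/orP[]/eqP em]; move: lm nb; rewrite em;
    case: j lj => [|[|[|//]]] _ // _ _; apply: tileA.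
have [k ek] := mod3E (m - 10); move: ek; case: (_ %% 3) => [|[|[|//]]] ek _;
  case: j lj {lm} => [|[|[|//]]] _ /=.
- by apply: (@famA 3 [::] 11 [:: 4] k) => //=; lia.
- by apply: (@famA 7 [:: 3] 10 [:: 4] k) => //=; lia.
- by apply: (@famA 10 [:: 3; 3] 10 [:: 4] k) => //=; lia.
- by apply: (@famA 3 [::] 12 [:: 4] k) => //=; lia.
- by apply: (@famA 7 [:: 3] 11 [:: 4] k) => //=; lia.
- by apply: (@famA 10 [:: 3; 3] 11 [:: 4] k) => //=; lia.
- by apply: (@famA 3 [::] 10 [:: 4] k.+1) => //=; lia.
- by apply: (@famA 7 [:: 3] 12 [:: 4] k) => //=; lia.
- by apply: (@famA 10 [:: 3; 3] 12 [:: 4] k) => //=; lia.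
Qed.

Lemma loopA_34m j m : j < 4 -> 0 < j -> 4 < m -> loop cutA (nseq j 3 ++ [:: 4; m]).
Proof.
move=> lj j0 lm; have [j3|j3] := ltnP j 3; first by apply: loopA_4m; lia.
have -> : j = 3 by lia.
(* For [m = 5] the three triangles cannot be split off: the pair 4, 5 that remains is the one
   excluded in [loopA_4m]. *)
have [->|m5] := eqVneq m 5; first exact: tileA.
apply: (@loop_cat _ [:: 3; 3; 3] [:: 4; m]); first exact: tileA.
by apply: (@loopA_4m 0); lia.
Qed.

Lemma loopA_big s : all (leq 5) s -> loop cutA s.
Proof.
elim: s => [|m s IHs] /=; first by move=> _; apply: loop_nil.
by case/andP=> m5 /IHs; apply: (@loop_cat _ [:: m]); apply: (@loopA_m 0).
Qed.

Lemma loopB_4m (j : bool) m : 4 + j < m -> loop cutB (nseq j 4 ++ [:: m]).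
Proof.
move=> lm; have [em|m5] := eqVneq m 5.
  by move: lm; rewrite em; case: j => // _; apply: tileB.
have m6 : 5 < m by move: lm m5; case: j; lia.
have [k ek] := mod3E (m - 6); move: ek {lm}; case: (_ %% 3) => [|[|[|//]]] ek _;
  case: j => /=.
- by apply: (@famB 2 [::] 8 [:: 4] k) => //=; lia.
- by apply: (@famB 2 [::] 4 [::] k) => //=; lia.
- by apply: (@famB 2 [::] 9 [:: 4] k) => //=; lia.
- by apply: (@famB 2 [::] 5 [::] k) => //=; lia.
- by apply: (@famB 2 [::] 10 [:: 4] k) => //=; lia.
- by apply: (@famB 2 [::] 6 [::] k) => //=; lia.
Qed.

Lemma loopB_big s : all (leq 5) s -> loop cutB s.
Proof.
elim: s => [|m s IHs] /=; first by move=> _; apply: loop_nil.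
by case/andP=> m5 /IHs; apply: (@loop_cat _ [:: m]); apply: (@loopB_4m false); lia.
Qed.

(** * Arbitrary cycle types on the strip *)

Definition tiled S L := exists2 L', perm_eq L L' & loop S L'.

Lemma count_flatten_nseq (T : Type) (P : pred T) k (s : seq T) :
  count P (flatten (nseq k s)) = k * count P s.
Proof. by elim: k => //= k IHk; rewrite count_cat IHk mulSn. Qed.

(** Since [b < 2 * a], the 4-cycles can be taken in pairs with one triangle for each pair. The
    remaining triangles go in threes, and the last few of them, with the unpaired 4-cycle if there
    is one, are placed with the cycle of length [m]. *)
Lemma tiledA_nonempty a b m s : b < 2 * a -> 4 < m -> all (leq 5) s ->
  tiled cutA (nseq a 3 ++ nseq b 4 ++ m :: s).
Proof.
move=> ba m5 s5; have := odd_double_half b; set q := b./2.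
have [ob|eb] := boolP (odd b) => bq.
  (* [loopA_34m] needs at least one triangle, hence the predecessor: one to three triangles are kept
     for it. *)
  have [k ek jlt] := mod3E (a - q).-1; move: ek jlt; set j := _ %% 3 => ek jlt.
  exists (flatten (nseq q [:: 3; 4; 4]) ++ flatten (nseq k [:: 3; 3; 3])
          ++ (nseq j.+1 3 ++ [:: 4; m]) ++ s); last first.
    apply: loop_cat; first exact/loop_nseq/tileA.
    apply: loop_cat; first exact/loop_nseq/tileA.
    by apply: loop_cat; [apply: loopA_34m | apply: loopA_big].
  apply/permP => P; rewrite !(count_cat, count_flatten_nseq, count_nseq) /= !addn0.
  have -> : b = q * 2 + 1 by lia.
  have -> : a = q + (k * 3 + j.+1) by lia.
  by case: (P 3); case: (P 4); rewrite ?mul1n ?mul0n; lia.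
have [k ek jlt] := mod3E (a - q); move: ek jlt; set j := _ %% 3 => ek jlt.
exists (flatten (nseq q [:: 3; 4; 4]) ++ flatten (nseq k [:: 3; 3; 3])
        ++ (nseq j 3 ++ [:: m]) ++ s); last first.
  apply: loop_cat; first exact/loop_nseq/tileA.
  apply: loop_cat; first exact/loop_nseq/tileA.
  by apply: loop_cat; [apply: loopA_m | apply: loopA_big].
apply/permP => P; rewrite !(count_cat, count_flatten_nseq, count_nseq) /= !addn0.
have -> : b = q * 2 by lia.
have -> : a = q + (k * 3 + j) by lia.
by case: (P 3); case: (P 4); rewrite ?mul1n ?mul0n; lia.
Qed.

(** In the absence of a long cycle the last two or three 4-cycles absorb the leftover triangles. The
    tiles with two 4-cycles carry 1 to 3 triangles, those with three carry 2 to 4, so every residue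
    modulo 3 is served. *)
Lemma tiledA_empty a b : b < 2 * a -> 1 < b -> tiled cutA (nseq a 3 ++ nseq b 4).
Proof.
move=> ba b1; have := odd_double_half b; set q := b./2.
have [ob|eb] := boolP (odd b) => bq.
  have [k ek jlt] := mod3E (a - q.-1).-2; move: ek jlt; set j := _ %% 3 => ek jlt.
  exists (flatten (nseq q.-1 [:: 3; 4; 4]) ++ flatten (nseq k [:: 3; 3; 3])
          ++ (nseq j.+2 3 ++ [:: 4; 4; 4])); last first.
    apply: loop_cat; first exact/loop_nseq/tileA.
    apply: loop_cat; first exact/loop_nseq/tileA.
    by case: (j) jlt => [|[|[|//]]] _; apply: tileA.
  apply/permP => P; rewrite !(count_cat, count_flatten_nseq, count_nseq) /= !addn0.
  have -> : b = q.-1 * 2 + 3 by lia.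
  have -> : a = q.-1 + (k * 3 + j.+2) by lia.
  by case: (P 3); case: (P 4); rewrite ?mul1n ?mul0n; lia.
have [k ek jlt] := mod3E (a - q); move: ek jlt; set j := _ %% 3 => ek jlt.
exists (flatten (nseq q.-1 [:: 3; 4; 4]) ++ flatten (nseq k [:: 3; 3; 3])
        ++ (nseq j.+1 3 ++ [:: 4; 4])); last first.
  apply: loop_cat; first exact/loop_nseq/tileA.
  apply: loop_cat; first exact/loop_nseq/tileA.
  by case: (j) jlt => [|[|[|//]]] _; apply: tileA.
apply/permP => P; rewrite !(count_cat, count_flatten_nseq, count_nseq) /= !addn0.
have -> : b = q.-1 * 2 + 2 by lia.
have -> : a = q.-1 + (k * 3 + j.+1) by lia.
by case: (P 3); case: (P 4); rewrite ?mul1n ?mul0n; lia.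
Qed.

(** There are enough 4-cycles to give two to each triangle, and the others go in pairs. An unpaired
    one joins a triangle with its two 4-cycles, or a cycle of length at least 6, or two 5-cycles. *)
Lemma tiledB a b s : 2 * a <= b -> all (leq 5) s ->
    ~~ (4 %| 3 * a + 4 * b + sumn s) -> 2 %| 3 * a + 4 * b + sumn s ->
  tiled cutB (nseq a 3 ++ nseq b 4 ++ s).
Proof.
move=> ab s5 n4 n2; have := odd_double_half (b - 2 * a); move: (_./2) => q.
have [ob|eb] := boolP (odd _) => bq; last first.
  exists (flatten (nseq a [:: 3; 4; 4]) ++ flatten (nseq q [:: 4; 4]) ++ s); last first.
    apply: loop_cat; first exact/loop_nseq/tileB.
    by apply: loop_cat; [exact/loop_nseq/tileB | apply: loopB_big].
  apply/permP => P; rewrite !(count_cat, count_flatten_nseq, count_nseq) /= !addn0.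
  have -> : b = a * 2 + q * 2 by lia.
  by case: (P 3); case: (P 4); rewrite ?mul1n ?mul0n; lia.
case: a ab n4 n2 ob bq => [|a] ab n4 n2 ob bq; last first.
  exists (flatten (nseq a [:: 3; 4; 4]) ++ [:: 3; 4; 4; 4]
          ++ flatten (nseq q [:: 4; 4]) ++ s); last first.
    apply: loop_cat; first exact/loop_nseq/tileB.
    apply: loop_cat; first exact: tileB.
    by apply: loop_cat; [exact/loop_nseq/tileB | apply: loopB_big].
  apply/permP => P; rewrite !(count_cat, count_flatten_nseq, count_nseq) /= !addn0.
  have -> : b = a * 2 + 3 + q * 2 by lia.
  by case: (P 3); case: (P 4); rewrite ?mul1n ?mul0n; lia.
have eb : b = q * 2 + 1 by lia.
have [/hasP[m ms m6]|/hasPn no6] := boolP (has (leq 6) s).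
  have pm := perm_to_rem ms.
  exists (flatten (nseq q [:: 4; 4]) ++ [:: 4; m] ++ rem m s); last first.
    apply: loop_cat; first exact/loop_nseq/tileB.
    apply: loop_cat; first exact: (@loopB_4m true).
    by apply: loopB_big; move: s5; rewrite (perm_all _ pm) /= => /andP[].
  apply/permP => P; rewrite !(count_cat, count_flatten_nseq, count_nseq) (permP pm) /= !addn0.
  by rewrite eb; case: (P 4); rewrite ?mul1n ?mul0n; lia.
have es : s = nseq (size s) 5.
  apply/all_pred1P/allP => x xs /=; have := no6 x xs; have := allP s5 x xs.
  by rewrite /=; lia.
(* Here the total is 4 times an odd number plus 5 for each 5-cycle: no 5-cycle would make it
   divisible by 4, a single one would make it odd. *)
have [c ec] : exists c, size s = c.+2.
  move: n4 n2; rewrite es sumn_nseq size_nseq eb; case: (size s) => [|[|c]]; last by exists c.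
    by lia.
  by lia.
exists (flatten (nseq q [:: 4; 4]) ++ [:: 4; 5; 5] ++ nseq c 5); last first.
  apply: loop_cat; first exact/loop_nseq/tileB.
  apply: loop_cat; first exact: tileB.
  by apply: loopB_big; rewrite all_nseq orbT.
apply/permP => P; rewrite es ec !(count_cat, count_flatten_nseq, count_nseq) /= !addn0.
by rewrite eb; case: (P 4); case: (P 5); rewrite ?mul1n ?mul0n; lia.
Qed.

Lemma split_lengths L : all (leq 3) L ->
  exists a b s, perm_eq L (nseq a 3 ++ nseq b 4 ++ s) /\ all (leq 5) s.
Proof.
move=> L3; exists (count_mem 3 L), (count_mem 4 L), (filter (leq 5) L).
split; last exact: filter_all.
apply/permP => P; rewrite !count_cat !count_nseq.
elim: L L3 => [|x L IHL] /=; first by rewrite !muln0.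
case/andP=> x3 /IHL ->; have [->|x3'] := eqVneq x 3; first by rewrite /=; lia.
have [->|x4] := eqVneq x 4; first by rewrite /=; lia.
have x5 : 4 < x by lia.
by rewrite x5 /=; lia.
Qed.

(** Neither cut applies to triangles with at most one 4-cycle and nothing else. Without the 4-cycle
    the total is divisible by 3; with it the type is the excluded one. *)
Theorem strip_tiling L : all (leq 3) L ->
    ~~ (3 %| sumn L) -> ~~ (4 %| sumn L) -> 2 %| sumn L ->
    (forall a, ~~ perm_eq L (4 :: nseq a 3)) ->
  exists S, tiled S L.
Proof.
move=> /split_lengths[a [b [s [pL s5]]]].
have -> : sumn L = 3 * a + 4 * b + sumn s.
  by rewrite (perm_sumn pL) !sumn_cat !sumn_nseq; lia.
move=> n3 n4 n2 not34.
have transfer S : tiled S (nseq a 3 ++ nseq b 4 ++ s) -> tiled S L.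
  by case=> L' pL' lL'; exists L' => //; apply: perm_trans pL'.
have [ba|ab] := ltnP b (2 * a); last first.
  by exists cutB; apply/transfer/tiledB.
exists cutA; apply: transfer; case: s s5 pL n3 n4 n2 => [|m s] s5 pL n3 n4 n2; last first.
  by case/andP: s5 => m5 s5; apply: tiledA_nonempty.
rewrite cats0; apply: tiledA_empty => //.
have [//|b1] := ltnP 1 b; case: b b1 {ba n4 n2} pL n3 => [|[|//]] _ pL; first by rewrite /=; lia.
move=> _; case/negP: (not34 a); apply: (perm_trans pL).
by apply/permP => P; rewrite !count_cat /= !count_nseq !addn0 addnC.
Qed.

(** * From the strip to the circulant graph *)

Definition circulant_cover n L (W : nat -> seq (seq nat)) : Prop :=
  [/\ forall f, f < 4 -> shape (W f) = L,
      forall f, f < 4 -> perm_eq (flatten (W f)) (iota 0 n)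
    & forall m d, m < n -> 0 < d < 5 -> exists2 f, f < 4 & covers (W f) m ((m + d) %% n)].

(** Reading a loop modulo its length identifies the vertices used beyond the right cut with those
    omitted at the left cut, so each factor becomes spanning. *)
Lemma circulant_of_loop S L : 0 < sumn L -> loop S L ->
  exists W, circulant_cover (sumn L) L W.
Proof.
set n := sumn L => n0 [B [sh pm cov]].
exists (fun f => map (map (modn^~ n)) (B f)); split=> [f lf|f lf|m d mn d5].
- rewrite -(sh f lf) /shape -map_comp; apply: eq_map => c /=; exact: size_map.
- have := perm_map (modn^~ n) (pm f lf); rewrite -map_flatten !map_cat -map_comp.
  have -> : map (modn^~ n \o addn n) (nth [::] S f) = map (modn^~ n) (nth [::] S f).
    by apply: eq_map => z /=; rewrite modnDl.
  have -> : map (modn^~ n) (iota 0 n) = iota 0 n.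
    apply: map_id_in => z; rewrite mem_iota /= => zn; exact: modn_small.
  move=> p; rewrite -(perm_cat2l (map (modn^~ n) (nth [::] S f))).
  by apply: (perm_trans p); rewrite perm_catC.
- have key t x y : t < n -> (x, y) \in strip_edges t -> x %% n = m -> y %% n = (m + d) %% n ->
      exists2 f, f < 4 & covers (map (map (modn^~ n)) (B f)) m ((m + d) %% n).
    move=> tn /(cov t x y tn)[f lf c] <- <-; exists f => //.
    exact: (covers_map (modn^~ n) c).
  (* In [strip_edges t] the differences 1 and 3 start at [t.+1], the differences 2 and 4 at [t]. For
     an odd difference from [m] the group is thus that of the cyclic predecessor [t0]. *)
  pose t0 := (m + n).-1 %% n.
  have t1 : (t0 + 1) %% n = m.
    by rewrite modnDml addn1 prednK ?modnDr ?modn_small //; lia.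
  have sh0 k : (t0 + 1 + k) %% n = (m + k) %% n by rewrite -modnDml t1.
  have tn : t0 < n by rewrite ltn_mod.
  have [d1|[d2|[d3|d4]]] : d = 1 \/ d = 2 \/ d = 3 \/ d = 4 by lia.
  + apply: (key t0 t0.+1 t0.+2 tn); rewrite ?inE ?eqxx //; first by rewrite -addn1.
    by rewrite d1 -sh0; congr (_ %% _); lia.
  + apply: (key m m m.+2 mn); [by rewrite !inE !eqxx ?orbT | exact: modn_small |].
    by rewrite d2 addn2.
  + apply: (key t0 t0.+1 (t0 + 4) tn); rewrite ?inE ?eqxx ?orbT //; first by rewrite -addn1.
    by rewrite d3 -sh0; congr (_ %% _); lia.
  + apply: (key m m (m + 4) mn); [by rewrite !inE !eqxx ?orbT | exact: modn_small |].
    by rewrite d4.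
Qed.

(** * Quartic classes and the circulant pieces *)

Section QuarticClasses.
Variables (p k : nat).
Hypotheses (p_pr : prime p) (pk : p = (4 * k).+1) (k_odd : odd k).
Local Open Scope ring_scope.

Local Notation F := 'F_p.
Definition chi (x : F) : F := x ^+ k.

Lemma chiM x y : chi (x * y) = chi x * chi y.
Proof. exact: exprMn. Qed.

Lemma chiX x n : chi (x ^+ n) = chi x ^+ n.
Proof. by rewrite /chi -!exprM mulnC. Qed.

Lemma chi0 x : x != 0 -> chi x != 0.
Proof. exact: expf_neq0. Qed.

Lemma chiV x : chi x^-1 = (chi x)^-1.
Proof. exact: exprVn. Qed.

Lemma Fp_eq0 n : (n%:R == 0 :> F) = (p %| n)%N.
Proof. by rewrite -(dvdn_pcharf (pchar_Fp p_pr)). Qed.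

Lemma two_neq0 : 2%:R != 0 :> F.
Proof. by rewrite Fp_eq0; apply/negP => /dvdn_leq; lia. Qed.

Lemma one_neq_opp1 : 1 != -1 :> F.
Proof. by rewrite -subr_eq0 opprK -(natrD _ 1 1) two_neq0. Qed.

Lemma chi4 x : x != 0 -> chi x ^+ 4 = 1.
Proof.
move=> x0; rewrite /chi -exprM mulnC.
have xp : x ^+ p = x.
  rewrite -[x in LHS]natr_Zp -natrX -(Fp_nat_mod p_pr) (fermat_little _ p_pr).
  by rewrite Fp_nat_mod // natr_Zp.
by apply: (mulfI x0); rewrite mulr1 -exprS -pk.
Qed.

Lemma chi_opp1 : chi (-1) = -1.
Proof. by rewrite /chi -signr_odd k_odd expr1. Qed.

Lemma sqr_eq1 (x : F) : x ^+ 2 = 1 -> x = 1 \/ x = -1.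
Proof.
move/eqP; rewrite -subr_eq0 subr_sqr_1 mulf_eq0 subr_eq0 addr_eq0.
by case/orP => /eqP; [left | right].
Qed.

Lemma unity_roots_bound n : (0 < n)%N -> (#|[pred x : F | (x ^+ n == 1)%R]| <= n)%N.
Proof.
move=> n0; rewrite cardE; apply: max_unity_roots => //.
  by apply/allP => x; rewrite mem_enum inE unity_rootE.
exact: enum_uniq.
Qed.

(** The equation z^(2k) = 1 has at most 2k roots among the 4k nonzero elements; for any other z,
    chi(z) squares to -1. *)
Lemma exists_sqrtN1 : exists i : F, i ^+ 2 = -1.
Proof.
have k0 : (0 < k)%N by case: (k) k_odd.
have [/forallP all1|/forallPn[z]] := boolP [forall x : F, (x != 0) ==> (x ^+ (2 * k) == 1)].
  have := @unity_roots_bound (2 * k); rewrite muln_gt0 k0 => /(_ isT).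
  have : (#|[pred x : F | (x != 0)%R]| <= #|[pred x : F | (x ^+ (2 * k) == 1)%R]|)%N.
    by apply: subset_leq_card; apply/subsetP => x; rewrite !inE => x0; have := all1 x; rewrite x0.
  by have := cardC1 (0 : F); rewrite card_Fp // => ->; lia.
rewrite negb_imply => /andP[z0 z1]; exists (chi z).
have /sqr_eq1[e|//] : (chi z ^+ 2) ^+ 2 = 1 by rewrite -exprM chi4.
by move: z1; rewrite mulnC exprM -/(chi z) e eqxx.
Qed.

(* (1 + i)^2 = 2i, and 2i is a square while i is not since p = 5 mod 8. *)
Lemma chi2_sqr : chi 2%:R ^+ 2 = -1.
Proof.
have [i i2] := exists_sqrtN1.
have i1 : 1 + i != 0.
  rewrite addrC addr_eq0; apply/eqP => e; move: i2; rewrite e sqrrN expr1n => /eqP.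
  by apply/negP/one_neq_opp1.
have := chi4 i1; rewrite (_ : 4 = 2 * 2)%N // exprM -chiX.
have -> : (1 + i) ^+ 2 = 2%:R * i.
  by rewrite sqrrD i2 expr1n mul1r addrAC subrr add0r mulr_natl.
rewrite chiM exprMn -[chi i ^+ 2]chiX i2 chi_opp1 mulrN1 => e.
by apply: oppr_inj; rewrite e opprK.
Qed.

Lemma chi_cases x : x != 0 ->
  [\/ chi x = 1, chi x = -1, chi x = chi 2%:R | chi x = - chi 2%:R].
Proof.
move=> x0; have /sqr_eq1[/sqr_eq1[]->|e] : (chi x ^+ 2) ^+ 2 = 1 by rewrite -exprM chi4.
- exact: Or41.
- exact: Or42.
have : (chi x - chi 2%:R) * (chi x + chi 2%:R) = 0 by rewrite -subr_sqr e chi2_sqr subrr.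
by move/eqP; rewrite mulf_eq0 subr_eq0 addr_eq0 => /orP[]/eqP->; [exact: Or43|exact: Or44].
Qed.

Lemma chi_exp x : x != 0 -> exists2 a, (a < 4)%N & chi x = chi 2%:R ^+ a.
Proof.
case/chi_cases=> ->; [exists 0%N|exists 2%N|exists 1%N|exists 3%N] => //.
  by rewrite chi2_sqr.
by rewrite exprS chi2_sqr mulrN1.
Qed.

(** The classes of 1, -1, 2, -2 are all four classes. It is used for the edges inside a side, where
    the sign of a difference is immaterial. *)
Lemma same_side_class z : z != 0 ->
  exists g : F, chi g = 1 /\ [\/ z = g, z = - g, z = 2%:R * g | z = - (2%:R * g)].
Proof.
move=> z0; case: (chi_cases z0) => e.
- by exists z; split=> //; apply: Or41.
- exists (- z); split; last by apply: Or42; rewrite opprK.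
  by rewrite -mulN1r chiM chi_opp1 e mulN1r opprK.
- exists (2%:R^-1 * z); split; last by apply: Or43; rewrite mulVKf ?two_neq0.
  by rewrite chiM chiV e mulVf // chi0 // two_neq0.
- exists (- (2%:R^-1 * z)); split; last by apply: Or44; rewrite mulrN opprK mulVKf ?two_neq0.
  by rewrite -mulN1r !chiM chiV chi_opp1 e mulN1r mulrN opprK mulVf // chi0 // two_neq0.
Qed.

Section Pieces.
Variables (x0 e : F).
Hypothesis e0 : e != 0.
Hypothesis AP_classes : forall d : F, d != 0 ->
  exists g j, [/\ chi g = 1, (j < 4)%N & d = g * (x0 + 2%:R * e * j%:R)].

(** Z_2p is split by parity, and the shift x0 + 3e of the odd points is chosen for the cross
    differences: steps 3 and 1 out of an odd point and 1 and 3 out of an even point give x0 + 2ej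
    for j = 0, 1, 2, 3, times [g] and measured from the even side. Steps 2 and 4 give 2e and 4e. So
    [e] is half the common difference of the progression. *)
Definition place (g : F) (m : nat) : F * bool :=
  (g * (e * m%:R + (if odd m then x0 + 3%:R * e else 0)), odd m).

Definition swap_side (x : F * bool) : F * bool := (x.1, ~~ x.2).

Lemma p_odd : odd p. Proof. by rewrite pk /= oddM. Qed.

Lemma place_mod g m : place g (m %% (2 * p)) = place g m.
Proof.
have o : odd (m %% (2 * p)) = odd m.
  by rewrite {2}(divn_eq m (2 * p)) oddD !oddM /= andbF.
rewrite /place o; congr (_ * (_ * _ + _), _).
by rewrite -[LHS](Fp_nat_mod p_pr) modn_dvdm ?dvdn_mull // Fp_nat_mod.
Qed.

Lemma place_surj g x : chi g = 1 -> exists2 m, (m < 2 * p)%N & place g m = x.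
Proof.
move=> g1; have g0 : g != 0.
  by apply: contra_eq_neq g1 => ->; rewrite /chi expr0n; case: (k) k_odd => //; rewrite eq_sym oner_eq0.
case: x => u b; pose z : F := e^-1 * (g^-1 * u - (if b then x0 + 3%:R * e else 0)).
have zp : (z < p)%N by have := ltn_ord z; rewrite {2}Fp_cast.
have zz : (z%:R : F) = z by rewrite natr_Zp.
(* As p is odd, exactly one of z and z + p has the required parity. *)
pose m := if odd z == b then (z : nat) else (z + p)%N.
have mb : odd m = b.
  by rewrite /m; case: eqVneq => // zb; rewrite oddD p_odd; move: zb; case: (odd z); case: (b).
have mz : (m%:R : F) = z.
  have pR : p%:R = 0 :> F by apply/eqP; rewrite Fp_eq0.
  by rewrite /m; case: ifP => _; rewrite ?natrD zz // pR addr0.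
exists m; first by rewrite /m; case: ifP; lia.
by rewrite /place mb mz mulVKf // subrK mulVKf.
Qed.

Definition fourth_powers := {g : F | chi g == 1}.

Lemma card_fourth_powers : (#|{: fourth_powers}| <= k)%N.
Proof.
rewrite card_sig; apply: unity_roots_bound; by case: (k) k_odd.
Qed.

Variables (L : seq nat) (W : nat -> seq (seq nat)).
Hypothesis W_cover : circulant_cover (2 * p) L W.

Definition copy (j : fourth_powers * 'I_4) : seq (seq (F * bool)) :=
  map (map (place (val j.1))) (W j.2).

Lemma copy_shape j : shape (copy j) = L.
Proof.
case: W_cover => sh _ _; rewrite -(sh j.2 (ltn_ord _)) /copy /shape -map_comp.
by apply: eq_map => c /=; rewrite size_map.
Qed.

Lemma copy_uniq j : uniq (flatten (copy j)).
Proof.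
case: W_cover => _ pm _; rewrite -map_flatten (perm_uniq (perm_map _ (pm j.2 (ltn_ord _)))).
apply: (@leq_size_uniq _ (enum {: F * bool})); first exact: enum_uniq.
  move=> x _; have [m mp <-] := place_surj x (eqP (valP j.1)).
  by apply: map_f; rewrite mem_iota.
by rewrite size_map size_iota -cardE card_prod card_bool card_Fp // mulnC.
Qed.

Lemma copy_step g m d : chi g = 1 -> (0 < d < 5)%N ->
  exists j, covers (copy j) (place g m) (place g (m + d)).
Proof.
move=> g1 d5; case: W_cover => _ _ cov.
have n0 : (0 < 2 * p)%N by lia.
have [f lf c] := cov (m %% (2 * p))%N d (ltn_pmod _ n0) d5.
exists (Sub g (introT eqP g1), Ordinal lf).
by have := covers_map (place g) c; rewrite modnDml !place_mod.
Qed.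

Lemma place_plus g m d u b :
    place g m = (u, b) ->
  place g (m + d) = (u + g * (e * d%:R + (if odd d then (if b then -1 else 1) * (x0 + 3%:R * e)
                                          else 0)), b (+) odd d).
Proof.
rewrite /place oddD => -[<- ->]; congr pair; rewrite natrD.
by case: (odd d); case: b => /=; ring.
Qed.

Lemma copy_cover x y : x != y -> y != swap_side x -> exists j, covers (copy j) x y.
Proof.
have cross (u v : F) : u != v -> exists j, covers (copy j) (u, false) (v, true).
  move=> uv; have vu : v - u != 0 by rewrite subr_eq0 eq_sym.
  have [g [j [g1 j4 e1]]] := AP_classes vu.
  have ev : v = u + g * (x0 + 2%:R * e * j%:R) by rewrite -e1 addrC subrK.
  (* The terms j = 0, 1 arise from steps that start on the odd side, the terms j = 2, 3 from steps
     that start on the even side. *)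
  have [j1|j1] := ltnP j 2.
    have [m _ em] := place_surj (v, true) g1.
    have [|i c] := @copy_step g m (3 - 2 * j)%N g1; first by lia.
    exists i; rewrite covers_sym; move: c; rewrite (place_plus _ em) em.
    have -> : odd (3 - 2 * j) by lia.
    have -> : v + g * (e * (3 - 2 * j)%:R + -1 * (x0 + 3%:R * e)) = u; last by [].
      rewrite ev natrB ?natrM; last by lia.
      by ring.
  have [m _ em] := place_surj (u, false) g1.
  have [|i c] := @copy_step g m (2 * j - 3)%N g1; first by lia.
  exists i; move: c; rewrite (place_plus _ em) em.
  have -> : odd (2 * j - 3) by lia.
  have -> : u + g * (e * (2 * j - 3)%:R + 1 * (x0 + 3%:R * e)) = v; last by [].
    rewrite ev natrB ?natrM; last by lia.
    by ring.
have same (g u : F) b d : chi g = 1 -> ((d == 1) || (d == 2))%N ->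
    exists j, covers (copy j) (u, b) (u + g * (2%:R * e * d%:R), b).
  move=> g1 d12; have [m _ em] := place_surj (u, b) g1.
  have [|i c] := @copy_step g m (2 * d)%N g1; first by lia.
  exists i; move: c; rewrite (place_plus _ em) em oddM addbF addr0.
  have -> : e * (2 * d)%:R = 2%:R * e * d%:R; last by [].
    by rewrite natrM; ring.
have sym (x1 y1 : F * bool) :
    (exists j, covers (copy j) x1 y1) -> exists j, covers (copy j) y1 x1.
  by case=> j c; exists j; rewrite covers_sym.
have side (u v : F) b : u != v -> exists j, covers (copy j) (u, b) (v, b).
  move=> uv; have e2 : 2%:R * e != 0 by rewrite mulf_neq0 ?two_neq0.
  have z0 : (2%:R * e)^-1 * (v - u) != 0 by rewrite mulf_neq0 ?invr_eq0 // subr_eq0 eq_sym.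
  have [g [g1 cases]] := same_side_class z0.
  have evu : v - u = 2%:R * e * ((2%:R * e)^-1 * (v - u)) by rewrite mulVKf.
  have shiftE (w1 w2 t : F) : w2 - w1 = t -> w2 = w1 + t by move=> <-; rewrite addrC subrK.
  have shiftE' (w1 w2 t : F) : w2 - w1 = - t -> w1 = w2 + t.
    by move=> e1; rewrite -[t]opprK -e1 opprB addrC subrK.
  case: cases evu => -> evu.
  - have -> : v = u + g * (2%:R * e * 1%:R) by apply: shiftE; rewrite evu; ring.
    exact: same.
  - have -> : u = v + g * (2%:R * e * 1%:R) by apply: shiftE'; rewrite evu; ring.
    by apply: sym; apply: same.
  - have -> : v = u + g * (2%:R * e * 2%:R) by apply: shiftE; rewrite evu; ring.
    exact: same.
  - have -> : u = v + g * (2%:R * e * 2%:R) by apply: shiftE'; rewrite evu; ring.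
    by apply: sym; apply: same.
case: x y => [u b] [v c]; rewrite /swap_side /= !xpair_eqE.
have [<-{c}|bc] := eqVneq b c; first by rewrite andbT => uv _; apply: side.
have -> : c = ~~ b by case: b c bc => -[].
rewrite eqxx andbT => _; rewrite eq_sym => uv; case: b {bc}; last exact: cross.
by apply: sym; apply: cross; rewrite eq_sym.
Qed.

Lemma OP_of_circulant (V : finType) (G : sgraph V) cs :
    regular 2 G -> #|V| = (2 * p)%N -> perm_eq (flatten cs) (enum V) ->
    all (cycle (adj G)) cs -> perm_eq (shape cs) L ->
  OP_solvable G.
Proof.
move=> regG cardV pcs ccs pL.
apply: (@OP_of_cycle_cover V (F * bool)%type (fourth_powers * 'I_4)%type G swap_side copy cs L).
all: rewrite ?cardV ?card_prod ?card_bool ?card_Fp ?card_ord //.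
- by rewrite mulnC.
- by rewrite oddM.
(* At most k multipliers with four factors each, and 8k + 2 = 2p: the bound required is met without
   slack. *)
- apply: (@leq_trans (2 * (k * 4) + 2)%N); last by lia.
  by rewrite leq_add2r leq_pmul2l // leq_pmul2r // card_fourth_powers.
- by case=> u b; rewrite /swap_side /= negbK.
- by case=> u b; rewrite /swap_side xpair_eqE /= andbC; case: b.
- exact: copy_shape.
- exact: copy_uniq.
- exact: copy_cover.
Qed.
End Pieces.

Lemma chi_smooth (qs a : seq nat) n :
    size qs = size a -> (forall i, i < size qs -> chi (nth 0 qs i)%:R = chi 2%:R ^+ nth 0 a i)%N ->
  chi (foldr muln 1 [seq q ^ logn q n | q <- qs])%N%:R
    = chi 2%:R ^+ sumn [seq x.1 * x.2 | x <- zip a [seq logn q n | q <- qs]]%N.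
Proof.
elim: qs a => [|q qs IHqs] [|c a] //= => [_ _|[sz] ch]; first by rewrite /chi expr1n expr0.
rewrite natrM natrX chiM chiX (ch 0%N) //= -exprM exprD (IHqs a) // => i li.
exact: (ch i.+1).
Qed.
End QuarticClasses.

(** * Progressions of smooth integers that meet all quartic classes *)

Definition small_primes := [:: 2; 3; 5; 7; 11; 13].

(** A negative sign counts 2 because chi(-1) = -1 is the square of chi(2). *)
Definition int_data (z : int) : nat * seq nat :=
  (if (z < 0)%R then 2 else 0, [seq logn q `|z|%N | q <- small_primes]).

(** The exponent of chi to the base chi(2), given assumed exponents [a] at 3, 5, 7, 11, 13; the
    leading 1 belongs to the prime 2. *)
Definition quartic_exponent (a : seq nat) (d : nat * seq nat) : nat :=
  d.1 + sumn [seq x.1 * x.2 | x <- zip (1 :: a) d.2].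

Definition progressions : seq (int * int) :=
  [seq ((if x.1.1 then - (x.1.2%:Z) else x.1.2%:Z)%R, Posz x.2) | x <-
  [:: (true, 3, 2); (true, 1, 3); (true, 4, 3); (true, 2, 3); (false, 3, 5); (true, 1, 7);
      (true, 9, 7); (true, 2, 17); (true, 8, 11); (true, 1, 17); (false, 5, 3);
      (true, 15, 14); (false, 9, 41); (true, 3, 8); (false, 6, 5); (true, 27, 20);
      (false, 2, 3); (false, 24, 1)]].

Definition terms (ap : int * int) : seq int := [seq (ap.1 + ap.2 * j%:Z)%R | j <- iota 0 4].

Definition all_hit (a : seq nat) (ds : seq (nat * seq nat)) : bool :=
  all (fun b => has (fun d => quartic_exponent a d %% 4 == b) ds) (iota 0 4).

Definition exponent_choices : seq (seq nat) :=
  iter 5 (fun ss => [seq x :: s | x <- iota 0 4, s <- ss]) [:: [::]].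

Lemma progressions_hit :
  let ds := [seq map int_data (terms ap) | ap <- progressions] in
  all (fun a => has (all_hit a) ds) exponent_choices.
Proof. by vm_cast_no_check (erefl true). Qed.

Lemma progressions_smooth : all (fun ap => all (fun z =>
  `|z|%N == foldr muln 1 [seq q ^ logn q `|z|%N | q <- small_primes]) (terms ap)) progressions.
Proof. by vm_cast_no_check (erefl true). Qed.

Lemma mem_exponent_choices (s : seq nat) :
  size s = 5 -> all (gtn 4) s -> s \in exponent_choices.
Proof.
rewrite /exponent_choices; elim: 5 s => [|n IHn] [|x s] // [sz] /andP[x4 s4].
by rewrite iterS; apply/allpairsP; exists (x, s); split; rewrite ?mem_iota ?IHn.
Qed.

Lemma exists_progression p k (p_pr : prime p) (pk : p = (4 * k).+1) (k_odd : odd k) :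
    13 < p ->
  (exists x0 e : 'F_p, e != 0 /\ forall d, d != 0 ->
    exists g j, [/\ chi k g = 1, (j < 4)%N & d = g * (x0 + 2%:R * e * j%:R)])%R.
Proof.
move=> p13.
have q0 i : (i < 6)%N -> ((nth 0%N small_primes i)%:R != 0 :> 'F_p)%R.
  move=> i6; rewrite Fp_eq0 //; apply/negP => /dvdn_leq.
  by case: i i6 => [|[|[|[|[|[|i]]]]]] //=; lia.
(* The guard [i < 6] makes the statement hold for every [i], so that [ex_minn] defines a function
   [c] of exponents. *)
have ex i : exists a, (a < 4) && ((i < 6) ==> (chi k (nth 0%N small_primes i)%:R == chi k 2%:R ^+ a :> 'F_p)%R).
  case: (ltnP i 6) => [i6|]; last by exists 0.
  by have [a a4 ->] := chi_exp p_pr pk k_odd (q0 i i6); exists a; rewrite a4 eqxx.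
pose c i := ex_minn (ex i.+1).
have cP i : (c i < 4) /\ ((i < 5)%N -> chi k (nth 0%N small_primes i.+1)%:R = chi k 2%:R ^+ c i :> 'F_p)%R.
  rewrite /c; case: ex_minnP => a /andP[a4 /implyP ea] _; split=> // i5.
  exact/eqP/ea.
have cs4 : all (gtn 4) (mkseq c 5) by rewrite /= !(cP _).1.
have := allP progressions_hit _ (mem_exponent_choices (size_mkseq c 5) cs4).
case/hasP=> _ /mapP[ap apP ->] hit.
have sm z : z \in terms ap -> chi k (z%:~R : 'F_p)%R = (chi k 2%:R ^+ quartic_exponent (mkseq c 5) (int_data z))%R.
  move=> zP; have /eqP zs := allP (allP progressions_smooth _ apP) _ zP.
  have ch := @chi_smooth p k small_primes (1 :: mkseq c 5) `|z| erefl.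
  rewrite /quartic_exponent /int_data exprD -ch => [|i]; last first.
    case: i => [|i] i6; first by rewrite expr1.
    by rewrite [in RHS]/= -[nth _ _ i]/(nth 0%N (mkseq c 5) i) nth_mkseq // (cP i).2.
  rewrite -zs; case: (Num.Theory.ltrP z 0%R) => z0 /=.
    rewrite (chi2_sqr p_pr pk k_odd) -(chi_opp1 p k_odd) -chiM mulN1r.
    by rewrite -[z in LHS]opprK mulrNz -(ltz0_abs z0).
  by rewrite mul1r -{1}(gez0_abs z0).
have i4 n m : (n = m %[mod 4])%N -> (chi k (2%:R : 'F_p) ^+ n = chi k 2%:R ^+ m)%R.
  move=> nm; rewrite (divn_eq n 4) (divn_eq m 4) nm !exprD ![(_ * 4)%N]mulnC !exprM.
  by rewrite chi4 ?expr1n // (two_neq0 p_pr pk k_odd).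
have hit4 b : b < 4 -> exists2 j, j < 4 &
    chi k ((ap.1 + ap.2 * j%:Z)%:~R : 'F_p)%R = (chi k 2%:R ^+ b)%R.
  move=> b4; have := allP hit b; rewrite mem_iota => /(_ b4)/hasP[_ /mapP[z zP ->] /eqP zb].
  case/mapP: (zP) => j; rewrite mem_iota => j4 ez; exists j; rewrite // -ez sm //.
  by apply: i4; rewrite zb modn_small.
pose e : 'F_p := (2%:R^-1 * ap.2%:~R)%R.
have e2 : (2%:R * e = ap.2%:~R)%R by rewrite mulVKf // (two_neq0 p_pr pk k_odd).
exists (ap.1%:~R)%R, e; split.
  (* With common difference 0 in F_p all four terms would coincide, but one has class 1 and another
     class chi(2). *)
  apply/eqP => e0; have [j _] := hit4 0 isT; have [j' _] := hit4 1 isT.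
  rewrite !rmorphD !rmorphM /= -e2 e0 mulr0 !mul0r addr0 => -> /esym /eqP.
  rewrite expr0 expr1; apply/negP; apply/eqP => e1; have := chi2_sqr p_pr pk k_odd.
  by rewrite -e1 expr1n => /eqP; apply/negP/(one_neq_opp1 p_pr pk k_odd).
move=> d d0; have [b b4 db] := chi_exp p_pr pk k_odd d0; have [j j4 jb] := hit4 b b4.
have z0 : ((ap.1 + ap.2 * j%:Z)%:~R != 0 :> 'F_p)%R.
  apply/eqP => z0; move: jb; rewrite z0 -db {1}/chi expr0n; case: (k) k_odd => // k' _ /= /eqP.
  by rewrite eq_sym; apply/negP; apply: chi0.
exists (d / (ap.1 + ap.2 * j%:Z)%:~R)%R, j; split=> //.
  by rewrite chiM chiV jb db mulfV // expf_neq0 // chi0 // (two_neq0 p_pr pk k_odd).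
have ez : ((ap.1 + ap.2 * j%:Z)%:~R = ap.1%:~R + ap.2%:~R * j%:R :> 'F_p)%R.
  by rewrite rmorphD rmorphM.
by rewrite e2 -ez mulfVK.
Qed.

(** * Order 26 *)

(* The points are Z_12 x {0, 1} (numbered 0..23) and two fixed points 24, 25;
   Z_12 permutes the twelve factors, so one base factor per cycle type suffices. *)
Definition spin (j x : nat) : nat :=
  if x < 12 then (x + j) %% 12 else if x < 24 then 12 + (x + j) %% 12 else x.

Definition mate26 (x : nat) : nat :=
  if x < 24 then spin 6 x else if x == 24 then 25 else 24.

(** The points 0, 12, 24, 25 represent the orbits of the rotation, so only pairs starting at one of
    them have to be tested. *)
Definition starter_ok (s : seq (seq nat)) : bool :=
  perm_eq (flatten s) (iota 0 26)
  && all (fun x => all (fun y => [|| x == y, y == mate26 x |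
        has (fun j => covers s (spin j x) (spin j y)) (iota 0 12)]) (iota 0 26))
       [:: 0; 12; 24; 25].

Definition starters : seq (seq (seq nat)) :=
  [:: [:: [:: 24; 20; 15; 0; 8; 9; 25; 22; 18; 19; 16; 2; 23; 21; 4; 17; 11; 6; 14; 10; 7; 5; 12; 1;
  13; 3]]; [:: [:: 25; 0; 15; 10; 14; 23; 13; 20; 11; 1; 6; 12; 2; 5; 9; 8; 16; 4; 17; 21; 7; 18;
  19]; [:: 24; 3; 22]]; [:: [:: 25; 0; 4; 5; 22; 7; 13; 20; 1; 23; 15; 6; 9; 11; 12; 8; 3; 14; 2;
  16; 19; 21]; [:: 24; 10; 18; 17]]; [:: [:: 25; 19; 3; 5; 2; 13; 0; 12; 17; 7; 14; 23; 21; 6; 20;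
  16; 15; 9; 8; 4; 11]; [:: 24; 10; 18; 1; 22]]; [:: [:: 25; 19; 8; 5; 9; 22; 3; 13; 16; 21; 17; 15;
  14; 11; 4; 6; 20; 2; 23; 7]; [:: 24; 10; 18; 1; 0; 12]]; [:: [:: 13; 8; 5; 19; 7; 6; 14; 21; 0; 4;
  17; 20; 12; 9; 11; 22; 3; 10; 16; 15]; [:: 24; 2; 18]; [:: 25; 1; 23]]; [:: [:: 25; 6; 17; 11; 20;
  21; 13; 3; 19; 14; 7; 5; 2; 16; 4; 9; 22; 12; 15]; [:: 24; 10; 18; 1; 0; 8; 23]]; [:: [:: 15; 8;
  6; 3; 12; 19; 4; 16; 14; 22; 5; 10; 11; 7; 21; 1; 23; 20; 9]; [:: 24; 2; 18; 17]; [:: 25; 0; 13]];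
  [:: [:: 25; 5; 14; 12; 19; 16; 17; 2; 9; 20; 7; 4; 23; 15; 3; 21; 11; 13]; [:: 24; 10; 18; 1; 0;
  8; 6; 22]]; [:: [:: 1; 12; 14; 18; 17; 4; 2; 9; 23; 16; 19; 11; 20; 8; 13; 7; 6; 10]; [:: 24; 3;
  22; 0; 15]; [:: 25; 21; 5]]; [:: [:: 19; 23; 8; 7; 13; 1; 11; 20; 9; 22; 3; 6; 10; 12; 4; 21; 14;
  16]; [:: 24; 2; 18; 17]; [:: 25; 0; 5; 15]]; [:: [:: 25; 21; 10; 1; 8; 9; 14; 12; 4; 16; 7; 5; 23;
  18; 19; 6; 2]; [:: 24; 3; 22; 0; 15; 11; 13; 17; 20]]; [:: [:: 21; 6; 11; 20; 7; 5; 8; 4; 22; 14;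
  15; 13; 16; 23; 3; 17; 10]; [:: 24; 2; 18; 1; 0; 12]; [:: 25; 19; 9]]; [:: [:: 10; 8; 5; 17; 4;
  18; 23; 2; 13; 9; 1; 19; 20; 16; 14; 6; 11]; [:: 24; 3; 22; 0; 15]; [:: 25; 21; 12; 7]]; [:: [::
  10; 6; 7; 20; 19; 11; 2; 4; 21; 23; 1; 8; 14; 17; 5; 16; 12]; [:: 24; 3; 22]; [:: 25; 0; 15]; [::
  18; 9; 13]]; [:: [:: 25; 9; 2; 15; 19; 7; 4; 13; 3; 17; 11; 14; 23; 16; 5; 12]; [:: 24; 10; 18; 1;
  0; 8; 6; 22; 20; 21]]; [:: [:: 4; 11; 20; 8; 6; 10; 16; 15; 12; 5; 13; 3; 14; 19; 21; 17]; [:: 24;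
  2; 18; 1; 0; 9; 23]; [:: 25; 7; 22]]; [:: [:: 2; 15; 22; 6; 7; 11; 1; 10; 19; 5; 12; 23; 14; 3;
  13; 17]; [:: 25; 16; 8; 20; 18; 0]; [:: 24; 21; 4; 9]]; [:: [:: 1; 11; 17; 4; 7; 16; 23; 6; 14;
  18; 20; 8; 19; 5; 10; 2]; [:: 24; 3; 22; 0; 15]; [:: 25; 21; 12; 13; 9]]; [:: [:: 25; 9; 17; 10;
  8; 5; 18; 23; 14; 15; 0; 1; 6; 2; 16; 12]; [:: 7; 19; 3; 13]; [:: 24; 21; 4]; [:: 20; 22; 11]];
  [:: [:: 25; 14; 18; 15; 10; 12; 11; 3; 21; 0; 23; 4; 16; 6; 1]; [:: 24; 7; 5; 8; 9; 13; 20; 19;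
  17; 2; 22]]; [:: [:: 13; 9; 18; 0; 2; 16; 5; 4; 1; 23; 12; 7; 20; 8; 15]; [:: 24; 6; 21; 25; 10;
  3; 11; 19]; [:: 17; 22; 14]]; [:: [:: 8; 16; 17; 15; 22; 19; 4; 6; 13; 21; 3; 14; 5; 10; 20]; [::
  24; 2; 18; 1; 0; 9; 23]; [:: 25; 7; 11; 12]]; [:: [:: 2; 19; 17; 11; 20; 8; 7; 5; 16; 23; 12; 10;
  1; 14; 6]; [:: 24; 3; 22; 0; 15; 18]; [:: 25; 21; 13; 9; 4]]; [:: [:: 25; 1; 9; 10; 23; 6; 16; 12;
  17; 3; 14; 7; 5; 0; 15]; [:: 20; 21; 19; 11; 8]; [:: 24; 2; 18]; [:: 22; 13; 4]]; [:: [:: 25; 1;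
  9; 10; 23; 6; 16; 12; 17; 3; 5; 8; 20; 0; 21]; [:: 11; 4; 19; 22]; [:: 14; 7; 13; 15]; [:: 24; 2;
  18]]; [:: [:: 25; 16; 5; 4; 2; 20; 19; 12; 7; 10; 18; 6; 1; 9]; [:: 24; 3; 22; 0; 15; 11; 13; 17;
  8; 21; 23; 14]]; [:: [:: 6; 10; 3; 17; 11; 12; 4; 15; 8; 23; 22; 13; 20; 16]; [:: 24; 2; 18; 1; 0;
  9; 7; 19; 21]; [:: 25; 5; 14]]; [:: [:: 16; 3; 11; 20; 5; 10; 17; 21; 23; 14; 4; 15; 22; 8]; [::
  24; 2; 18; 1; 0; 9; 7; 19]; [:: 25; 6; 12; 13]]; [:: [:: 19; 4; 13; 15; 22; 3; 21; 20; 10; 5; 17;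
  14; 6; 8]; [:: 24; 2; 18; 1; 0; 9; 23]; [:: 25; 7; 11; 12; 16]]; [:: [:: 24; 2; 13; 7; 10; 15; 11;
  4; 17; 12; 23; 14; 22; 20]; [:: 25; 21; 9; 18; 3; 1]; [:: 0; 19; 5; 6; 16; 8]]; [:: [:: 25; 1; 9;
  10; 23; 6; 16; 12; 17; 3; 14; 11; 8; 15]; [:: 0; 20; 21; 19; 7; 5]; [:: 24; 2; 18]; [:: 4; 13;
  22]]; [:: [:: 2; 13; 18; 17; 11; 20; 4; 16; 14; 6; 19; 23; 9; 1]; [:: 24; 3; 22; 0; 15]; [:: 25;
  21; 12; 7]; [:: 10; 8; 5]]; [:: [:: 25; 16; 8; 20; 18; 15; 5; 23; 0; 14; 22; 1; 11; 2]; [:: 24;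
  21; 4; 9]; [:: 13; 10; 17; 12]; [:: 7; 3; 19; 6]]; [:: [:: 19; 22; 9; 10; 16; 21; 20; 12; 0; 7;
  14; 11; 3; 17]; [:: 24; 2; 18]; [:: 25; 1; 23]; [:: 13; 8; 5]; [:: 6; 4; 15]]; [:: [:: 24; 6; 21;
  25; 10; 3; 11; 19; 15; 14; 12; 0; 17]; [:: 20; 7; 23; 9; 8; 18; 13; 16; 5; 2; 4; 22; 1]]; [:: [::
  5; 1; 12; 23; 18; 16; 19; 7; 4; 6; 14; 9; 10]; [:: 24; 3; 22; 0; 15; 11; 13; 17; 8; 21]; [:: 25;
  20; 2]]; [:: [:: 8; 12; 2; 16; 4; 23; 22; 20; 9; 18; 13; 7; 5]; [:: 24; 6; 21; 25; 10; 3; 11; 19;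
  15]; [:: 0; 17; 14; 1]]; [:: [:: 7; 12; 23; 1; 13; 16; 0; 2; 5; 4; 18; 9; 20]; [:: 24; 6; 21; 25;
  10; 3; 11; 19]; [:: 17; 22; 14; 8; 15]]; [:: [:: 8; 19; 10; 3; 13; 5; 17; 20; 21; 6; 4; 22; 15];
  [:: 24; 2; 18; 1; 0; 9; 23]; [:: 25; 7; 11; 12; 16; 14]]; [:: [:: 25; 1; 9; 10; 23; 6; 16; 12; 17;
  20; 8; 11; 19]; [:: 7; 14; 0; 5; 3; 21; 22]; [:: 24; 2; 18]; [:: 13; 4; 15]]; [:: [:: 25; 1; 9;
  10; 23; 6; 16; 12; 17; 3; 0; 19; 21]; [:: 14; 8; 20; 11; 4; 15]; [:: 5; 7; 22; 13]; [:: 24; 2;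
  18]]; [:: [:: 5; 4; 18; 7; 20; 16; 10; 2; 23; 6; 14; 19; 17]; [:: 24; 3; 22; 0; 15]; [:: 25; 21;
  12; 13; 9]; [:: 1; 11; 8]]; [:: [:: 4; 9; 20; 16; 17; 11; 19; 14; 1; 13; 23; 2; 18]; [:: 24; 3;
  22; 0; 15]; [:: 25; 21; 12; 7]; [:: 10; 8; 5; 6]]; [:: [:: 19; 22; 9; 10; 16; 7; 11; 4; 6; 17; 3;
  15; 0]; [:: 21; 14; 12; 20]; [:: 24; 2; 18]; [:: 25; 1; 23]; [:: 13; 8; 5]]; [:: [:: 24; 2; 13; 7;
  10; 15; 11; 4; 17; 12; 23; 14]; [:: 25; 20; 8; 16; 18; 22; 3; 1; 0; 21; 6]; [:: 19; 9; 5]]; [::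
  [:: 13; 17; 12; 4; 8; 22; 11; 14; 23; 5; 15; 6]; [:: 24; 2; 18; 1; 0; 9; 7; 19; 21; 20]; [:: 25;
  10; 3; 16]]; [:: [:: 13; 11; 6; 12; 4; 8; 15; 23; 22; 17; 20; 10]; [:: 24; 2; 18; 1; 0; 9; 7; 19;
  21]; [:: 25; 5; 14; 3; 16]]; [:: [:: 11; 21; 10; 5; 20; 15; 23; 14; 16; 8; 22; 3]; [:: 24; 2; 18;
  1; 0; 9; 7; 19]; [:: 25; 6; 12; 13; 4; 17]]; [:: [:: 25; 1; 9; 10; 23; 6; 16; 12; 17; 5; 3; 21];
  [:: 4; 7; 14; 13; 15; 0; 20; 11]; [:: 24; 2; 18]; [:: 19; 22; 8]]; [:: [:: 2; 13; 6; 20; 0; 12;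
  14; 10; 1; 16; 19; 15]; [:: 24; 21; 4; 9; 18; 8; 7]; [:: 25; 17; 22; 23; 5; 3; 11]]; [:: [:: 25;
  1; 9; 10; 23; 6; 16; 12; 17; 20; 22; 21]; [:: 7; 13; 4; 15; 3; 8; 5]; [:: 14; 0; 19; 11]; [:: 24;
  2; 18]]; [:: [:: 25; 1; 9; 10; 23; 6; 16; 12; 17; 3; 0; 21]; [:: 22; 20; 19; 7; 5; 13]; [:: 11;
  14; 8; 15; 4]; [:: 24; 2; 18]]; [:: [:: 25; 0; 5; 9; 22; 7; 8; 19; 1; 4; 6; 13]; [:: 10; 12; 14;
  23; 3; 15]; [:: 24; 2; 18; 17]; [:: 21; 11; 20; 16]]; [:: [:: 19; 23; 6; 7; 18; 20; 8; 16; 2; 10;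
  5; 14]; [:: 24; 3; 22; 0; 15]; [:: 25; 21; 12; 13; 9]; [:: 1; 11; 17; 4]]; [:: [:: 19; 22; 9; 10;
  16; 12; 17; 6; 4; 11; 20; 21]; [:: 14; 0; 15; 3; 7]; [:: 24; 2; 18]; [:: 25; 1; 23]; [:: 13; 8;
  5]]; [:: [:: 22; 7; 10; 12; 20; 3; 14; 16; 21; 1; 9; 19]; [:: 24; 2; 18; 17]; [:: 11; 23; 5; 4];
  [:: 25; 0; 13]; [:: 15; 8; 6]]; [:: [:: 24; 2; 18; 1; 0; 9; 7; 19; 21; 20; 17]; [:: 22; 11; 14; 8;
  4; 13; 6; 16; 3; 23; 15]; [:: 25; 12; 10; 5]]; [:: [:: 15; 5; 23; 4; 8; 17; 6; 14; 11; 13; 22];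
  [:: 24; 2; 18; 1; 0; 9; 7; 19; 21; 20]; [:: 25; 10; 3; 16; 12]]; [:: [:: 18; 23; 12; 14; 6; 8; 7;
  16; 4; 9; 5]; [:: 24; 3; 22; 0; 15; 11; 13; 17; 20]; [:: 25; 21; 10; 1; 19; 2]]; [:: [:: 25; 1; 9;
  10; 23; 6; 16; 12; 17; 20; 21]; [:: 11; 8; 14; 0; 5; 3; 22; 7; 19]; [:: 24; 2; 18]; [:: 15; 13;
  4]]; [:: [:: 10; 5; 15; 22; 11; 14; 16; 20; 23; 3; 17]; [:: 24; 2; 18; 1; 0; 9; 7; 19]; [:: 25; 6;
  12; 13; 4; 8; 21]]; [:: [:: 25; 1; 9; 10; 23; 6; 16; 12; 17; 11; 19]; [:: 22; 21; 0; 14; 7; 4; 15;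
  13]; [:: 3; 8; 20; 5]; [:: 24; 2; 18]]; [:: [:: 25; 1; 9; 10; 23; 6; 16; 12; 17; 3; 21]; [:: 13;
  14; 7; 5; 0; 15; 4]; [:: 11; 8; 20; 22; 19]; [:: 24; 2; 18]]; [:: [:: 25; 0; 5; 9; 22; 7; 8; 19;
  1; 11; 21]; [:: 6; 3; 23; 14; 16; 4; 13]; [:: 24; 2; 18; 17]; [:: 10; 12; 20; 15]]; [:: [:: 25; 1;
  9; 10; 23; 6; 16; 12; 17; 3; 21]; [:: 11; 14; 13; 4; 15; 8]; [:: 22; 20; 0; 5; 7; 19]; [:: 24; 2;
  18]]; [:: [:: 12; 23; 16; 10; 8; 7; 11; 20; 6; 14; 1]; [:: 24; 3; 22; 0; 15; 18]; [:: 25; 21; 13;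
  9; 4]; [:: 2; 19; 17; 5]]; [:: [:: 19; 22; 9; 10; 16; 21; 17; 15; 4; 6; 20]; [:: 12; 3; 11; 14; 7;
  0]; [:: 24; 2; 18]; [:: 25; 1; 23]; [:: 13; 8; 5]]; [:: [:: 19; 10; 7; 2; 14; 18; 20; 6; 23; 16;
  8]; [:: 24; 3; 22; 0; 15]; [:: 25; 21; 12; 13; 9]; [:: 1; 11; 17; 4; 5]]; [:: [:: 22; 7; 10; 12;
  19; 1; 9; 21; 11; 4; 5]; [:: 14; 3; 23; 20; 16]; [:: 24; 2; 18; 17]; [:: 25; 0; 13]; [:: 15; 8;
  6]]; [:: [:: 21; 16; 7; 11; 9; 10; 22; 13; 6; 20; 3]; [:: 24; 2; 18; 17]; [:: 25; 0; 5; 15]; [::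
  1; 4; 12; 14]; [:: 19; 23; 8]]; [:: [:: 19; 22; 9; 10; 12; 0; 21; 6; 4; 11; 17]; [:: 24; 2; 18];
  [:: 25; 1; 23]; [:: 13; 8; 5]; [:: 20; 15; 16]; [:: 14; 7; 3]]; [:: [:: 24; 2; 18; 1; 0; 9; 7; 19;
  21; 20]; [:: 16; 12; 11; 13; 5; 23; 8; 4; 15; 6]; [:: 25; 10; 3; 22; 17; 14]]; [:: [:: 25; 1; 9;
  10; 23; 6; 16; 12; 17; 15]; [:: 14; 0; 21; 3; 22; 13; 5; 7; 4; 11]; [:: 24; 2; 18]; [:: 20; 8;
  19]]; [:: [:: 12; 4; 8; 23; 20; 10; 17; 13; 11; 6]; [:: 24; 2; 18; 1; 0; 9; 7; 19; 21]; [:: 25; 5;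
  14; 3; 16; 15; 22]]; [:: [:: 8; 1; 4; 12; 23; 5; 18; 16; 7; 9]; [:: 24; 3; 22; 0; 15; 11; 13; 17;
  20]; [:: 25; 21; 10; 6]; [:: 14; 19; 2]]; [:: [:: 15; 22; 8; 21; 10; 17; 14; 16; 20; 5]; [:: 24;
  2; 18; 1; 0; 9; 7; 19]; [:: 25; 6; 12; 13; 4; 11; 3; 23]]; [:: [:: 25; 1; 9; 10; 23; 6; 16; 12;
  17; 15]; [:: 0; 7; 14; 3; 5; 8; 20; 21]; [:: 22; 13; 11; 19; 4]; [:: 24; 2; 18]]; [:: [:: 25; 0;
  5; 9; 22; 7; 8; 19; 12; 21]; [:: 3; 1; 10; 16; 20; 11; 13; 15]; [:: 24; 2; 18; 17]; [:: 4; 23; 6;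
  14]]; [:: [:: 25; 1; 9; 10; 23; 6; 16; 12; 17; 19]; [:: 14; 15; 4; 11; 13; 22; 7]; [:: 21; 0; 20;
  8; 5; 3]; [:: 24; 2; 18]]; [:: [:: 25; 0; 5; 9; 22; 7; 8; 19; 12; 15]; [:: 3; 20; 6; 14; 16; 10;
  1]; [:: 21; 13; 4; 23; 11]; [:: 24; 2; 18; 17]]; [:: [:: 19; 22; 9; 10; 16; 15; 20; 12; 0; 21];
  [:: 4; 11; 14; 7; 3; 17; 6]; [:: 24; 2; 18]; [:: 25; 1; 23]; [:: 13; 8; 5]]; [:: [:: 25; 2; 11;
  17; 18; 15; 20; 4; 0; 19]; [:: 3; 14; 9; 22; 1; 13]; [:: 16; 8; 7; 5; 10; 12]; [:: 24; 6; 21;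
  23]]; [:: [:: 12; 1; 14; 6; 20; 8; 5; 7; 16; 23]; [:: 24; 3; 22; 0; 15; 18]; [:: 25; 21; 13; 9;
  4]; [:: 2; 19; 17; 11; 10]]; [:: [:: 22; 7; 10; 12; 16; 5; 9; 4; 3; 20]; [:: 11; 21; 1; 19; 14;
  23]; [:: 24; 2; 18; 17]; [:: 25; 0; 13]; [:: 15; 8; 6]]; [:: [:: 18; 10; 2; 20; 6; 23; 19; 14; 16;
  7]; [:: 24; 3; 22; 0; 15]; [:: 25; 21; 12; 13; 9]; [:: 1; 11; 8]; [:: 5; 4; 17]]; [:: [:: 24; 9;
  15; 19; 5; 2; 17; 0; 7; 18]; [:: 14; 12; 8; 10; 6]; [:: 25; 22; 13; 1]; [:: 4; 23; 16; 3]; [:: 11;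
  21; 20]]; [:: [:: 9; 14; 16; 13; 20; 11; 12; 10; 21; 1]; [:: 24; 2; 18; 17]; [:: 25; 0; 5; 15];
  [:: 19; 23; 8; 7]; [:: 4; 6; 3; 22]]; [:: [:: 24; 9; 15; 19; 5; 2; 17; 0; 7; 18]; [:: 10; 22; 3;
  11]; [:: 25; 14; 1]; [:: 13; 4; 20]; [:: 12; 23; 21]; [:: 16; 8; 6]]; [:: [:: 24; 2; 18; 1; 0; 9;
  7; 19; 21]; [:: 6; 11; 13; 22; 15; 23; 8; 4; 12]; [:: 25; 5; 14; 3; 16; 17; 10; 20]]; [:: [:: 25;
  1; 9; 10; 23; 6; 16; 12; 17]; [:: 11; 20; 0; 5; 7; 14; 13; 22; 8]; [:: 19; 21; 3; 15; 4]; [:: 24;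
  2; 18]]; [:: [:: 25; 0; 5; 9; 22; 7; 8; 19; 15]; [:: 20; 11; 1; 13; 23; 4; 14; 6; 3]; [:: 24; 2;
  18; 17]; [:: 10; 12; 21; 16]]; [:: [:: 25; 1; 9; 10; 23; 6; 16; 12; 17]; [:: 13; 22; 4; 15; 7; 5;
  14; 11]; [:: 19; 21; 20; 8; 3; 0]; [:: 24; 2; 18]]; [:: [:: 25; 0; 5; 9; 22; 7; 8; 19; 15]; [::
  23; 3; 6; 12; 10; 20; 1; 11]; [:: 21; 14; 16; 13; 4]; [:: 24; 2; 18; 17]]; [:: [:: 19; 22; 9; 10;
  16; 20; 21; 7; 14]; [:: 3; 11; 4; 6; 17; 15; 0; 12]; [:: 24; 2; 18]; [:: 25; 1; 23]; [:: 13; 8;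
  5]]; [:: [:: 25; 1; 9; 10; 23; 6; 16; 12; 17]; [:: 19; 21; 7; 13; 22; 11; 4]; [:: 3; 0; 20; 8; 15;
  14; 5]; [:: 24; 2; 18]]; [:: [:: 25; 0; 5; 9; 22; 7; 8; 19; 15]; [:: 23; 20; 10; 1; 11; 13; 6];
  [:: 12; 3; 21; 14; 16; 4]; [:: 24; 2; 18; 17]]; [:: [:: 25; 19; 4; 6; 5; 12; 0; 23; 9]; [:: 10;
  20; 13; 16; 14; 15; 7]; [:: 24; 2; 18; 1; 22]; [:: 11; 3; 8; 21; 17]]; [:: [:: 22; 7; 10; 12; 20;
  3; 4; 11; 19]; [:: 5; 16; 14; 21; 9; 1; 23]; [:: 24; 2; 18; 17]; [:: 25; 0; 13]; [:: 15; 8; 6]];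
  [:: [:: 25; 19; 4; 6; 5; 12; 0; 23; 9]; [:: 11; 8; 21; 20; 15; 7]; [:: 16; 10; 3; 13; 17; 14]; [::
  24; 2; 18; 1; 22]]; [:: [:: 8; 22; 19; 21; 13; 7; 5; 16; 15]; [:: 12; 0; 1; 4; 14; 11]; [:: 25; 6;
  10; 3; 20]; [:: 24; 17; 9]; [:: 23; 18; 2]]; [:: [:: 21; 16; 7; 14; 9; 11; 12; 4; 3]; [:: 6; 10;
  1; 13; 22; 20]; [:: 24; 2; 18; 17]; [:: 25; 0; 5; 15]; [:: 19; 23; 8]]; [:: [:: 20; 18; 23; 6; 14;
  5; 10; 2; 16]; [:: 24; 3; 22; 0; 15]; [:: 25; 21; 12; 13; 9]; [:: 1; 11; 17; 4]; [:: 19; 7; 8]];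
  [:: [:: 9; 14; 6; 4; 1; 22; 20; 13; 16]; [:: 21; 10; 12; 11; 3]; [:: 24; 2; 18; 17]; [:: 25; 0; 5;
  15]; [:: 19; 23; 8; 7]]; [:: [:: 19; 22; 9; 10; 12; 20; 15; 0; 21]; [:: 16; 17; 11; 6; 4]; [:: 24;
  2; 18]; [:: 25; 1; 23]; [:: 13; 8; 5]; [:: 7; 14; 3]]; [:: [:: 22; 7; 10; 11; 4; 14; 3; 20; 12];
  [:: 24; 2; 18; 17]; [:: 19; 16; 23; 5]; [:: 25; 0; 13]; [:: 15; 8; 6]; [:: 21; 9; 1]]; [:: [:: 24;
  3; 22; 0; 15; 11; 13; 17]; [:: 23; 10; 18; 9; 7; 6; 12; 14]; [:: 25; 20; 19; 8; 1; 5; 2]; [:: 21;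
  16; 4]]; [:: [:: 25; 0; 5; 9; 22; 7; 8; 19]; [:: 14; 6; 16; 10; 12; 15; 13; 21]; [:: 3; 1; 4; 23;
  11; 20]; [:: 24; 2; 18; 17]]; [:: [:: 25; 19; 4; 6; 5; 12; 0; 7]; [:: 23; 10; 20; 9; 15; 13; 21;
  14]; [:: 24; 2; 18; 1; 22]; [:: 3; 17; 16; 8; 11]]; [:: [:: 22; 7; 10; 12; 16; 14; 19; 11]; [:: 3;
  20; 23; 1; 5; 4; 9; 21]; [:: 24; 2; 18; 17]; [:: 25; 0; 13]; [:: 15; 8; 6]]; [:: [:: 25; 0; 5; 9;
  22; 7; 8; 19]; [:: 3; 1; 4; 12; 16; 10; 15]; [:: 21; 14; 23; 13; 6; 20; 11]; [:: 24; 2; 18; 17]];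
  [:: [:: 25; 19; 4; 6; 5; 12; 0; 7]; [:: 8; 11; 3; 14; 13; 21; 16]; [:: 10; 20; 17; 15; 9; 23]; [::
  24; 2; 18; 1; 22]]; [:: [:: 5; 23; 8; 21; 2; 18; 16; 7]; [:: 12; 0; 1; 4; 14; 15; 19]; [:: 25; 6;
  10; 3; 20]; [:: 24; 17; 9]; [:: 22; 11; 13]]; [:: [:: 21; 16; 7; 20; 1; 13; 22; 4]; [:: 6; 3; 11;
  9; 10; 12; 14]; [:: 24; 2; 18; 17]; [:: 25; 0; 5; 15]; [:: 19; 23; 8]]; [:: [:: 25; 19; 9; 6; 10;
  13; 4; 11]; [:: 24; 2; 18; 1; 0; 12]; [:: 14; 22; 23; 21; 3; 17]; [:: 7; 5; 16; 8; 15; 20]]; [::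
  [:: 11; 8; 3; 5; 14; 7; 15; 13]; [:: 24; 2; 18; 1; 0; 12]; [:: 4; 17; 20; 16; 23; 22]; [:: 25; 19;
  9]; [:: 21; 6; 10]]; [:: [:: 24; 9; 15; 19; 5; 2; 17; 12]; [:: 16; 11; 6; 10; 14; 7]; [:: 25; 4;
  3; 1; 21]; [:: 13; 22; 23; 0]; [:: 18; 8; 20]]; [:: [:: 9; 14; 16; 13; 20; 11; 3; 22]; [:: 6; 4;
  1; 21; 10; 12]; [:: 24; 2; 18; 17]; [:: 25; 0; 5; 15]; [:: 19; 23; 8; 7]]; [:: [:: 19; 22; 9; 10;
  12; 0; 15; 20]; [:: 21; 17; 6; 4; 11; 3]; [:: 24; 2; 18]; [:: 25; 1; 23]; [:: 13; 8; 5]; [:: 7;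
  16; 14]]; [:: [:: 20; 9; 21; 16; 17; 14; 12; 10]; [:: 24; 2; 18; 1; 22]; [:: 25; 19; 4; 6; 5]; [::
  3; 11; 8; 15; 23]; [:: 7; 13; 0]]; [:: [:: 14; 18; 10; 2; 19; 5; 23; 16]; [:: 24; 3; 22; 0; 15];
  [:: 25; 21; 12; 13; 9]; [:: 1; 11; 20; 8]; [:: 7; 6; 17; 4]]; [:: [:: 22; 7; 10; 12; 20; 9; 4; 5];
  [:: 23; 1; 21; 3; 11]; [:: 24; 2; 18; 17]; [:: 25; 0; 13]; [:: 15; 8; 6]; [:: 19; 14; 16]]; [::
  [:: 21; 16; 10; 9; 14; 6; 4; 7]; [:: 24; 2; 18; 17]; [:: 25; 0; 5; 15]; [:: 22; 13; 1; 20]; [::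
  19; 23; 8]; [:: 11; 3; 12]]; [:: [:: 2; 19; 5; 16; 17; 20; 12; 4]; [:: 24; 3; 22]; [:: 25; 0; 15];
  [:: 18; 9; 13]; [:: 10; 6; 7]; [:: 11; 23; 21]; [:: 8; 1; 14]]; [:: [:: 25; 22; 6; 1; 0; 19; 8];
  [:: 5; 18; 20; 23; 12; 16; 2]; [:: 21; 3; 15; 10; 13; 4; 14]; [:: 24; 17; 9; 7; 11]]; [:: [:: 25;
  14; 10; 16; 15; 23; 11]; [:: 17; 2; 22; 13; 20; 6; 19]; [:: 24; 21; 4; 9; 18; 8]; [:: 3; 7; 5; 12;
  1; 0]]; [:: [:: 11; 8; 3; 5; 23; 4; 13]; [:: 16; 17; 20; 7; 15; 22; 14]; [:: 24; 2; 18; 1; 0; 12];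
  [:: 25; 19; 9]; [:: 21; 6; 10]]; [:: [:: 25; 21; 12; 13; 9; 4; 7]; [:: 14; 16; 20; 2; 19; 5; 1];
  [:: 24; 3; 22; 0; 15]; [:: 18; 10; 11; 23]; [:: 8; 6; 17]]; [:: [:: 9; 14; 1; 21; 12; 10; 16]; [::
  11; 3; 6; 4; 13; 20; 22]; [:: 24; 2; 18; 17]; [:: 25; 0; 5; 15]; [:: 19; 23; 8; 7]]; [:: [:: 19;
  22; 9; 10; 21; 20; 12]; [:: 15; 6; 4; 16; 14; 7; 0]; [:: 24; 2; 18]; [:: 25; 1; 23]; [:: 13; 8;
  5]; [:: 17; 11; 3]]; [:: [:: 24; 9; 15; 19; 5; 2; 17]; [:: 25; 18; 8; 4; 16; 0]; [:: 14; 7; 20;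
  11; 10; 21]; [:: 3; 23; 6; 1]; [:: 12; 13; 22]]; [:: [:: 20; 9; 21; 17; 14; 12; 10]; [:: 11; 3;
  23; 16; 15; 8]; [:: 24; 2; 18; 1; 22]; [:: 25; 19; 4; 6; 5]; [:: 7; 13; 0]]; [:: [:: 24; 9; 15;
  19; 5; 2; 17]; [:: 21; 1; 14; 13; 20; 23]; [:: 25; 18; 8; 4; 6]; [:: 7; 12; 0; 16]; [:: 11; 22; 3;
  10]]; [:: [:: 22; 7; 10; 12; 20; 9; 5]; [:: 11; 23; 1; 21; 3; 4]; [:: 24; 2; 18; 17]; [:: 25; 0;
  13]; [:: 15; 8; 6]; [:: 19; 16; 14]]; [:: [:: 14; 16; 23; 15; 8; 3; 0]; [:: 24; 2; 18; 1; 22]; [::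
  25; 19; 4; 6; 5]; [:: 21; 9; 17; 20; 10]; [:: 7; 13; 12; 11]]; [:: [:: 6; 4; 8; 13; 20; 17; 9];
  [:: 24; 3; 22; 0; 15]; [:: 1; 12; 14; 18; 19]; [:: 25; 21; 5]; [:: 11; 10; 23]; [:: 2; 7; 16]];
  [:: [:: 21; 16; 14; 1; 13; 22; 3]; [:: 11; 9; 10; 6; 20]; [:: 24; 2; 18; 17]; [:: 25; 0; 5; 15];
  [:: 19; 23; 8]; [:: 12; 4; 7]]; [:: [:: 21; 16; 10; 11; 1; 14; 9]; [:: 24; 2; 18; 17]; [:: 25; 0;
  5; 15]; [:: 7; 3; 12; 4]; [:: 20; 6; 13; 22]; [:: 19; 23; 8]]; [:: [:: 5; 10; 20; 21; 17; 14; 1];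
  [:: 18; 9; 13; 23]; [:: 24; 3; 22]; [:: 25; 0; 15]; [:: 7; 6; 12]; [:: 19; 8; 11]; [:: 4; 2; 16]];
  [:: [:: 24; 9; 15; 19; 5; 14]; [:: 25; 13; 22; 17; 4; 0]; [:: 6; 11; 1; 20; 8; 16]; [:: 7; 12; 23;
  21; 10]; [:: 3; 18; 2]]; [:: [:: 24; 9; 15; 19; 5; 14]; [:: 25; 13; 22; 17; 4; 0]; [:: 11; 10; 21;
  1; 16; 18]; [:: 7; 2; 12; 23]; [:: 3; 6; 8; 20]]; [:: [:: 21; 11; 23; 15; 17; 14]; [:: 20; 0; 8;
  3; 16; 9]; [:: 24; 2; 18; 1; 22]; [:: 25; 19; 4; 6; 5]; [:: 7; 13; 12; 10]]; [:: [:: 1; 12; 14;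
  18; 13; 4]; [:: 19; 16; 2; 7; 8; 20]; [:: 24; 3; 22; 0; 15]; [:: 25; 21; 5]; [:: 9; 17; 11]; [::
  10; 23; 6]]; [:: [:: 21; 16; 14; 6; 7; 9]; [:: 11; 12; 10; 1; 20; 3]; [:: 24; 2; 18; 17]; [:: 25;
  0; 5; 15]; [:: 19; 23; 8]; [:: 22; 4; 13]]; [:: [:: 7; 20; 6; 5; 10; 18]; [:: 24; 3; 22; 0; 15];
  [:: 25; 21; 12; 13; 9]; [:: 1; 11; 17; 8; 4]; [:: 2; 19; 23; 16; 14]]; [:: [:: 16; 17; 1; 19; 14;
  18]; [:: 24; 3; 22; 0; 15]; [:: 10; 8; 20; 9; 23]; [:: 25; 21; 12; 7]; [:: 11; 6; 2]; [:: 4; 5;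
  13]]; [:: [:: 21; 16; 9; 1; 3; 4]; [:: 14; 6; 20; 11; 12]; [:: 24; 2; 18; 17]; [:: 25; 0; 5; 15];
  [:: 13; 22; 10; 7]; [:: 19; 23; 8]]; [:: [:: 16; 11; 21; 20; 6; 8]; [:: 18; 9; 13; 23; 14]; [::
  24; 3; 22]; [:: 25; 0; 15]; [:: 1; 12; 19]; [:: 10; 2; 7]; [:: 4; 5; 17]]; [:: [:: 9; 22; 11; 20;
  13; 16]; [:: 24; 2; 18; 17]; [:: 25; 0; 5; 15]; [:: 19; 23; 8; 7]; [:: 12; 10; 6; 14]; [:: 4; 21;
  3; 1]]; [:: [:: 17; 21; 20; 22; 13; 9]; [:: 2; 7; 5; 12]; [:: 1; 18; 6; 15]; [:: 24; 8; 19]; [::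
  25; 11; 14]; [:: 3; 4; 0]; [:: 16; 10; 23]]; [:: [:: 24; 3; 22; 0; 15]; [:: 25; 21; 12; 13; 9];
  [:: 1; 11; 17; 19; 14]; [:: 2; 23; 6; 5; 10]; [:: 16; 20; 8]; [:: 18; 4; 7]]; [:: [:: 24; 3; 22;
  0; 15]; [:: 10; 8; 5; 6; 19]; [:: 16; 20; 2; 13; 14]; [:: 25; 21; 12; 7]; [:: 23; 18; 4; 11]; [::
  17; 1; 9]]; [:: [:: 9; 14; 21; 3; 16]; [:: 4; 12; 1; 10; 6]; [:: 24; 2; 18; 17]; [:: 25; 0; 5;
  15]; [:: 19; 23; 8; 7]; [:: 11; 20; 22; 13]]; [:: [:: 17; 20; 21; 7; 9]; [:: 22; 18; 2; 12; 5];
  [:: 13; 1; 6; 15]; [:: 24; 8; 19]; [:: 25; 11; 14]; [:: 3; 4; 0]; [:: 16; 10; 23]]; [:: [:: 22; 2;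
  9; 7; 17]; [:: 16; 10; 23; 13]; [:: 12; 20; 21; 5]; [:: 15; 6; 18; 1]; [:: 24; 8; 19]; [:: 25; 11;
  14]; [:: 3; 4; 0]]; [:: [:: 5; 7; 20; 17; 21]; [:: 24; 8; 19]; [:: 25; 11; 14]; [:: 3; 4; 0]; [::
  16; 10; 15]; [:: 9; 23; 18]; [:: 6; 13; 1]; [:: 12; 22; 2]]; [:: [:: 24; 9; 15; 19]; [:: 25; 4;
  21; 18]; [:: 23; 0; 3; 16]; [:: 5; 7; 6; 10]; [:: 1; 20; 8; 17]; [:: 13; 14; 11]; [:: 22; 2; 12]];
  [:: [:: 12; 23; 10; 8]; [:: 9; 0; 14; 2]; [:: 24; 5; 16]; [:: 25; 4; 19]; [:: 17; 13; 22]; [:: 18;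
  20; 1]; [:: 7; 6; 15]; [:: 3; 21; 11]]].

Lemma starters_ok : all starter_ok starters.
Proof. by vm_cast_no_check (erefl true). Qed.

(** The parts are generated in nonincreasing order, the largest being at most [m]; [minn n m - 2] is
    the number of candidates from 3 upwards. *)
Fixpoint partitions (fuel n m : nat) : seq (seq nat) :=
  if fuel is fuel'.+1 then
    if n == 0 then [:: [::]]
    else flatten [seq [seq x :: r | r <- partitions fuel' (n - x) x] | x <- iota 3 (minn n m - 2)]
  else [::].

Lemma mem_partitions fuel n m L :
    n < fuel -> all (leq 3) L -> sorted geq L -> head m L <= m -> sumn L = n ->
  L \in partitions fuel n m.
Proof.
elim: fuel n m L => [//|fuel IHf] n m [|x L] nf /= L3 sL hm sumL.
  by rewrite -sumL eqxx inE.
case/andP: L3 => x3 L3.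
have -> : (n == 0) = false by lia.
apply/flattenP; exists [seq x :: r | r <- partitions fuel (n - x) x].
  apply/mapP; exists x => //; rewrite mem_iota; lia.
apply: map_f; apply: IHf => //; [lia | exact: path_sorted sL | | lia].
by case: (L) sL => //= y L' /andP[].
Qed.

Lemma partitions_covered :
  all (fun L => L \in [seq shape s | s <- starters]) (partitions 27 26 26).
Proof. by vm_cast_no_check (erefl true). Qed.

Lemma exists_starter L : all (leq 3) L -> sumn L = 26 ->
  exists2 s, starter_ok s & perm_eq L (shape s).
Proof.
move=> L3 sumL; pose L' := sort geq L.
have pL : perm_eq L' L by rewrite perm_sort.
have sum' : sumn L' = 26 by rewrite (perm_sumn pL).
have : L' \in partitions 27 26 26.
  apply: mem_partitions => //; first by rewrite (perm_all _ pL).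
    by apply: sort_sorted => x y; apply: leq_total.
  by case: (L') sum' => //= x s <-; apply: leq_addr.
move/(allP partitions_covered)/mapP=> [s sP eL]; exists s; first exact: (allP starters_ok).
by rewrite -eL perm_sym.
Qed.

Lemma spin_lt j x : x < 26 -> spin j x < 26.
Proof. by rewrite /spin => x26; case: ifP => _; [|case: ifP => _ //]; lia. Qed.

Lemma spinD i j x : spin i (spin j x) = spin (i + j) x.
Proof.
rewrite /spin; have [x12|x12] := ltnP x 12.
  by rewrite ltn_mod /= modnDml -addnA (addnC j).
have [x24|x24] := ltnP x 24; last by rewrite ltnNge x12 ltnNge x24.
rewrite ltnNge leq_addr /= -[24]/(12 + 12) ltn_add2l ltn_mod /=.
by lia.
Qed.

Lemma spin_period i x : x < 26 -> spin (12 * i) x = x.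
Proof.
rewrite /spin => x26; have [x12|x12] := ltnP x 12.
  lia.
have [x24|//] := ltnP x 24; lia.
Qed.

Lemma mate26_spin j x : x < 26 -> mate26 (spin j x) = spin j (mate26 x).
Proof.
move=> x26; rewrite /mate26; have [x24|x24] := ltnP x 24.
  have -> : spin j x < 24 by rewrite /spin x24; case: ifP => _; lia.
  by rewrite !spinD addnC.
have -> : spin j x = x by rewrite /spin ltnNge (leq_trans _ x24) // ltnNge x24.
by rewrite ltnNge x24 /=; case: ifP => _.
Qed.

Lemma mate26P x : x < 26 -> [&& mate26 x < 26, mate26 (mate26 x) == x & mate26 x != x].
Proof.
move=> x26.
have : all (fun x => [&& mate26 x < 26, mate26 (mate26 x) == x & mate26 x != x]) (iota 0 26).
  by [].
by move/allP; apply; rewrite mem_iota.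
Qed.

Lemma OP_order26 (V : finType) (F : sgraph V) cs :
    regular 2 F -> #|V| = 26 -> perm_eq (flatten cs) (enum V) ->
    all (cycle (adj F)) cs -> all (leq 3) (shape cs) ->
  OP_solvable F.
Proof.
move=> regF cardV pcs ccs cs3.
have sum26 : sumn (shape cs) = 26 by rewrite -size_flatten (perm_size pcs) -cardE.
have [s /andP[ps /allP cov] pL] := exists_starter cs3 sum26.
pose w (j : 'I_12) := map (map (fun x => inord (spin j x) : 'I_26)) s.
have s26 x : x \in flatten s -> x < 26 by rewrite (perm_mem ps) mem_iota.
apply: (@OP_of_cycle_cover V 'I_26 'I_12 F (fun x => inord (mate26 x)) w cs (shape s));
  rewrite ?cardV ?card_ord //.
- move=> x; have [m1 /eqP m2 _] := and3P (mate26P (ltn_ord x)).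
  by apply: val_inj; rewrite /= !inordK ?m2.
- move=> x; have [m1 _ m3] := and3P (mate26P (ltn_ord x)).
  by rewrite -val_eqE /= inordK.
- by move=> j; rewrite /w /shape -map_comp; apply: eq_map => c /=; rewrite size_map.
- move=> j; rewrite /w -map_flatten map_inj_in_uniq; last first.
    move=> x y /s26 x26 /s26 y26 /(congr1 val); rewrite /= !inordK ?spin_lt // => exy.
    have := congr1 (spin (11 * j)) exy; rewrite !spinD -mulSnr.
    by rewrite !spin_period.
  by rewrite (perm_uniq ps) iota_uniq.
move=> x y xy ym.
have [x0 [i [x0P i12 ex]]] : exists x0 i, [/\ x0 \in [:: 0; 12; 24; 25], i < 12 & spin i x0 = x].
  have [x12|x12] := ltnP x 12; first by exists 0, x; rewrite /spin /= add0n modn_small.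
  have [x24|x24] := ltnP x 24.
    by exists 12, (x - 12); rewrite /spin /=; split=> //; lia.
  have : (x == 24 :> nat) || (x == 25 :> nat) by have := ltn_ord x; lia.
  by case/orP=> /eqP ->; [exists 24, 0 | exists 25, 0].
(* Rotation by 11i is rotation by -i; it takes the pair x, y to one that starts at the
   representative [x0]. *)
pose y0 := spin (11 * i) y.
have y026 : y0 < 26 by apply: spin_lt.
have ey : spin i y0 = y by rewrite /y0 spinD -mulSn spin_period.
have := allP (cov x0 x0P) y0; rewrite mem_iota => /(_ y026) /or3P[/eqP e|/eqP e|].
- by case/eqP: xy; apply: val_inj; rewrite /= -ex e.
- have [m1 _ _] := and3P (mate26P (ltn_ord x)).
  case/eqP: ym; apply: val_inj; rewrite /= inordK // -ex mate26_spin -?e ?ey //.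
  by move: x0P; rewrite !inE; lia.
case/hasP=> j; rewrite mem_iota => j12 c.
(* This is i - j modulo 12: the base factor covers the pair of [x0] and [y0] rotated by j, so its
   rotation by i - j covers x, y. *)
pose j' := (i + 11 * j) %% 12.
have j'12 : j' < 12 by rewrite ltn_mod.
have spin' z : z < 26 -> spin j' (spin j z) = spin i z.
  have ej : j' + j = i %[mod 12] by rewrite modnDml -addnA -mulSnr addnC mulnC modnMDl.
  by move=> z26; rewrite spinD /spin -(modnDmr z (j' + j)) ej modnDmr.
exists (Ordinal j'12); have := covers_map (fun x => inord (spin j' x) : 'I_26) c.
have x026 : x0 < 26 by move: x0P; rewrite !inE; lia.
by rewrite !spin' // ex ey !inord_val.
Qed.

(** * Triangles and one square *)

Definition linear_space (T : finType) (B : {set {set T}}) : Prop :=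
  (forall x y, x != y -> exists b, [/\ b \in B, x \in b & y \in b])
  /\ (forall b b' x y, b \in B -> b' \in B -> x != y ->
        x \in b -> y \in b -> x \in b' -> y \in b' -> b = b').

(* A group divisible design with blocks of size 4 and the groups {x} x 3, x in D. *)
Definition gdd_on (T : finType) (D : {set T}) (B : {set {set (T * 'I_3)}}) : Prop :=
  [/\ forall b, b \in B -> #|b| = 4,
      forall b u, b \in B -> u \in b -> u.1 \in D,
      forall b u v, b \in B -> u \in b -> v \in b -> u.1 = v.1 -> u = v,
      forall u v, u.1 \in D -> v.1 \in D -> u.1 != v.1 ->
        exists b, [/\ b \in B, u \in b & v \in b]
    & forall b b' u v, b \in B -> b' \in B -> u != v ->
        u \in b -> v \in b -> u \in b' -> v \in b' -> b = b'].

Definition gdd3 (n : nat) : Prop := exists B, @gdd_on 'I_n setT B.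

Lemma gdd_transport (T U : finType) (f : T -> U) (D : {set T}) B :
  injective f -> gdd_on D B -> exists B', gdd_on (f @: D) B'.
Proof.
move=> f_inj [B4 BD Bg Bc Bu].
pose F (u : T * 'I_3) := (f u.1, u.2).
have F_inj : injective F by move=> [x i] [y j] [/f_inj-> ->].
exists [set F @: (b : {set _}) | b in B]; split.
- by move=> _ /imsetP[b bB ->]; rewrite card_imset // B4.
- by move=> _ v /imsetP[b bB ->] /imsetP[u ub ->]; rewrite /= imset_f // (BD b).
- move=> _ v v' /imsetP[b bB ->] /imsetP[u ub ->] /imsetP[u' ub' ->] /= /f_inj e.
  by rewrite (Bg b u u').
- move=> [x i] [y j] /= /imsetP[x' x'D ->] /imsetP[y' y'D ->]; rewrite (inj_eq f_inj) => xy.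
  have [b [bB ub vb]] := Bc (x', i) (y', j) x'D y'D xy.
  exists (F @: b); split; first exact: imset_f.
    by apply/imsetP; exists (x', i).
  by apply/imsetP; exists (y', j).
- move=> _ _ u v /imsetP[b bB ->] /imsetP[b' b'B ->] uv.
  case/imsetP=> u1 u1b eu /imsetP[v1 v1b ev].
  rewrite eu ev !mem_imset // => u1b' v1b'.
  have -> : b = b'; last by [].
  by apply: (Bu b b' u1 v1) => //; apply: contraNneq uv => e; rewrite eu ev e.
Qed.

Lemma gdd_on_set (T : finType) (D : {set T}) : gdd3 #|D| -> exists B, gdd_on D B.
Proof.
case=> B gB; have [B' gB'] := gdd_transport (@enum_val_inj _ (mem D)) gB.
exists B'; suff <- : [set enum_val x | x in [set: 'I_#|D|]] = D by [].
apply/setP => x; apply/imsetP/idP => [[i _ ->]|xD]; first exact: enum_valP.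
by exists (enum_rank_in xD x); rewrite ?enum_rankK_in.
Qed.

Lemma gdd3_card (T : finType) B : @gdd_on T setT B -> gdd3 #|T|.
Proof.
move=> gB; have [B' gB'] := gdd_transport (@enum_rank_inj T) gB.
exists B'; suff <- : [set enum_rank x | x in [set: T]] = setT by [].
by apply/setP => i; rewrite inE; apply/imsetP; exists (enum_val i); rewrite ?enum_valK.
Qed.

(** Wilson's fundamental construction with weight 3: each block of the linear space is inflated to a
    design. Two blocks share at most one point, so their designs share at most one group, and no
    pair is covered twice. *)
Lemma gdd_closure (T : finType) (P : {set {set T}}) :
  linear_space P -> (forall b, b \in P -> gdd3 #|b|) -> gdd3 #|T|.
Proof.
move=> [Pc Pu] P3.
have [C CP] : exists C : {set T} -> {set {set (T * 'I_3)}}, forall b, b \in P -> gdd_on b (C b).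
  apply: (@fin_all_exists _ _ (fun b C => b \in P -> gdd_on b C)) => b.
  have [/P3/gdd_on_set[B gB]|_] := boolP (b \in P); first by exists B.
  by exists set0.
apply: (@gdd3_card T (\bigcup_(b in P) C b)); split.
- by move=> c /bigcupP[b /CP[C4 _ _ _ _]]; apply: C4.
- by move=> *; rewrite inE.
- by move=> c u v /bigcupP[b /CP[_ _ Cg _ _]]; apply: Cg.
- move=> u v _ _ uv; have [b [bP ub vb]] := Pc _ _ uv.
  have [_ _ _ Cc _] := CP b bP; have [c [cC uc vc]] := Cc u v ub vb uv.
  by exists c; split=> //; apply/bigcupP; exists b.
- move=> c c' u v /bigcupP[b bP cb] /bigcupP[b' b'P cb'] uv uc vc uc' vc'.
  have [_ Cd Cg _ Cu] := CP b bP; have [_ Cd' _ _ _] := CP b' b'P.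
  have uv1 : u.1 != v.1 by apply: contraNneq uv => e; rewrite (Cg c u v).
  have eb : b = b' by apply: (Pu b b' u.1 v.1); rewrite ?(Cd c) ?(Cd' c').
  by apply: (Cu c c' u v); rewrite // eb.
Qed.

(** * Truncated transversal designs *)

Section TruncatedTD.
Variables (m t : nat).
Hypotheses (m1 : 1 < m) (m6 : coprime m 6) (tm : t <= m).
Local Open Scope ring_scope.

Local Notation td_point := (('I_4 * 'Z_m) + 'I_t)%type.

(** The line with intercept [l.1] and slope [l.2] on four columns Z_m. Its point on the fifth column
    is the slope, kept only for the slopes below t. *)
Definition td_line (l : 'Z_m * 'Z_m) : {set td_point} :=
  [set x : td_point | match x with
           | inl (j, y) => y == l.1 + j%:R * l.2
           | inr i => i%:R == l.2
           end].

Definition td_group (j : 'I_4) : {set td_point} :=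
  [set x : td_point | if x is inl (j', _) then j' == j else false].

Definition td_last : {set td_point} := [set x : td_point | if x is inr _ then true else false].

Definition td_blocks : {set {set td_point}} :=
  [set td_line l | l in setT] :|: [set td_group j | j in setT] :|: [set td_last].

(** Column indices differ by 1, 2 or 3 up to sign, which are units modulo m as m is coprime to 6. *)
Lemma slope_unit (i j : 'I_4) : i != j -> (i%:R - j%:R : 'Z_m) \is a GRing.unit.
Proof.
wlog ij : i j / (j < i)%N => [th|] ineq.
  by case: (ltngtP i j) (ineq) => [lij|lij|/val_inj->]; rewrite ?eqxx // => _;
    [rewrite -opprB unitrN th // eq_sym | rewrite th].
rewrite -natrB; last exact: ltnW.
rewrite unitZpE //; apply: coprime_dvdr m6.
by case: i j ij {ineq} => [[|[|[|[|i]]]] ?] [[|[|[|[|j]]]] ?].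
Qed.

Lemma trunc_inj (i j : 'I_t) : i%:R = j%:R :> 'Z_m -> i = j.
Proof.
move/(congr1 val); rewrite /= !val_Zp_nat // !modn_small; first exact: val_inj.
all: exact: leq_trans (ltn_ord _) tm.
Qed.

Lemma td_linear_space : linear_space td_blocks.
Proof.
have Bl l : td_line l \in td_blocks by rewrite !inE imset_f.
have Bg j : td_group j \in td_blocks by rewrite !inE (imset_f td_group) ?orbT.
have Bt : td_last \in td_blocks by rewrite !inE eqxx orbT.
split.
  have mixed j y (i : 'I_t) : exists b, [/\ b \in td_blocks, inl (j, y) \in b & inr i \in b].
    by exists (td_line (y - j%:R * i%:R, i%:R)); rewrite Bl !inE /= subrK !eqxx.
  move=> [[j y]|i] [[j' y']|i'] ne.
  - have [ejj|nj] := eqVneq j j'.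
      by exists (td_group j); rewrite Bg !inE /= ejj eqxx.
    pose b := (y - y') / (j%:R - j'%:R).
    have eb : b * (j%:R - j'%:R) = y - y' by rewrite divrK ?slope_unit.
    exists (td_line (y - j%:R * b, b)); rewrite Bl !inE /= subrK eqxx; split=> //.
    apply/eqP; rewrite -[LHS](subKr y) -eb; ring.
  - exact: mixed.
  - by have [b []] := mixed j' y' i; exists b.
  - by exists td_last; rewrite Bt !inE.
have lg l j x y : x \in td_line l -> y \in td_line l -> x \in td_group j -> y \in td_group j -> x = y.
  case: x y => [[j1 y1]|i1] [[j2 y2]|i2]; rewrite !inE //= => /eqP-> /eqP-> /eqP-> /eqP->.
  by [].
have lt l x y : x \in td_line l -> y \in td_line l -> x \in td_last -> y \in td_last -> x = y.
  case: x y => [[j1 y1]|i1] [[j2 y2]|i2]; rewrite !inE //= => /eqP<- /eqP.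
  by move/trunc_inj->.
have gt j x : x \in td_group j -> x \in td_last -> False.
  by case: x => [[j1 y1]|i1]; rewrite !inE.
have gg j j' x : x \in td_group j -> x \in td_group j' -> j = j'.
  by case: x => [[j1 y1]|i1]; rewrite !inE // => /eqP<- /eqP.
have ll l l' x y : x != y -> x \in td_line l -> y \in td_line l ->
    x \in td_line l' -> y \in td_line l' -> l = l'.
  have fin1 (a b a' b' : 'Z_m) (j : 'I_4) : b = b' -> a + j%:R * b = a' + j%:R * b' -> (a, b) = (a', b').
    by move=> -> /addIr->.
  case: l l' => [a b] [a' b'].
  case: x y => [[j1 y1]|i1] [[j2 y2]|i2] ne; rewrite !inE /=.
  - move=> /eqP e0 /eqP e2 /eqP; rewrite e0 => e1 /eqP; rewrite e2 => e3.
    have nj : j1 != j2.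
      by apply: contraNneq ne => ej; rewrite e0 e2 ej.
    apply: (fin1 _ _ _ _ j1) => //; apply: (mulrI (slope_unit nj)).
    apply: (addrI (a + j2%:R * b)); rewrite {2}e3.
    rewrite (_ : a + j2%:R * b + (j1%:R - j2%:R) * b = a + j1%:R * b); last by ring.
    by rewrite e1; ring.
  - by move=> /eqP-> /eqP<- /eqP e1 /eqP e2; apply: (fin1 _ _ _ _ j1).
  - by move=> /eqP<- /eqP-> /eqP e1 /eqP e2; apply: (fin1 _ _ _ _ j2).
  - move=> /eqP e1 /eqP e2; case/eqP: ne; congr inr; apply: trunc_inj.
    by rewrite e1 e2.
move=> b b' x y; rewrite !inE => bB b'B xy xb yb xb' yb'; move: bB b'B.
case/orP=> [/orP[]/imsetP[l _ eb]|/eqP eb] /orP[/orP[]/imsetP[l' _ eb']|/eqP eb'];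
  move: xb yb xb' yb'; rewrite eb eb' => xb yb xb' yb'.
- by rewrite (ll l l' x y).
- by case/eqP: xy; apply: (lg l l').
- by case/eqP: xy; apply: (lt l).
- by case/eqP: xy; apply: (lg l' l).
- by rewrite (gg l l' x).
- by case: (gt l x).
- by case/eqP: xy; apply: (lt l').
- by case: (gt l' x).
- by [].
Qed.

Lemma card_td_line l : #|td_line l| = 4 \/ #|td_line l| = 5.
Proof.
pose A : {set td_point} := [set inl (j, l.1 + j%:R * l.2) | j : 'I_4].
pose C : {set td_point} := [set inr i | i in [pred i : 'I_t | i%:R == l.2]].
have -> : td_line l = A :|: C.
  apply/setP => -[[j y]|i]; rewrite !inE.
    apply/eqP/orP => [->|[/imsetP[j' _ [-> ->]]|/imsetP[]]] //.
    by left; apply/imsetP; exists j.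
  apply/eqP/orP => [e|[/imsetP[]|/imsetP[i' + [->]]]] //; last by rewrite inE => /eqP.
  by right; apply/imsetP; exists i; rewrite ?inE ?e.
have A4 : #|A| = 4 by rewrite card_imset ?card_ord // => j j' [].
have AC : A :&: C = set0.
  by apply/setP => x; rewrite !inE; apply/negP => /andP[/imsetP[? _ ->] /imsetP[]].
have C1 : (#|C| <= 1)%N.
  rewrite card_imset; last by move=> i j [].
  by apply/card_le1P => i /eqP ei j; rewrite !inE -ei; apply/eqP/eqP => [/trunc_inj|->].
by rewrite cardsU AC cards0 subn0 A4; case: #|C| C1 => [|[|//]] _; [left|right].
Qed.

(** The blocks of the truncated design have 4 or 5 points (lines), m points (full columns) or t
    points (the truncated column), so [gdd_closure] applies. *)
Lemma gdd3_td : gdd3 4 -> gdd3 5 -> gdd3 m -> gdd3 t -> gdd3 (4 * m + t).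
Proof.
move=> g4 g5 gm gt.
have <- : #|{: td_point}| = (4 * m + t)%N by rewrite card_sum card_prod !card_ord Zp_cast.
apply: (gdd_closure td_linear_space) => b; rewrite !inE => /orP[/orP[]/imsetP[l _ ->]|/eqP->].
- by case: (card_td_line l) => ->.
- suff -> : #|td_group l| = m by [].
  have -> : td_group l = [set inl (l, y) | y : 'Z_m].
    apply/setP => -[[j y]|i]; rewrite !inE; last by apply/esym/negP => /imsetP[].
    apply/eqP/imsetP => [->|[y' _ [-> _]]] //; by exists y.
  by rewrite card_imset ?card_ord ?Zp_cast // => y y' [].
- suff -> : #|td_last| = t by [].
  have -> : td_last = [set inr i | i : 'I_t].
    apply/setP => -[[j y]|i]; rewrite !inE; first by apply/esym/negP => /imsetP[].
    by apply/esym/imsetP; exists i.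
  by rewrite card_imset ?card_ord // => i j [].
Qed.
End TruncatedTD.

Lemma gdd3_1 : gdd3 1.
Proof.
exists set0; split.
- by move=> b; rewrite inE.
- by move=> b u; rewrite inE.
- by move=> b u v; rewrite inE.
- by move=> u v _ _; rewrite !ord1 eqxx.
- by move=> b b' u v; rewrite inE.
Qed.

(* The point (i, k) of 'I_n * 'I_3 is coded by i + n * k. *)
Lemma gdd3_of_seq n (bl : seq (seq nat)) :
    0 < n ->
    (forall b, b \in bl -> [/\ uniq b, size b = 4 & all (gtn (3 * n)) b]) ->
    (forall b x y, b \in bl -> x \in b -> y \in b -> x = y %[mod n] -> x = y) ->
    (forall x y, x < 3 * n -> y < 3 * n -> x != y %[mod n] ->
       exists b, [/\ b \in bl, x \in b & y \in b]) ->
    (forall b b' x y, b \in bl -> b' \in bl -> x != y ->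
       x \in b -> y \in b -> x \in b' -> y \in b' -> b = b') ->
  gdd3 n.
Proof.
case: n => // n _ bl1 bl2 bl3 bl4.
pose code (u : 'I_n.+1 * 'I_3) := u.1 + n.+1 * u.2.
pose dec x : 'I_n.+1 * 'I_3 := (inord (x %% n.+1), inord (x %/ n.+1)).
have code_mod u : code u %% n.+1 = u.1.
  by rewrite /code mulnC addnC modnMDl modn_small.
have code_div u : code u %/ n.+1 = u.2.
  by rewrite /code addnC mulnC divnMDl // divn_small ?addn0.
have codeK : cancel code dec.
  by move=> [i k]; rewrite /dec code_mod code_div /= !inord_val.
have code_lt u : code u < 3 * n.+1.
  by rewrite /code; have := ltn_ord u.1; have := ltn_ord u.2; nia.
have decK x : x < 3 * n.+1 -> code (dec x) = x.
  move=> x3; rewrite /code /dec /= !inordK; last exact: ltn_pmod.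
    by rewrite mulnC addnC -divn_eq.
  by rewrite ltn_divLR.
pose blk (b : seq nat) := [set u | code u \in b].
have blkE b x : b \in bl -> x \in b -> dec x \in blk b.
  by case/bl1=> _ _ /allP b3 xb; rewrite inE decK //; apply: b3.
exists [set x in [seq blk b | b <- bl]]; split.
- move=> c; rewrite inE => /mapP[b bbl ->]; have [ub sb b3] := bl1 b bbl.
  rewrite -sb -(size_map dec); have ud : uniq (map dec b).
    rewrite map_inj_in_uniq // => x y xb yb e.
    by rewrite -(decK x (allP b3 x xb)) e (decK y (allP b3 y yb)).
  rewrite -(card_uniqP ud); apply: eq_card => u; rewrite inE.
  apply/idP/mapP => [ub'|[x xb ->]]; last by rewrite (decK x (allP b3 x xb)).
  by exists (code u); rewrite ?codeK.
- by move=> *; rewrite inE.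
- move=> c u v; rewrite inE => /mapP[b bbl ->]; rewrite !inE => ub vb uv.
  by apply: (can_inj codeK); apply: (bl2 b) => //; rewrite !code_mod uv.
- move=> u v _ _ uv; have [|b [bbl ub vb]] := bl3 _ _ (code_lt u) (code_lt v).
    by rewrite !code_mod.
  by exists (blk b); rewrite !inE map_f.
- move=> c c' u v; rewrite !inE => /mapP[b bbl ->] /mapP[b' b'bl ->] uv.
  rewrite !inE => ub vb ub' vb'; have -> : b = b'; last by [].
  by apply: (bl4 b b' (code u) (code v)) => //; rewrite (can_eq codeK).
Qed.

Definition gdd_check n (bl : seq (seq nat)) : bool :=
  [&& all (fun b : seq nat => [&& uniq b, size b == 4 & all (gtn (3 * n)) b]) bl,
      all (fun b : seq nat => all (fun x : nat => all (fun y : nat =>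
        (x %% n == y %% n) ==> (x == y)) b) b) bl,
      all (fun x : nat => all (fun y : nat => (x %% n == y %% n)
        || has (fun b : seq nat => (x \in b) && (y \in b)) bl) (iota 0 (3 * n))) (iota 0 (3 * n))
    & all (fun b : seq nat => all (fun b' : seq nat => (b == b')
        || all (fun x : nat => all (fun y : nat => [|| x == y, x \notin b' | y \notin b']) b) b) bl) bl].

Lemma gdd_checkP n bl : 0 < n -> gdd_check n bl -> gdd3 n.
Proof.
move=> n0 /and4P[/allP c1 /allP c2 /allP c3 /allP c4]; apply: (@gdd3_of_seq n bl) => //.
- by move=> b /c1 /and3P[? /eqP].
- move=> b x y /c2/allP c xb yb /eqP e; have /implyP/(_ e)/eqP := allP (c x xb) y yb.
  by [].
- move=> x y xn yn xy; have xi : x \in iota 0 (3 * n) by rewrite mem_iota.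
  have := allP (c3 x xi) y; rewrite mem_iota (negbTE xy) => /(_ yn)/hasP[b bbl /andP[xb yb]].
  by exists b.
- move=> b b' x y bbl b'bl xy xb yb xb' yb'.
  have /orP[/eqP//|/allP/(_ x xb)/allP/(_ y yb)] := allP (c4 b bbl) b' b'bl.
  by rewrite (negbTE xy) xb' yb'.
Qed.

(** The blocks (a, a + b, a + 2b, b) over Z_3 form the transversal design with four groups of size
    3. *)
Lemma gdd3_4 : gdd3 4.
Proof.
apply: (@gdd_checkP 4 [seq [:: 4 * a; 1 + 4 * ((a + b) %% 3);
  2 + 4 * ((a + 2 * b) %% 3); 3 + 4 * b] | a <- iota 0 3, b <- iota 0 3]); first by [].
by vm_cast_no_check (erefl true).
Qed.

(* Addition in Z_3^3, whose elements are coded by their ternary digits. *)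
Definition add27 (x y : nat) : nat :=
  (x + y) %% 3 + 3 * ((x %/ 3 + y %/ 3) %% 3) + 9 * ((x %/ 9 + y %/ 9) %% 3).

(** Two base blocks developed over Z_3^3. Their 24 differences avoid the subgroup generated by 9,
    whose cosets, the classes modulo 9, are the groups. *)
Lemma gdd3_9 : gdd3 9.
Proof.
apply: (@gdd_checkP 9 [seq map (add27 t) b | b <- [:: [:: 0; 1; 3; 13]; [:: 0; 19; 14; 8]],
  t <- iota 0 27]); first by [].
by vm_cast_no_check (erefl true).
Qed.

Lemma map_uniq_inj (T U : eqType) (f : T -> U) s :
  uniq (map f s) -> {in s &, injective f}.
Proof.
elim: s => //= z s IHs /andP[zs us] x y; rewrite !inE.
case/orP=> [/eqP->|xs] /orP[/eqP->|ys] // e; last exact: IHs.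
  by case/negP: zs; rewrite e map_f.
by case/negP: zs; rewrite -e map_f.
Qed.

(** * Cyclic difference families *)

Section DifferenceFamily.
Variables (n : nat) (D : seq (seq nat)).
Let v := 3 * n.

Definition df_triples : seq (seq nat * (nat * nat)) :=
  [seq (b, xy) | b <- D, xy <- [seq xy <- [seq (x, y) | x <- b, y <- b] | xy.1 != xy.2]].

Definition df_diff (d : seq nat * (nat * nat)) : nat := (d.2.1 + (v - d.2.2)) %% v.

(** A difference family over Z_3n relative to the subgroup of order 3: the differences are the
    residues that are not multiples of n, each once. The groups are the classes modulo n, in
    accordance with the coding in [gdd3_of_seq]. *)
Definition df_check : bool :=
  let ds := map df_diff df_triples in
  [&& 0 < n, all (fun b => [&& uniq b, size b == 4 & all (gtn v) b]) D, uniq ds,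
      all (fun d => d %% n != 0) ds
    & all (fun d => (d %% n == 0) || (d \in ds)) (iota 0 v)].

Lemma mem_df_triples b x y :
  ((b, (x, y)) \in df_triples) = [&& b \in D, x \in b, y \in b & x != y].
Proof.
apply/allpairsPdep/and4P => [[b' [[x' y']]]|[bD xb yb xy]].
  case=> b'D; rewrite mem_filter /= andbC.
  by case/andP=> /allpairsP[[x1 y1] /= [x1b y1b [-> ->]]] ne [-> -> ->].
exists b, (x, y); split=> //; rewrite mem_filter xy /=.
by apply/allpairsP; exists (x, y).
Qed.

Lemma gdd3_df : df_check -> gdd3 n.
Proof.
case/and5P=> n0 /allP D1 uds /allP nz /allP cov.
have v0 : 0 < v by rewrite muln_gt0.
have lt b x : b \in D -> x \in b -> x < v by move=> /D1/and3P[_ _ /allP lt] /lt.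
have shift_inj b x y t : b \in D -> x \in b -> y \in b -> x + t = y + t %[mod v] -> x = y.
  move=> bD xb yb /eqP; rewrite eqn_modDr !modn_small ?(lt b) //.
  by move/eqP.
have diffE b x y t : b \in D -> y \in b -> df_diff (b, (x, y)) = x + t + (v - (y + t) %% v) %[mod v].
  move=> bD yb; have yv := lt b y bD yb; rewrite /df_diff /= modn_mod.
  have tv := ltn_pmod (y + t) v0; have := divn_eq (y + t) v.
  move: ((y + t) %/ v * v) (modnMDl ((y + t) %/ v) (x + (v - y)) v) => q qE e.
  by rewrite -qE; congr (_ %% _); lia.
have diff2 b b' x y x' y' t t' : b \in D -> b' \in D -> y \in b -> y' \in b' ->
    (x + t) %% v = (x' + t') %% v -> (y + t) %% v = (y' + t') %% v ->
    df_diff (b, (x, y)) = df_diff (b', (x', y')).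
  move=> bD b'D yb yb' ex ey.
  have := diffE b x y t bD yb; have := diffE b' x' y' t' b'D yb'.
  rewrite {1 3}/df_diff !modn_mod -/(df_diff (b, (x, y))) -/(df_diff (b', (x', y'))).
  by move=> -> ->; rewrite -modnDml ex ey modnDml.
apply: (@gdd3_of_seq n [seq [seq (x + t) %% v | x <- b] | b <- D, t <- iota 0 v]) => //.
- move=> _ /allpairsP[[b t] /= [bD _ ->]]; have /and3P[ub /eqP sb _] := D1 b bD.
  split; rewrite ?size_map //; last by apply/allP => _ /mapP[x _ ->] /=; rewrite ltn_mod.
  rewrite map_inj_in_uniq // => x y xb yb; exact: (shift_inj b).
- move=> _ z1 z2 /allpairsP[[b t] /= [bD _ ->]] /mapP[x xb ->] /mapP[y yb ->] e.
  have [->//|xy] := eqVneq x y; have dP : (b, (x, y)) \in df_triples.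
    by rewrite mem_df_triples bD xb yb xy.
  have := nz _ (map_f df_diff dP); case/eqP.
  have vn : n %| v by rewrite dvdn_mull.
  have ent : x = y %[mod n].
    by apply/eqP; rewrite -(eqn_modDr t) -(modn_dvdm (x + t) vn) e modn_dvdm.
  rewrite /df_diff /= modn_dvdm // -modnDml ent modnDml subnKC ?(ltnW (lt b y _ _)) //.
  exact/eqP.
- move=> x y xv yv xy; pose d := (x + (v - y)) %% v.
  have dv : d \in iota 0 v by rewrite mem_iota ltn_mod.
  have vn : n %| v by rewrite dvdn_mull.
  have /orP[d0|] := cov d dv.
    case/negP: xy; move: d0; rewrite /d modn_dvdm // => d0.
    rewrite -(eqn_modDr (v - y)) subnKC ?(ltnW yv) //.
    by rewrite (eqP d0) eq_sym.
  case/mapP=> -[b [x0 y0]]; rewrite mem_df_triples => /and4P[bD x0b y0b _] ed.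
  (* The translation that takes [x0] to [x]; the differences being equal, it also takes [y0] to
     [y]. *)
  pose t := (x + (v - x0)) %% v.
  have x0v := lt b x0 bD x0b; have y0v := lt b y0 bD y0b.
  have ex : (x0 + t) %% v = x.
    by rewrite /t modnDmr addnCA subnKC ?(ltnW x0v) // modnDr modn_small.
  exists [seq (z + t) %% v | z <- b]; split.
  + by apply/allpairsP; exists (b, t); rewrite mem_iota ltn_mod.
  + by rewrite -ex; apply: map_f.
  apply/mapP; exists y0 => //.
  have e1 : x + (v - y) + (y + y0 + (v - x0)) = x0 + (v - y0) + (y + y0 + (v - x0)) %[mod v].
    by rewrite -modnDml -[(x + (v - y)) %% v]/d ed /df_diff /= modnDml.
  move: e1; rewrite (_ : x + _ + _ = y0 + (x + (v - x0)) + v); last by lia.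
  rewrite (_ : x0 + _ + _ = y + v + v); last by lia.
  by rewrite !modnDr (modn_small yv) /t modnDmr.
- move=> _ _ z1 z2 /allpairsP[[b t] /= [bD tv ->]] /allpairsP[[b' t'] /= [b'D t'v ->]] z12.
  case/mapP=> x xb ex /mapP[y yb ey] /mapP[x' xb' ex'] /mapP[y' yb' ey'].
  have xy : x != y by apply: contraNneq z12 => e; rewrite ex ey e.
  have xy' : x' != y' by apply: contraNneq z12 => e; rewrite ex' ey' e.
  have [eb exx _] : (b, (x, y)) = (b', (x', y')).
    apply: (map_uniq_inj uds); rewrite ?mem_df_triples ?bD ?xb ?yb ?b'D ?xb' ?yb' //.
    by apply: (diff2 _ _ _ _ _ _ t t'); rewrite -?ex -?ex' -?ey -?ey'.
  have -> : t = t'; last by rewrite eb.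
  move: tv t'v ex; rewrite !mem_iota /= => tv t'v; rewrite ex' exx => /eqP.
  by rewrite eqn_modDl !modn_small // => /eqP.
Qed.
End DifferenceFamily.

(** Together with 1 and 9, these are the orders below 149 that are 1 modulo 4 and that the
    truncation in [gdd3_mod4] does not reach. *)
Definition difference_families : seq (nat * seq (seq nat)) :=
  [:: (5, [:: [:: 0; 7; 4; 6]]); (13, [:: [:: 0; 19; 4; 36]; [:: 0; 18; 28; 16]; [:: 0; 14; 5; 6]]);
  (17, [:: [:: 0; 25; 44; 13]; [:: 0; 24; 47; 42]; [:: 0; 22; 6; 36]; [:: 0; 11; 10; 8]]); (29, [::
  [:: 0; 43; 34; 45]; [:: 0; 41; 71; 5]; [:: 0; 40; 48; 17]; [:: 0; 38; 6; 28]; [:: 0; 37; 52; 19];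
  [:: 0; 27; 7; 3]; [:: 0; 26; 14; 1]]); (33, [:: [:: 0; 49; 9; 8]; [:: 0; 48; 87; 94]; [:: 0; 47;
  79; 37]; [:: 0; 45; 76; 70]; [:: 0; 44; 26; 28]; [:: 0; 43; 13; 77]; [:: 0; 38; 14; 11]; [:: 0;
  36; 19; 15]]); (37, [:: [:: 0; 55; 25; 38]; [:: 0; 54; 45; 60]; [:: 0; 53; 39; 11]; [:: 0; 52; 50;
  34]; [:: 0; 49; 41; 89]; [:: 0; 47; 1; 91]; [:: 0; 43; 36; 10]; [:: 0; 35; 4; 23]; [:: 0; 32; 29;
  5]]); (41, [:: [:: 0; 61; 111; 107]; [:: 0; 60; 102; 22]; [:: 0; 59; 93; 6]; [:: 0; 58; 76; 2];
  [:: 0; 57; 96; 68]; [:: 0; 54; 17; 3]; [:: 0; 52; 7; 33]; [:: 0; 48; 13; 23]; [:: 0; 44; 24; 29];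
  [:: 0; 40; 31; 32]]); (45, [:: [:: 0; 67; 49; 111]; [:: 0; 66; 57; 47]; [:: 0; 65; 12; 34]; [:: 0;
  64; 93; 58]; [:: 0; 63; 96; 83]; [:: 0; 61; 11; 121]; [:: 0; 59; 36; 32]; [:: 0; 56; 84; 30]; [::
  0; 55; 48; 40]; [:: 0; 46; 5; 3]; [:: 0; 38; 17; 1]]); (49, [:: [:: 0; 73; 20; 61]; [:: 0; 72; 2;
  112]; [:: 0; 71; 48; 4]; [:: 0; 69; 22; 33]; [:: 0; 68; 134; 17]; [:: 0; 65; 27; 84]; [:: 0; 64;
  43; 50]; [:: 0; 62; 56; 101]; [:: 0; 60; 118; 115]; [:: 0; 59; 54; 28]; [:: 0; 52; 34; 42]; [:: 0;
  25; 9; 24]]); (89, [:: [:: 0; 133; 22; 229]; [:: 0; 132; 139; 214]; [:: 0; 131; 9; 161]; [:: 0;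
  130; 113; 66]; [:: 0; 129; 150; 205]; [:: 0; 127; 58; 26]; [:: 0; 126; 92; 142]; [:: 0; 124; 6;
  194]; [:: 0; 123; 14; 239]; [:: 0; 121; 169; 120]; [:: 0; 119; 52; 224]; [:: 0; 114; 2; 87]; [::
  0; 110; 97; 51]; [:: 0; 108; 31; 196]; [:: 0; 107; 210; 24]; [:: 0; 104; 167; 93]; [:: 0; 99; 189;
  8]; [:: 0; 94; 65; 84]; [:: 0; 80; 35; 12]; [:: 0; 72; 54; 39]; [:: 0; 61; 56; 36]; [:: 0; 44; 41;
  4]]); (93, [:: [:: 0; 139; 11; 169]; [:: 0; 138; 98; 100]; [:: 0; 137; 246; 221]; [:: 0; 136; 45;
  86]; [:: 0; 135; 9; 88]; [:: 0; 134; 155; 194]; [:: 0; 133; 182; 248]; [:: 0; 132; 76; 81]; [:: 0;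
  131; 27; 105]; [:: 0; 130; 185; 22]; [:: 0; 129; 216; 12]; [:: 0; 127; 44; 217]; [:: 0; 125; 36;
  244]; [:: 0; 123; 236; 77]; [:: 0; 122; 107; 48]; [:: 0; 118; 214; 17]; [:: 0; 114; 184; 168]; [::
  0; 112; 32; 99]; [:: 0; 103; 1; 69]; [:: 0; 92; 20; 73]; [:: 0; 64; 61; 57]; [:: 0; 52; 42; 24];
  [:: 0; 37; 23; 29]]); (97, [:: [:: 0; 145; 199; 154]; [:: 0; 144; 33; 151]; [:: 0; 143; 202; 90];
  [:: 0; 142; 181; 65]; [:: 0; 141; 27; 217]; [:: 0; 139; 182; 57]; [:: 0; 138; 132; 108]; [:: 0;
  136; 191; 78]; [:: 0; 135; 71; 37]; [:: 0; 134; 48; 28]; [:: 0; 133; 117; 122]; [:: 0; 131; 56;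
  46]; [:: 0; 130; 251; 172]; [:: 0; 129; 67; 36]; [:: 0; 128; 223; 103]; [:: 0; 127; 83; 115]; [::
  0; 126; 2; 186]; [:: 0; 123; 189; 204]; [:: 0; 104; 35; 96]; [:: 0; 99; 50; 73]; [:: 0; 94; 3;
  22]; [:: 0; 88; 18; 47]; [:: 0; 84; 63; 80]; [:: 0; 52; 1; 14]])].

Lemma difference_families_ok : all (fun d => df_check d.1 d.2) difference_families.
Proof. by vm_cast_no_check (erefl true). Qed.

Lemma gdd3_table s : s \in map fst difference_families -> gdd3 s.
Proof. by case/mapP=> -[n D] /(allP difference_families_ok) /gdd3_df g ->. Qed.

(** Strong induction through s = 4m + t with t <= m, where m and t are both 1 modulo 4 and m is
    coprime to 6. *)
Lemma gdd3_mod4 s : s %% 4 = 1 -> gdd3 s.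
Proof.
elim/ltn_ind: s => s IHs s1.
have td m : 1 < m -> coprime m 6 -> m %% 4 = 1 -> 4 * m < s -> s <= 5 * m -> gdd3 s.
  move=> m1 m6 m4 ms sm; have -> : s = 4 * m + (s - 4 * m) by lia.
  apply: gdd3_td => //; [by lia | exact: gdd3_4 | exact: gdd3_table | |]; apply: IHs; lia.
have cop m : m %% 12 \in [:: 1; 5] -> coprime m 6.
  move=> m12; rewrite -(coprime_modl m 6) -(@modn_dvdm 12) //.
  by move: m12; rewrite !inE => /orP[]/eqP->.
have [big|small] := leqP 149 s.
  pose q := (s - 1) %/ 4.
  (* Residues 1 and 5 modulo 12 mean 1 modulo 4 and coprime to 6, and any eight consecutive integers
     contain one. From 149 on, 5 (q - 7) >= 4q + 1 = s, so every m in this window satisfies s <=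
     5m. *)
  have [m [mq m12]] : exists m, (q - 7 <= m <= q) /\ (m %% 12 \in [:: 1; 5]).
    have [r rq r12] : exists2 r, r <= 7 & (q - r) %% 12 \in [:: 1; 5].
      have q7 : 7 <= q by rewrite /q; lia.
      have : q %% 12 < 12 by rewrite ltn_mod.
      case e : (q %% 12) => [|[|[|[|[|[|[|[|[|[|[|[|//]]]]]]]]]]]] _;
        [exists 7|exists 0|exists 1|exists 2|exists 3|exists 0|exists 1|exists 2|exists 3
        |exists 4|exists 5|exists 6] => //; rewrite !inE; lia.
    by exists (q - r); split=> //; lia.
  have m4 : m %% 4 = 1 by move: m12; rewrite !inE; lia.
  by apply: (td m) => //; [rewrite /q in mq; lia | exact: cop | |]; rewrite /q in mq; lia.
have [->|n1] := eqVneq s 1; first exact: gdd3_1.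
have [->|n9] := eqVneq s 9; first exact: gdd3_9.
have [st|sn] := boolP (s \in map fst difference_families); first exact: gdd3_table.
have : has (fun m => (4 * m < s) && (s <= 5 * m)) [:: 5; 13; 17; 25; 29].
  have : all (fun s => [|| s %% 4 != 1, s == 1, s == 9, s \in map fst difference_families
    | has (fun m => (4 * m < s) && (s <= 5 * m)) [:: 5; 13; 17; 25; 29]]) (iota 0 149).
    by vm_cast_no_check (erefl true).
  move/allP/(_ s); rewrite mem_iota => /(_ small).
  by rewrite s1 eqxx (negbTE n1) (negbTE n9) (negbTE sn).
case/hasP=> m mP /andP[ms sm]; apply: (td m) => //.
- by move: mP; rewrite !inE; lia.
- by apply: cop; move: mP; rewrite !inE => /or4P[||| /orP[]] /eqP->.
- by move: mP; rewrite !inE => /or4P[||| /orP[]] /eqP->.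
Qed.

(** * Steiner systems and Kirkman frames *)

Definition steiner4 (T : finType) (B : {set {set T}}) : Prop :=
  linear_space B /\ forall b, b \in B -> #|b| = 4.

(** The point [None] at infinity is added to every group, which turns the groups of size 3 into
    blocks of size 4. *)
Lemma steiner_of_gdd s : gdd3 s ->
  exists B, @steiner4 (option ('I_s * 'I_3)) B.
Proof.
case=> B [B4 _ Bg Bc Bu].
pose lift (b : {set 'I_s * 'I_3}) : {set option ('I_s * 'I_3)} := [set Some u | u in b].
pose grp (i : 'I_s) : {set option ('I_s * 'I_3)} :=
  None |: [set Some (i, k) | k : 'I_3].
have Some_inj : injective (@Some ('I_s * 'I_3)) by move=> u v [].
have inl b u : (Some u \in lift b) = (u \in b) by rewrite mem_imset.
have inl0 b : (None \in lift b) = false by apply/negP => /imsetP[].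
have ing i u : (Some u \in grp i) = (u.1 == i).
  rewrite !inE /=; apply/imsetP/eqP => [[k _ [->]]//|<-]; exists u.2 => //.
  by case: (u).
have ing0 i : None \in grp i by rewrite !inE.
exists ([set lift b | b in B] :|: [set grp i | i : 'I_s]); split; last first.
  move=> c; rewrite inE => /orP[]/imsetP[b bB ->]; first by rewrite card_imset // B4.
  rewrite cardsU1 (_ : None \notin _); last by apply/negP => /imsetP[].
  by rewrite card_imset ?card_ord // => k k' [].
split.
  have lB b : b \in B -> lift b \in [set lift b | b in B] :|: [set grp i | i : 'I_s].
    by move=> bB; rewrite inE imset_f.
  have gB i : grp i \in [set lift b | b in B] :|: [set grp i | i : 'I_s].
    by rewrite inE (imset_f grp) ?orbT.
  move=> [u|] [v|] // ne.
  - have [e|nuv] := eqVneq u.1 v.1.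
      by exists (grp u.1); rewrite gB !ing e eqxx.
    have [b [bB ub vb]] := Bc u v (in_setT _) (in_setT _) nuv.
    by exists (lift b); rewrite lB // !inl.
  - by exists (grp u.1); rewrite gB ing eqxx ing0.
  - by exists (grp v.1); rewrite gB ing eqxx ing0.
move=> c c' x y; rewrite !inE => cB c'B xy.
case/orP: cB => /imsetP[b bB ->]; case/orP: c'B => /imsetP[b' b'B ->].
- case: x y xy => [u|] [v|] // uv; rewrite ?inl0 // !inl => ub vb ub' vb'.
  by rewrite (Bu b b' u v) //; apply: contraNneq uv => ->.
- case: x y xy => [u|] [v|] // uv; rewrite ?inl0 // !inl !ing => ub vb /eqP e1 /eqP e2.
  by case/eqP: uv; congr Some; apply: (Bg b) => //; rewrite e1.
- case: x y xy => [u|] [v|] // uv; rewrite ?inl0 // !inl !ing => /eqP e1 /eqP e2 ub vb.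
  by case/eqP: uv; congr Some; apply: (Bg b') => //; rewrite e1.
- have same u : Some u \in grp b -> Some u \in grp b' -> grp b = grp b'.
    by rewrite !ing => /eqP<- /eqP<-.
  by case: x y xy => [u|] [v|] // _ ? ? ? ?; [apply: (same u)|apply: (same u)|apply: (same v)].
Qed.

(** The Kirkman frame of type 2^4 with groups {i} x bool: the two triangles of [frame k] partition
    the six points outside the group of k. *)
Definition frame (k : nat) : seq (seq (nat * bool)) :=
  nth [::]
  [:: [:: [:: (1, false); (2, false); (3, false)]; [:: (1, true); (2, true); (3, true)]];
      [:: [:: (0, false); (2, false); (3, true)]; [:: (0, true); (2, true); (3, false)]];
      [:: [:: (0, false); (1, true); (3, false)]; [:: (0, true); (1, false); (3, true)]];
      [:: [:: (0, false); (1, false); (2, true)]; [:: (0, true); (1, true); (2, false)]]] k.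

Lemma frame_cover i j (a b : bool) : i < 4 -> j < 4 -> i != j ->
  exists2 k, k < 4 & covers (frame k) (i, a) (j, b).
Proof.
move=> i4 j4 ij.
have : all (fun i => all (fun j => all (fun a => all (fun b => (i == j)
    || has (fun k => covers (frame k) (i, a) (j, b)) (iota 0 4))
  [:: false; true]) [:: false; true]) (iota 0 4)) (iota 0 4).
  by vm_cast_no_check (erefl true).
have in2 (c : bool) : c \in [:: false; true] by case: c.
move/allP/(_ i); rewrite mem_iota => /(_ i4)/allP/(_ j); rewrite mem_iota => /(_ j4).
move/allP/(_ a (in2 a))/allP/(_ b (in2 b)); rewrite (negbTE ij) => /hasP[k].
by rewrite mem_iota; exists k.
Qed.

Lemma frame_points k i (a : bool) : k < 4 -> i < 4 -> i != k -> (i, a) \in flatten (frame k).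
Proof.
by case: k => [|[|[|[|k]]]] //; case: i => [|[|[|[|i]]]] //; case: a.
Qed.

Lemma frame_shape k : k < 4 -> shape (frame k) = [:: 3; 3].
Proof. by case: k => [|[|[|[|k]]]]. Qed.

Section TrianglesAndOneSquare.
Variables (T : finType) (B : {set {set T}}).
Hypothesis steinerB : steiner4 B.

Local Notation point := ((T * bool) + bool)%type.

Definition star (x : T) : seq {set T} := enum [set b in B | x \in b].

Definition block_triangles (x : T) (b : {set T}) : seq (seq point) :=
  [seq [seq inl (nth x (enum b) z.1, z.2) | z <- c] | c <- frame (index x (enum b))].

(** The two diagonals of the square join mates, and its four sides are all the edges from the two
    copies of [x] to the two extra points. *)
Definition square_factor (x : T) : seq (seq point) :=
  [:: inr false; inl (x, false); inr true; inl (x, true)]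
  :: flatten [seq block_triangles x b | b <- star x].

Definition square_mate (z : point) : point :=
  match z with inl (x, i) => inl (x, ~~ i) | inr i => inr (~~ i) end.

Lemma mem_star x b : (b \in star x) = (b \in B) && (x \in b).
Proof. by rewrite mem_enum inE. Qed.

Lemma block_shape x b : b \in star x -> shape (block_triangles x b) = [:: 3; 3].
Proof.
rewrite mem_star => /andP[bB xb]; rewrite -(@frame_shape (index x (enum b))); last first.
  by rewrite -(steinerB.2 b bB) cardE index_mem mem_enum.
by rewrite /block_triangles /shape -map_comp; apply: eq_map => c /=; rewrite size_map.
Qed.

(** The blocks through [x], deprived of [x], partition the other points into triples. *)
Lemma size_star x : 3 * size (star x) = #|T|.-1.
Proof.
have [[Bc Bu] B4] := steinerB.
pose P := [set b :\ x | b in [set b in B | x \in b]].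
have inj : {in [set b in B | x \in b] &, injective (fun b => b :\ x)}.
  move=> b b'; rewrite !inE => /andP[_ xb] /andP[_ xb'] e.
  by rewrite -(setD1K xb) -(setD1K xb') e.
have partP : partition P [set~ x].
  apply/and3P; split.
  - rewrite eqEsubset; apply/andP; split; apply/subsetP => y.
      case/bigcupP=> _ /imsetP[b _ ->]; rewrite !inE => /andP[yx _].
      by [].
    rewrite !inE => yx; have [b [bB yb xb]] := Bc y x yx.
    apply/bigcupP; exists (b :\ x); last by rewrite !inE yx.
    by apply: imset_f; rewrite inE bB.
  - apply/trivIsetP => _ _ /imsetP[b bP ->] /imsetP[b' b'P ->] ne.
    rewrite -setI_eq0; apply/eqP/setP => y; rewrite !inE; apply/negP.
    case/andP=> /andP[yx yb] /andP[_ yb']; case/eqP: ne.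
    move: bP b'P; rewrite !inE => /andP[bB xb] /andP[b'B xb'].
    by rewrite (Bu b b' x y) // eq_sym.
  - apply/imsetP => -[b]; rewrite inE => /andP[bB xb] e.
    by have := B4 b bB; rewrite (cardsD1 x) xb -e cards0.
have := card_partition partP; rewrite cardsC1 => ->.
rewrite (eq_bigr (fun=> 3)) => [|_ /imsetP[b + ->]].
  by rewrite sum_nat_const card_in_imset // -cardE mulnC.
by rewrite inE => /andP[bB xb]; have := B4 b bB; rewrite (cardsD1 x) xb => -[].
Qed.

Lemma shape_square_factor x : shape (square_factor x) = 4 :: nseq (2 * size (star x)) 3.
Proof.
rewrite /= /shape map_flatten -map_comp; congr (_ :: _).
have : all (fun b => shape (block_triangles x b) == [:: 3; 3]) (star x).
  by apply/allP => b /block_shape ->.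
elim: (star x) => // b s IHs /andP[/eqP eb /IHs es].
have -> : 2 * size (b :: s) = (2 * size s).+2 by rewrite /=; lia.
by rewrite map_cons [flatten _]/= -/(shape _) es eb.
Qed.

Lemma mem_square_factor x z : z \in flatten (square_factor x).
Proof.
have [[Bc Bu] B4] := steinerB.
rewrite /= !inE; case: z => [[y i]|i]; last by case: i; rewrite ?eqxx ?orbT.
have [->|yx] := eqVneq y x; first by case: i; rewrite ?eqxx ?orbT.
do 4!(apply/orP; right).
have [b [bB yb xb]] := Bc y x yx.
have bx : b \in star x by rewrite mem_star bB.
apply/flattenP; have ky : index y (enum b) < 4 by rewrite -(B4 b bB) cardE index_mem mem_enum.
have kx : index x (enum b) < 4 by rewrite -(B4 b bB) cardE index_mem mem_enum.
have kxy : index y (enum b) != index x (enum b).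
  apply: contraNneq yx => e; rewrite -(nth_index x (_ : y \in enum b)) ?mem_enum // e.
  by rewrite nth_index ?mem_enum.
have /flattenP[c cf zc] := frame_points i kx ky kxy.
exists [seq inl (nth x (enum b) z.1, z.2) | z <- c].
  by apply/flattenP; exists (block_triangles x b); rewrite map_f.
by apply/mapP; exists (index y (enum b), i); rewrite //= nth_index ?mem_enum.
Qed.

(** The factor meets every point and lists only as many vertices as there are points, so none is
    repeated. *)
Lemma uniq_square_factor x : uniq (flatten (square_factor x)).
Proof.
apply: (@leq_size_uniq _ (enum {: point})); first exact: enum_uniq.
  by move=> z _; apply: mem_square_factor.
rewrite size_flatten shape_square_factor -(cardE {: point}) card_sum card_prod card_bool /= sumn_nseq.
have := size_star x; have : 0 < #|T| by apply/card_gt0P; exists x.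
by rewrite -ltnS; case: #|T| => // n _ /= <-; lia.
Qed.

Lemma square_factor_cover u v : u != v -> v != square_mate u ->
  exists x, covers (square_factor x) u v.
Proof.
have [[Bc Bu] B4] := steinerB.
have mixed x (i j : bool) : covers (square_factor x) (inl (x, i)) (inr j).
  by apply/orP; left; case: i; case: j; rewrite /consec /= !eqxx ?orbT.
case: u v => [[x i]|i] [[y j]|j] uv; rewrite /square_mate => um.
- have xy : x != y.
    apply: contraNneq um => exy; move: uv; rewrite exy; case: (i); case: (j) => //;
    by rewrite ?eqxx.
  have [b [bB xb yb]] := Bc x y xy.
  have kx : index x (enum b) < 4 by rewrite -(B4 b bB) cardE index_mem mem_enum.
  have ky : index y (enum b) < 4 by rewrite -(B4 b bB) cardE index_mem mem_enum.
  have kxy : index x (enum b) != index y (enum b).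
    apply: contraNneq xy => e; rewrite -(nth_index x (_ : x \in enum b)) ?mem_enum // e.
    by rewrite nth_index ?mem_enum.
  have [k k4 c] := frame_cover i j kx ky kxy.
  (* The frame triangles that cover the pair are those missing the k-th group, so they belong to the
     factor of the k-th point of the block. *)
  pose z := nth x (enum b) k; have kb : k < size (enum b) by rewrite -cardE B4.
  have zb : z \in b by rewrite -mem_enum mem_nth.
  have kz : index z (enum b) = k by rewrite index_uniq ?enum_uniq.
  exists z; rewrite /covers /=; apply/orP; right.
  have := covers_map (fun w => inl (nth z (enum b) w.1, w.2) : point) c.
  rewrite /= !nth_index ?mem_enum // => /hasP[d dP dc].
  apply/hasP; exists d => //; apply/flattenP; exists (block_triangles z b).
    by apply: map_f; rewrite mem_star bB.
  by rewrite /block_triangles kz.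
- by exists x.
- by exists y; rewrite covers_sym.
- by case: i j uv um => -[] //.
Qed.

Lemma OP_of_steiner (V : finType) (G : sgraph V) cs a :
    regular 2 G -> #|V| = (2 * #|T|).+2 -> perm_eq (flatten cs) (enum V) ->
    all (cycle (adj G)) cs -> perm_eq (shape cs) (4 :: nseq a 3) ->
  OP_solvable G.
Proof.
move=> regG cardV pcs ccs pL.
have sumL : 4 + 3 * a = (2 * #|T|).+2.
  have := perm_sumn pL; rewrite /= sumn_nseq -size_flatten (perm_size pcs) -cardE cardV => ->.
  by [].
apply: (@OP_of_cycle_cover V point T G square_mate square_factor cs (4 :: nseq a 3)) => //.
- by rewrite card_sum card_prod card_bool cardV; lia.
- by rewrite cardV /= oddM.
- by rewrite cardV addn2.
- by case=> [[x i]|i] /=; rewrite negbK.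
- by case=> [[x []]|[]]; apply/eqP => -[].
- move=> x; rewrite shape_square_factor; congr (_ :: nseq _ _).
  have := size_star x; have : 0 < #|T| by apply/card_gt0P; exists x.
  by lia.
- exact: uniq_square_factor.
- exact: square_factor_cover.
Qed.
End TrianglesAndOneSquare.

(** For k = 1 the classes are single elements, and -3, -1, 1, 3 are all nonzero elements of F_5, so
    the multiplier is always 1. *)
Lemma exists_progression5 :
  (exists x0 e : 'F_5, e != 0 /\ forall d, d != 0 ->
    exists g j, [/\ chi 1 g = 1, (j < 4)%N & d = g * (x0 + 2%:R * e * j%:R)])%R.
Proof.
exists (- 3%:R)%R, 1%R; split=> // d d0.
have [j j4 ->] : exists2 j, j < 4 & (d = - 3%:R + 2%:R * j%:R)%R.
  case: d d0 => -[|[|[|[|[|//]]]]] i // _; [exists 2|exists 0|exists 3|exists 1] => //;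
  exact: val_inj.
by exists 1%R, j; split=> //; rewrite ?mulr1 ?mul1r // /chi expr1n.
Qed.

Theorem theorem26 (p : nat) (p_prime : prime p) (p_mod8 : p = 5 %[mod 8])
    (V : finType) (F : sgraph V) (F_order : #|V| = 2 * p)
    (F_2regular : regular 2 F) :
  OP_solvable F.
Proof.
have [cs [pcs cs3 ccs]] := cycle_decomposition F_2regular.
have L3 : all (leq 3) (shape cs) by rewrite all_map.
have sumL : sumn (shape cs) = 2 * p by rewrite -size_flatten (perm_size pcs) -cardE.
have p8 : p %% 8 = 5 by rewrite p_mod8.
have [p13|p13] := eqVneq p 13.
  by apply: OP_order26 ccs L3 => //; rewrite F_order p13.
have [sq|nsq] := boolP (perm_eq (shape cs) (4 :: nseq (size cs).-1 3)).
  have := perm_sumn sq; rewrite sumL /= sumn_nseq => sumL'.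
  (* From 2p = 4 + 3a follows p = 2 mod 3, hence p = 5 mod 24 and s = 1 mod 8; the Steiner system
     then has 3s + 1 = p - 1 points. *)
  pose s := (p - 2) %/ 3; have ps : p = 3 * s + 2 by rewrite /s; lia.
  have s1 : s %% 4 = 1 by lia.
  have [B stB] := steiner_of_gdd (gdd3_mod4 s1).
  apply: (OP_of_steiner stB F_2regular _ pcs ccs sq).
  by rewrite card_option card_prod !card_ord F_order; lia.
have p3 : ~~ (3 %| p).
  by rewrite (dvdn_prime2 (isT : prime 3) p_prime); lia.
have [|||a|S [L' pL loopL]] := @strip_tiling (shape cs) L3.
- by rewrite sumL; lia.
- by rewrite sumL; lia.
- by rewrite sumL dvdn_mulr.
- apply: contra nsq => pa; have := perm_size pa; rewrite size_map /= size_nseq => ->.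
  exact: pa.
have sumL' : sumn L' = 2 * p by rewrite -(perm_sumn pL).
have [|W] := circulant_of_loop _ loopL; first by lia.
rewrite sumL' => Wcov.
pose k := p %/ 4; have pk : p = (4 * k).+1 by rewrite /k; lia.
have k_odd : odd k by lia.
have [x0 [e [e0 AP]]] : (exists x0 e : 'F_p, e != 0 /\ forall d, d != 0 ->
    exists g j, [/\ chi k g = 1, (j < 4)%N & d = g * (x0 + 2%:R * e * j%:R)])%R.
  have [p5|p5] := eqVneq p 5.
    have k1 : k = 1 by rewrite /k p5.
    by rewrite k1 p5; apply: exists_progression5.
  by apply: exists_progression => //; lia.
exact: (OP_of_circulant p_prime pk k_odd e0 AP Wcov F_2regular F_order pcs ccs pL).
Qed.
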